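(* Let $\zeta_1,\dots,\zeta_n$ be algebraic functions over $k$ forming a set closed under Galois conjugation over $k$, and pairwise distinct modulo $\mathbb{Z}$ (i.e. $\zeta_i-\zeta_j\notin\mathbb{Z}$ for $i\neq j$). Then the functions $\Gamma(\nu-\zeta_1),\dots,\Gamma(\nu-\zeta_n)$ (considered on a non-empty open set $\Omega\subset\mathbb{C}$ on which the $\zeta_i$ and these functions are analytic) are differentially independent over $K$.
   Context: $\nu$ denotes the identity function on $\mathbb{C}$, $k$ the field of $1$-periodic meromorphic functions on $\mathbb{C}$, and $K=k(\nu)$ (note $\nu$ is transcendental over $k$). $\Gamma$ is Euler's gamma function. Functions $f_1,\dots,f_n$ analytic on a non-empty open subset of $\mathbb{C}$ are differentially independent over $K$ if the functions $\frac{d^j f_i}{d\nu^j}$, $i=1,\dots,n$, $j\geq0$, are algebraically independent over $K$ (no non-trivial algebraic differential relation with coefficients in $K$ with respect to $D=\frac{d}{d\nu}$). *)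

(* Defs.v *)
From HB Require Import structures.
From mathcomp Require Import all_boot all_order all_algebra complex.
From mathcomp Require Import all_classical all_reals all_analysis.
(* Not imported: its notations clash with those of the files above. *)
From mathcomp Require mpoly.

Set Implicit Arguments.
Unset Strict Implicit.
Unset Printing Implicit Defensive.

Import Order.TTheory GRing.Theory Num.Theory.
Import numFieldNormedType.Exports.

Local Open Scope classical_set_scope.
Local Open Scope ring_scope.

(* Typed as a [numClosedFieldType], so that the complex numbers get the norm
   and the topology defined generically on such fields. *)
Definition CC (R : realType) : numClosedFieldType := R[i].

(* The type [CC R -> CC R] carries the pointwise ring structure, so that
   [{poly (CC R -> CC R)}] is the type of polynomials with functions as
   coefficients, and [p.[f]] is the function [z |-> \sum_i p`_i z * f z ^+ i]. *)

Definition analytic_at (R : realType) (f : CC R -> CC R) (z0 : CC R) : Prop :=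
  exists (a : nat -> CC R) (r : CC R), 0 < r /\
    forall z : CC R, `|z - z0| < r ->
      series (fun n => a n * (z - z0) ^+ n) @ \oo --> f z.

Definition analytic_on (R : realType) (U : set (CC R)) (f : CC R -> CC R) :
  Prop := forall z0, U z0 -> analytic_at f z0.

(* A meromorphic function is represented by a total function whose values are
   irrelevant at isolated points, in particular at the poles.  Two
   representatives give the same meromorphic function on [U] when they agree on
   a punctured neighbourhood of each point of [U]. *)
Definition mero_eq (R : realType) (U : set (CC R)) (f g : CC R -> CC R) :
  Prop := forall z0, U z0 -> \forall z \near z0^', f z = g z.

Definition meromorphic (R : realType) (f : CC R -> CC R) : Prop :=
  forall z0 : CC R, exists (n : nat) (g : CC R -> CC R),
    analytic_at g z0 /\ \forall z \near z0^', f z = g z / (z - z0) ^+ n.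

(* The field k. *)
Definition periodic_field (R : realType) (f : CC R -> CC R) : Prop :=
  meromorphic f /\ mero_eq setT (fun z => f (z + 1)) f.

(* The field K = k(nu): nu is the identity function, and an element of K is a
   quotient p(nu) / q(nu) with p, q in k[X] and q(nu) nonzero. *)
Definition rational_field (R : realType) (f : CC R -> CC R) : Prop :=
  exists p q : {poly (CC R -> CC R)},
    [/\ forall i, periodic_field p`_i,
        forall i, periodic_field q`_i,
        ~ mero_eq setT q.[id] 0
      & mero_eq setT (f * q.[id]) p.[id]].

(* In the definitions below, [F] is a field of meromorphic functions on the
   complex plane, given by the set of all representatives of its elements. *)

Definition algebraic_over (R : realType) (U : set (CC R))
    (F : (CC R -> CC R) -> Prop) (f : CC R -> CC R) : Prop :=
  exists p : {poly (CC R -> CC R)},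
    [/\ forall i, F p`_i,
        exists i, ~ mero_eq setT p`_i 0
      & mero_eq U p.[f] 0].

Definition is_minpoly (R : realType) (U : set (CC R))
    (F : (CC R -> CC R) -> Prop) (f : CC R -> CC R)
    (p : {poly (CC R -> CC R)}) : Prop :=
  [/\ p \is monic, forall i, F p`_i, mero_eq U p.[f] 0
    & forall q : {poly (CC R -> CC R)},
        q \is monic -> (forall i, F q`_i) -> mero_eq U q.[f] 0 ->
        (size p <= size q)%N].

(* The Galois conjugates of [f i] over [F] are the roots of its minimal
   polynomial over [F]: they all belong to the family [f] exactly when this
   polynomial is a product of factors X - f j. *)
Definition conjugation_closed (R : realType) (U : set (CC R))
    (F : (CC R -> CC R) -> Prop) (n : nat) (f : 'I_n -> CC R -> CC R) : Prop :=
  forall (i : 'I_n) (p : {poly (CC R -> CC R)}),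
    is_minpoly U F (f i) p ->
    exists s : seq 'I_n,
      forall d, mero_eq U p`_d (\prod_(j <- s) ('X - (f j)%:P))`_d.

(* Two algebraic functions are equal as soon as they agree on some non-empty
   open set, hence the quantification over [V].  It is only needed when [U] is
   not connected: otherwise V = U suffices, by the identity theorem. *)
Definition distinct_mod_int (R : realType) (U : set (CC R))
    (f g : CC R -> CC R) : Prop :=
  forall V : set (CC R), open V -> V !=set0 -> V `<=` U ->
    ~ exists m : int, forall z, V z -> f z - g z = m%:~R.

Definition algebraically_independent (R : realType) (U : set (CC R))
    (F : (CC R -> CC R) -> Prop) (I : Type) (f : I -> CC R -> CC R) : Prop :=
  forall (d : nat) (x : 'I_d -> I), injective x ->
  forall P : mpoly.mpoly d (CC R -> CC R),
    (forall m, F (mpoly.mcoeff m P)) ->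
    mero_eq U (mpoly.meval (fun l => f (x l)) P) 0 ->
    forall m, mero_eq setT (mpoly.mcoeff m P) 0.

Definition differentially_independent (R : realType) (U : set (CC R))
    (F : (CC R -> CC R) -> Prop) (n : nat) (f : 'I_n -> CC R -> CC R) : Prop :=
  algebraically_independent U F
    (fun ij : 'I_n * nat => derive1n ij.2 (f ij.1)).

Definition Cexp (R : realType) (z : CC R) : CC R :=
  (expR (complex.Re z) * cos (complex.Im z) +i*
   (expR (complex.Re z) * sin (complex.Im z)))%C.

(* Euler's limit n! n^z / (z (z + 1) ... (z + n)); the value at the poles
   0, -1, -2, ... is irrelevant. *)
Definition Gamma (R : realType) (z : CC R) : CC R :=
  limn (fun n : nat =>
    n`!%:R * Cexp (z * ((ln (n%:R : R))%:C)%C) / \prod_(k < n.+1) (z + k%:R)).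

(* Main.v *)
(* Hoelder's argument, carried out at a single generic point.

   Let [A] be the monic polynomial over k with the roots zeta_i.  Choose [z] such
   that, along the whole horizontal line through [z], all the data over k are
   holomorphic and [A] is separable, without roots of the form w + l with l in N,
   so that the line avoids the poles of the Gamma(nu - zeta_i).  A differential
   relation near [z] between these functions can be continued along this line,
   the roots of [A] being followed, and at [z + m] they are a permutation of the
   zeta_i(z) by periodicity.  Hence, for every natural number m and up to a
   permutation, the Taylor coefficients at [z] of u |-> Gamma(u + m - zeta_i(u))
   satisfy a polynomial relation whose coefficients are polynomials in m.  These
   jets satisfy y_i(m + 1) = (m - c_i) y_i(m), where the c_i = zeta_i - nu have
   constant terms distinct modulo Z and nonzero linear terms.

   In a nonzero relation W with minimal leading monomial a and leading coefficient
   u, comparing m with m + K gives, identically in m and y,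
       u(m) W(m + K; phi_K(m) y) = u(m + K) phi_K(m)^a W(m; y),
   where phi_K(m) = prod_(k < K) (m + k - c_i).  Specializing m to c_i(0) - k shows
   that no variable of index i occurs in W: either y_i(0) divides W, against
   minimality, or the top order coefficient drops out of W.  So W is a polynomial
   in m alone, vanishing at all natural numbers. *)

From HB Require Import structures.
From mathcomp Require Import all_boot all_order all_algebra complex.
From mathcomp Require mpoly.

Set Implicit Arguments.
Unset Strict Implicit.
Unset Printing Implicit Defensive.

Import Order.TTheory GRing.Theory Num.Theory.

(** * Polynomial relations between jets *)

Module HolderAlgebra.
Import mpoly.
Local Open Scope ring_scope.

(** Periodicity is what makes a single point enough: coefficients over k take the same values at z
    and z + m, so only nu = z + m varies and a coefficient in k[nu] becomes a complex polynomial in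
    m. Relations indexed by the natural numbers m then replace the shift operator on functions.

    The comparison uses every K, not only K = 1, because phi_K(m) has a zero constant term for
    finitely many m only, while an identity in m needs infinitely many specializations. A variable K
    also allows one of the two ends m, m + K to be kept away from the roots of u while the other one
    runs through an infinite set.

    At m = c_i(0) - k with k < K, exactly one factor of phi_K for the index i vanishes at the
    origin, and the nonzero linear term of c_i makes this zero simple. Multiplication by phi_K then
    acts on the jet of index i as a shift by exactly one order followed by an invertible map, and on
    the other jets as an invertible map. *)

Lemma nonroot_ge (F : fieldType) (p : {poly F}) (s : nat -> F) (k0 : nat) :
  injective s -> p != 0 -> exists2 k, (k0 <= k)%N & p.[s k] != 0.
Proof.
move=> s_inj p0; case: (boolP [exists i : 'I_(size p), p.[s (k0 + i)%N] != 0]).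
  by move=> /existsP[i ?]; exists (k0 + i)%N; rewrite ?leq_addr.
rewrite negb_exists => /forallP p_roots.
pose rs := [seq s k | k <- iota k0 (size p)].
have rs_roots : all (root p) rs.
  apply/allP => x /mapP[k]; rewrite mem_iota => /andP[le_k0k lt_k] ->.
  have lt_k' : (k - k0 < size p)%N by rewrite ltn_subLR.
  have := p_roots (Ordinal lt_k'); rewrite negbK /= subnKC //.
have := max_poly_roots p0 rs_roots.
by rewrite map_inj_uniq // iota_uniq size_map size_iota ltnn => /(_ isT).
Qed.

Lemma poly_injective_roots (F : fieldType) (p : {poly F}) (s : nat -> F)
    (k0 : nat) :
  injective s -> (forall k, (k0 <= k)%N -> p.[s k] = 0) -> p = 0.
Proof.
move=> s_inj p0; apply/eqP; apply: contraT => /(nonroot_ge k0 s_inj)[k /p0 ->].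
by rewrite eqxx.
Qed.

Lemma natr_injective (F : numFieldType) (c : F) :
  injective (fun k : nat => c + k%:R).
Proof. by move=> k l /addrI /eqP; rewrite eqr_nat => /eqP. Qed.

Lemma natrN_injective (F : numFieldType) (c : F) :
  injective (fun k : nat => c - k%:R).
Proof. by move=> k l /addrI /oppr_inj /eqP; rewrite eqr_nat => /eqP. Qed.

(** Uniqueness of the expansion in base [B], one digit at a time by reduction modulo [B]. It
    separates the monomials under Kronecker's substitution. *)
Lemma digits_inj (B N : nat) (f g : nat -> nat) :
  (forall i, f i < B)%N -> (forall i, g i < B)%N ->
  (\sum_(i < N) f i * B ^ i = \sum_(i < N) g i * B ^ i)%N ->
  forall i, (i < N)%N -> f i = g i.
Proof.
elim: N f g => // N IHN f g f_lt g_lt.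
have B_gt0 : (0 < B)%N by apply: leq_ltn_trans (f_lt 0%N).
have split (h : nat -> nat) : (\sum_(i < N.+1) h i * B ^ i =
    (\sum_(i < N) h i.+1 * B ^ i) * B + h 0)%N.
  rewrite big_ord_recl expn0 muln1 addnC big_distrl /=; congr addn.
  by apply: eq_bigr => i _; rewrite /bump /= add1n expnSr mulnA.
rewrite !split => E.
have E0 : f 0%N = g 0%N.
  by have := congr1 (modn^~ B) E; rewrite /= !modnMDl !modn_small.
move: E; rewrite E0 => /addIn /eqP; rewrite eqn_pmul2r // => /eqP E.
by move=> [|i] // lt_iN; apply: (IHN (f \o S) (g \o S)) => //= k.
Qed.

Lemma mpoly_eq0_eval (F : numFieldType) (N : nat) (W : {mpoly F[N]}) :
  (forall v, W.@[v] = 0) -> W = 0.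
Proof.
move=> W0; apply/mpolyP => mu; rewrite mcoeff0.
case: (boolP (mu \in msupp W)) => [mu_in|]; last first.
  by rewrite mcoeff_msupp negbK => /eqP.
(* Kronecker's substitution X_i := t ^ (B ^ i). *)
pose B := msize W; pose kappa (m : 'X_{1..N}) := (\sum_(i < N) m i * B ^ i)%N.
pose q : {poly F} := \sum_(m <- msupp W) W@_m *: 'X^(kappa m).
have q0 : q = 0.
  apply: (@poly_injective_roots F q _ 0%N (@natr_injective F 0)) => k _.
  rewrite /q horner_sum -[RHS](W0 (fun i : 'I_N => (0 + k%:R) ^+ (B ^ i))).
  rewrite mevalE; apply: eq_bigr => m _; rewrite hornerZ hornerXn; congr (_ * _).
  rewrite /kappa -prodrXr; apply: eq_bigr => i _.
  by rewrite -exprM mulnC.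
have m_lt m i : m \in msupp W -> (m i < B)%N.
  move=> /msize_mdeg_lt; apply: leq_ltn_trans; rewrite mdegE (bigD1 i) //=.
  exact: leq_addr.
have kappa_inj m : m \in msupp W -> kappa m = kappa mu -> m = mu.
  move=> m_in E; apply/mnmP => i.
  have i0 : 'I_N := i.
  (* [digits_inj] takes digits indexed by all natural numbers, so exponents are padded with 0; the
     index [i] at hand shows that 0 is below [B]. *)
  pose ext (h : 'X_{1..N}) k := if insub k is Some j then h j else 0%N.
  have extE h (j : 'I_N) : ext h j = h j by rewrite /ext valK.
  have ext_lt h : h \in msupp W -> forall k, (ext h k < B)%N.
    move=> h_in k; rewrite /ext; case: insubP => [j _ _|_]; first exact: m_lt.
    exact: leq_ltn_trans (m_lt h i h_in).
  rewrite -!extE; apply: (@digits_inj B N) (ltn_ord i); try exact: ext_lt.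
  by move: E; rewrite /kappa; under eq_bigr do rewrite -extE;
    under [in RHS]eq_bigr do rewrite -extE.
have := congr1 (fun p : {poly F} => p`_(kappa mu)) q0.
rewrite coef0 /q coef_sum (bigD1_seq mu) ?msupp_uniq //=.
rewrite coefZ coefXn eqxx mulr1 big_seq_cond big1 ?addr0 // => m.
case/andP=> m_in m_neq; rewrite coefZ coefXn; case: eqP => [E|]; last by rewrite mulr0.
by move: m_neq; rewrite (kappa_inj m) // eqxx.
Qed.

(** The coefficient ring [{poly F}] consists of polynomials in m, kept apart from the jet variables:
    leading coefficients are then polynomials u(m), on which [shift] acts. *)
Definition specialize (F : fieldType) (N : nat) (m : F) (Y : 'I_N -> F)
  (W : {mpoly {poly F}[N]}) : F := mmap (horner_eval m) Y W.

(** For each [k] the specialized polynomial vanishes as a function of the variables, hence has zero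
    coefficients; each coefficient of [W] then has infinitely many roots [s k]. *)
Lemma specialize_eq0 (F : numFieldType) (N : nat) (W : {mpoly {poly F}[N]})
    (s : nat -> F) (k0 : nat) : injective s ->
  (forall k, (k0 <= k)%N -> forall Y, specialize (s k) Y W = 0) -> W = 0.
Proof.
move=> s_inj W0; apply/mpolyP => mu; rewrite mcoeff0.
apply: (@poly_injective_roots _ _ _ k0 s_inj) => k le_k.
have : map_mpoly (horner_eval (s k)) W = 0.
  apply: mpoly_eq0_eval => v; rewrite -[RHS](W0 k le_k v) /specialize.
  pose b := maxn (msize W) (msize (map_mpoly (horner_eval (s k)) W)).
  rewrite /meval (mmapE b) ?leq_maxr // (mmapE b) ?leq_maxl //.
  by apply: eq_bigr => m _; rewrite mcoeff_map_mpoly.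
by move/(congr1 (mcoeff mu)); rewrite mcoeff_map_mpoly mcoeff0.
Qed.

(** * Semi-invariance of a minimal relation between jets *)

Section Semiinvariant.
Variables (F : numFieldType) (n J N : nat).
Variables (own : 'I_N -> 'I_n) (od : 'I_N -> nat) (var : 'I_n -> nat -> 'I_N).
Hypothesis od_le : forall v, (od v <= J)%N.
Hypothesis own_var : forall i j, (j <= J)%N -> own (var i j) = i.
Hypothesis od_var : forall i j, (j <= J)%N -> od (var i j) = j.
Hypothesis var_own : forall v, var (own v) (od v) = v.
Hypothesis var_anti : forall i j j', (j < j' <= J)%N -> (var i j' < var i j)%N.
Variable c : 'I_n -> {poly F}.
Local Notation Wpoly := {mpoly {poly F}[N]}.
Implicit Types (W : Wpoly) (m : F) (y : 'I_n -> {poly F}) (K : nat).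

(* The variable [v] stands for the coefficient of order [od v] in the jet of
   index [own v]. *)
Definition ev m y W : F := specialize m (fun v => (y (own v))`_(od v)) W.

Definition phi i K m : {poly F} := \prod_(k < K) ((m + k%:R)%:P - c i).

(** The product [phi i K] with m left indeterminate: the outer variable is that of the jets, the
    inner one is m. *)
Definition Phi i K : {poly {poly F}} :=
  \prod_(k < K) (('X + k%:R%:P)%:P - map_poly polyC (c i)).

Lemma Phi_eval i K m : map_poly (horner_eval m) (Phi i K) = phi i K m.
Proof.
rewrite /Phi (rmorph_prod (map_poly (horner_eval m))); apply: eq_bigr => k _.
rewrite rmorphB /= map_polyC /= -map_poly_comp /= /horner_eval.
rewrite hornerD hornerX hornerC; congr (_ - _).
by apply: map_poly_id => x _ /=; rewrite hornerC.
Qed.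

Lemma phiD i K m : phi i K.+1 m = ((m + K%:R)%:P - c i) * phi i K m.
Proof. by rewrite /phi big_ord_recr mulrC. Qed.

Definition lin K v : Wpoly :=
  \sum_(l < (od v).+1) (Phi (own v) K)`_l *: 'X_(var (own v) (od v - l)).

Definition shift K : {poly F} -> {poly F} := comp_poly ('X + K%:R%:P).

(** Pullback of a relation along m -> m + K: [lin K v] is the coefficient of order [od v] in the
    product of [Phi] by the jet, so [sig K W] at (m, y) is [W] at (m + K, phi y). *)
Definition sig K W : Wpoly := mmap (@mpolyC N _ \o shift K) (lin K) W.

Lemma ev_lin m y K v :
  ev m y (lin K v) = (phi (own v) K m * y (own v))`_(od v).
Proof.
rewrite /ev /specialize /lin raddf_sum coefM; apply: eq_bigr => l _ /=.
rewrite mmapZ mmapX mmap1U own_var ?od_var ?(leq_trans (leq_subr _ _)) //.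
by rewrite -Phi_eval coef_map.
Qed.

Lemma ev_sig m y K W :
  ev m y (sig K W) = ev (m + K%:R) (fun i => phi i K m * y i) W.
Proof.
rewrite /ev /specialize /sig [mmap (_ \o _) _ _]/mmap raddf_sum [RHS]/mmap.
apply: eq_bigr => mu _ /=; rewrite rmorphM /= mmapC /= /horner_eval.
rewrite /shift horner_comp !hornerE; congr (_ * _).
rewrite /mmap1 (rmorph_prod (mmap (horner_eval m) (fun v => (y (own v))`_(od v)))).
apply: eq_bigr => v _ /=.
by rewrite rmorphXn /=; congr (_ ^+ _); have := ev_lin m y K v.
Qed.

Lemma mlead_sum_bound (I : Type) (r : seq I) (P : pred I) (G : I -> Wpoly) mu :
  (forall x, P x -> (mlead (G x) <= mu)%O) ->
  (mlead (\sum_(x <- r | P x) G x) <= mu)%O.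
Proof.
move=> G_le; elim/big_ind: _ => //; first by rewrite mlead0 le0m.
by move=> p q le_p le_q; apply: le_trans (mleadD_le p q) _; rewrite leUx le_p.
Qed.

Lemma var_lt i j j' : (j < j' <= J)%N -> (U_(var i j)%MM < U_(var i j')%MM)%O.
Proof.
move=> lt_jj'; apply/ltmcP; first by rewrite !mdeg1.
have lt_v := var_anti i lt_jj'.
exists (var i j') => [w lt_w|]; rewrite !mnm1E.
  have -> : (var i j == w) = false by apply/eqP => E; move: lt_w; rewrite -E ltnNge ltnW.
  by have -> : (var i j' == w) = false by apply/eqP => E; move: lt_w; rewrite -E ltnn.
have -> : (var i j == var i j') = false by apply/eqP => E; move: lt_v; rewrite E ltnn.
by rewrite eqxx.
Qed.

(** Besides [v], the coefficient of order [od v] of a product involves only variables of the same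
    index and of lower order, which are smaller monomials. A bound together with one coefficient is
    the form that passes to products by [mleadcMW]. *)
Lemma lin_lead K v :
  (mlead (lin K v) <= U_(v)%MM)%O /\ (lin K v)@_(U_(v)%MM) = (Phi (own v) K)`_0.
Proof.
have lt_l l : (0 < l <= od v)%N -> (U_(var (own v) (od v - l))%MM < U_(v)%MM)%O.
  case/andP=> l_gt0 le_l; rewrite -[v in X in (_ < X)%O]var_own; apply: var_lt.
  by rewrite od_le andbT ltn_subrL l_gt0 (leq_trans l_gt0).
split.
  apply: mlead_sum_bound => -[[|l] lt_lv] _ /=; apply: le_trans (mleadZ_le _ _) _.
    by rewrite mleadXm subn0 var_own.
  by rewrite mleadXm ltW // lt_l.
rewrite /lin big_ord_recl subn0 var_own mcoeffD mcoeffZ mcoeffXU eqxx mulr1.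
rewrite raddf_sum big1 ?addr0 // => l _ /=; rewrite mcoeffZ mcoeffX.
case: eqP => [E|]; rewrite ?mulr0 //.
by have := lt_l l.+1; rewrite E ltxx ltn_ord => /(_ isT).
Qed.

Lemma prod_lead K mu :
  (mlead (mmap1 (lin K) mu) <= mu)%O /\
  (mmap1 (lin K) mu)@_mu = \prod_v (Phi (own v) K)`_0 ^+ mu v.
Proof.
have exp_lead v k : (mlead (lin K v ^+ k) <= (U_(v) *+ k)%MM)%O /\
    (lin K v ^+ k)@_(U_(v) *+ k)%MM = (Phi (own v) K)`_0 ^+ k.
  have [le1 coef1] := lin_lead K v.
  elim: k => [|k [le_k coef_k]].
    by rewrite !expr0 mulm0n mlead1 lexx mcoeff1 eqxx.
  rewrite !exprS mulmS; split; last by rewrite mleadcMW // coef1 coef_k.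
  exact: le_trans (mleadM_le _ _) (lem_add le1 le_k).
suff gen (r : seq 'I_N) :
    (mlead (\prod_(v <- r) lin K v ^+ mu v) <= (\sum_(v <- r) U_(v) *+ mu v)%MM)%O /\
    (\prod_(v <- r) lin K v ^+ mu v)@_(\sum_(v <- r) U_(v) *+ mu v)%MM =
      \prod_(v <- r) (Phi (own v) K)`_0 ^+ mu v.
  by have := gen (index_enum _); rewrite -(multinomUE_id mu).
elim: r => [|v r [le_r coef_r]].
  by rewrite !big_nil mlead1 lexx mcoeff1 eqxx.
have [le_v coef_v] := exp_lead v (mu v).
rewrite !big_cons; split; last by rewrite mleadcMW // coef_v coef_r.
exact: le_trans (mleadM_le _ _) (lem_add le_v le_r).
Qed.

(** The substitution is triangular: a monomial below [mlead W] stays below it, so only the leading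
    term contributes to this coefficient. *)
Lemma sig_lead K W :
  (mlead (sig K W) <= mlead W)%O /\
  (sig K W)@_(mlead W) =
    shift K (W@_(mlead W)) * \prod_v (Phi (own v) K)`_0 ^+ mlead W v.
Proof.
rewrite /sig /mmap; split.
  rewrite big_seq; apply: mlead_sum_bound => mu mu_in.
  rewrite /= mul_mpolyC; apply: le_trans (mleadZ_le _ _) _.
  by apply: le_trans (prod_lead K mu).1 _; apply: msupp_le_mlead.
have [->|W0] := eqVneq W 0.
  by rewrite msupp0 big_nil mlead0 !mcoeff0 /shift comp_poly0 mul0r.
rewrite (bigD1_seq (mlead W)) ?mlead_supp ?msupp_uniq //= mcoeffD raddf_sum /=.
rewrite [X in _ + X]big1_seq ?addr0 => [|mu /andP[mu_neq mu_in]].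
  by rewrite mul_mpolyC mcoeffZ (prod_lead K _).2.
rewrite mul_mpolyC mcoeffZ [X in _ * X]mcoeff_gt_mlead ?mulr0 //.
apply: le_lt_trans (prod_lead K mu).1 _.
by rewrite lt_neqAle mu_neq msupp_le_mlead.
Qed.

(** Congruence modulo X^(J+1): polynomials stand for power series truncated at order [J]. *)
Definition eqJ (p q : {poly F}) := forall j, (j <= J)%N -> p`_j = q`_j.

Lemma eqJ_mul r p q : eqJ p q -> eqJ (r * p) (r * q).
Proof.
move=> E j le_j; rewrite !coefM; apply: eq_bigr => l _.
by rewrite E // (leq_trans (leq_subr _ _)).
Qed.

(** A series with nonzero constant term is invertible: a Bezout relation with X^(J+1) gives the
    inverse. *)
Lemma eqJ_solve (g r : {poly F}) : g`_0 != 0 -> exists x, eqJ (g * x) r.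
Proof.
move=> g0; have : coprimep g ('X ^+ J.+1).
  by apply: coprimep_expr; rewrite coprimepX rootE horner_coef0.
case/Bezout_coprimepP => [[u v]] /=; rewrite -size_poly_eq1 => /size_poly1P[d d0 E].
exists (d^-1 *: (u * r)) => j le_j.
have -> : g * (d^-1 *: (u * r)) = r - d^-1 *: (v * r) * 'X ^+ J.+1.
  have uE : u * g = d%:P - v * 'X ^+ J.+1 by rewrite -E addrK.
  rewrite -scalerAr mulrA (mulrC g u) uE mulrBl scalerBr mul_polyC scalerA mulVf //.
  by rewrite scale1r -scalerAl mulrAC.
by rewrite coefB coefMXn ltnS le_j subr0.
Qed.

Lemma ev_eqJ m y y' W : (forall i, eqJ (y i) (y' i)) -> ev m y W = ev m y' W.
Proof.
move=> E; apply: eq_bigr => mu _; congr (_ * _).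
by apply: mmap1_eq => v; apply: E.
Qed.

Lemma specialize_ev m (Y : 'I_N -> F) W :
  specialize m Y W = ev m (fun i => \poly_(j < J.+1) Y (var i j)) W.
Proof.
apply: eq_bigr => mu _; congr (_ * _); apply: mmap1_eq => v.
by rewrite coef_poly ltnS od_le var_own.
Qed.

(** [W] with the variable [v] set to 0. Thus [kill v W = W] says that [v] does not occur in [W], and
    [kill v W = 0] that [W] is divisible by it. *)
Definition kill v W : Wpoly :=
  \sum_(mu <- msupp W | mu v == 0%N) W@_mu *: 'X_[mu].

Lemma mcoeff_kill v W mu : (kill v W)@_mu = if mu v == 0%N then W@_mu else 0.
Proof.
rewrite /kill raddf_sum /= -big_filter.
under eq_bigr do rewrite mcoeffZ mcoeffX.
case: (boolP (mu \in [seq nu : 'X_{1..N} <- msupp W | nu v == 0%N])) => [mu_in|mu_nin].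
  rewrite (bigD1_seq mu) ?filter_uniq ?msupp_uniq //= eqxx mulr1.
  rewrite big1 ?addr0 => [|nu /negPf ->]; last by rewrite mulr0.
  by move: mu_in; rewrite mem_filter => /andP[-> _].
rewrite big1_seq => [|nu /andP[_ nu_in]].
  move: mu_nin; rewrite mem_filter negb_and; case: eqP => //= _.
  by rewrite mcoeff_msupp negbK => /eqP.
by case: eqP => [E|]; rewrite ?mulr0 //; move: mu_nin; rewrite -E nu_in.
Qed.

Lemma specialize_kill m Y v W :
  specialize m Y (kill v W) = specialize m (fun w => if w == v then 0 else Y w) W.
Proof.
rewrite /specialize /kill raddf_sum [RHS]/mmap [RHS](bigID (fun mu : 'X_{1..N} => mu v == 0%N)).
rewrite /= [X in _ = _ + X]big1 ?addr0 => [|mu /negPf mu_v]; last first.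
  by rewrite /mmap1 (bigD1 v) //= eqxx expr0n mu_v mul0r mulr0.
apply: eq_bigr => mu /eqP mu_v; rewrite mmapZ mmapX; congr (_ * _).
by apply: eq_bigr => w _; case: eqP => [->|//]; rewrite mu_v !expr0.
Qed.

Lemma killP v W : kill v W = W -> forall mu, mu \in msupp W -> mu v = 0%N.
Proof.
move=> E mu; rewrite mcoeff_msupp -E mcoeff_kill.
by case: (mu v =P 0%N) => //; rewrite eqxx.
Qed.

Lemma kill0_div v W : kill v W = 0 -> exists W', W = 'X_v * W'.
Proof.
move=> E; exists (\sum_(mu <- msupp W) W@_mu *: 'X_[mu - U_(v)]).
rewrite mulr_sumr {1}[W]mpolyE; apply: eq_big_seq => mu mu_in.
rewrite -scalerAr -mpolyXD addmC submK // lep1mP.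
apply: contraL mu_in => mu_v; rewrite mcoeff_msupp negbK.
by have := mcoeff_kill v W mu; rewrite E mu_v mcoeff0 => <-.
Qed.

Hypothesis c_dist :
  forall (i j : 'I_n) (k l : nat), i != j -> (c i)`_0 + k%:R != (c j)`_0 + l%:R.
Hypothesis c_deriv : forall i, (c i)`_1 != 0.

Lemma phi0E i K m : (phi i K m)`_0 = \prod_(k < K) (m + k%:R - (c i)`_0).
Proof.
rewrite -horner_coef0 /phi horner_prod; apply: eq_bigr => k _.
by rewrite !hornerE horner_coef0.
Qed.

Lemma phi0_neq0 i j K k :
  i != j -> (phi j K ((c i)`_0 - k%:R))`_0 != 0.
Proof.
move=> ij; rewrite phi0E; apply/prodf_neq0 => l _.
rewrite subr_eq0; apply: contra (c_dist l k ij) => /eqP <-.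
by rewrite addrAC subrK.
Qed.

(** At this m only the factor of rank [k] vanishes at the origin, by characteristic 0, and its zero
    is simple because [c i] has a nonzero linear term. *)
Lemma phi_factor i K k : (k < K)%N ->
  exists2 g, phi i K ((c i)`_0 - k%:R) = 'X * g & g`_0 != 0.
Proof.
move=> lt_k; pose psi : {poly F} := \poly_(j < size (c i)) (c i)`_j.+1.
have cE : ((c i)`_0)%:P - c i = - ('X * psi).
  apply/polyP => -[|j]; rewrite !coefE //= ?subrr ?oppr0 //.
  rewrite sub0r; case: ltnP => // le_j; rewrite nth_default //.
  exact: leq_trans le_j _.
exists (- psi * \prod_(l < K | l != Ordinal lt_k)
          (((c i)`_0 - k%:R + l%:R)%:P - c i)).
  by rewrite /phi (bigD1 (Ordinal lt_k)) //= subrK cE mulNr mulNr mulrN mulrA.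
rewrite -horner_coef0 hornerM hornerN horner_prod mulf_neq0 //.
  rewrite oppr_eq0 horner_coef0 coef_poly; case: ltnP; rewrite ?c_deriv //.
  by move=> le0; move: (c_deriv i); rewrite nth_default ?eqxx // (leq_trans le0).
apply/prodf_neq0 => l lk; rewrite !hornerE horner_coef0 addrAC [X in X + _]addrAC subrr sub0r addrC.
rewrite subr_eq0 eqr_nat; apply: contra lk => /eqP E.
exact/eqP/val_inj.
Qed.

Variable y : 'I_n -> nat -> {poly F}.
Hypothesis y_rec : forall i (m : nat), eqJ (y i m.+1) ((m%:R%:P - c i) * y i m).
Hypothesis y0 : forall i (m : nat), (y i m)`_0 != 0.

Lemma y_shift i K (m : nat) : eqJ (phi i K m%:R * y i m) (y i (m + K)%N).
Proof.
elim: K => [|K IHK] j le_j; first by rewrite /phi big_ord0 mul1r addn0.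
rewrite addnS y_rec // phiD -natrD -mulrA; exact: eqJ_mul.
Qed.

Definition vanishing W := forall m : nat, ev m%:R (y^~ m) W = 0.

Lemma sig_vanishing K W : vanishing W -> vanishing (sig K W).
Proof.
move=> W0 m; rewrite ev_sig -natrD -[RHS](W0 (m + K)%N).
by apply: ev_eqJ => i; apply: y_shift.
Qed.

(* The difference of the two sides is again a relation, with a smaller leading
   monomial. *)
Lemma semiinvariance W : vanishing W ->
  (forall W', vanishing W' -> (mlead W' < mlead W)%O -> W' = 0) ->
  forall K m x, (W@_(mlead W)).[m] * ev (m + K%:R) (fun i => phi i K m * x i) W =
    (W@_(mlead W)).[m + K%:R] * (\prod_v (phi (own v) K m)`_0 ^+ mlead W v) *
      ev m x W.
Proof.
move=> W0 W_min K m x; set a := mlead W; set u := W@_a.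
pose V := u *: sig K W - (shift K u * \prod_v (Phi (own v) K)`_0 ^+ a v) *: W.
have [le_sig coef_sig] := sig_lead K W.
have V0 : V = 0.
  have V_van : vanishing V.
    move=> k; rewrite /V /ev /specialize raddfB /= !mmapZ.
    have := W0 k; rewrite /ev /specialize => ->.
    by have := sig_vanishing K W0 k; rewrite /ev /specialize => ->; rewrite !mulr0 subr0.
  apply/eqP; apply: contraT => V_neq0.
  suff V_lt : (mlead V < mlead W)%O by rewrite (W_min V V_van V_lt) eqxx in V_neq0.
  rewrite lt_neqAle; apply/andP; split.
    apply: contraNneq V_neq0 => E; rewrite -mleadc_eq0 E.
    by rewrite /V mcoeffB !mcoeffZ coef_sig mulrC -/a -/u subrr.
  apply: le_trans (mleadB_le _ _) _; rewrite leUx.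
  by rewrite (le_trans (mleadZ_le _ _) le_sig) mleadZ_le.
have : ev m x V = 0 by rewrite V0 /ev /specialize raddf0.
rewrite /V /ev /specialize raddfB /= !mmapZ => /eqP; rewrite subr_eq0 => /eqP E.
have := ev_sig m x K W; rewrite /ev /specialize => <-.
rewrite [LHS]E rmorphM rmorph_prod /=; congr (_ * _ * _).
  by rewrite /horner_eval /shift horner_comp !hornerE.
by apply: eq_bigr => v _; rewrite rmorphXn /= -Phi_eval coef_map.
Qed.

(** Semi-invariance is used at m = c_i(0) - k, where phi_K has zero constant term at the index i. If
    a variable of index i occurs in the leading monomial, the right-hand side vanishes, so [W] is
    zero whenever y_i(0) = 0. Otherwise the factor on the right is nonzero, while the left-hand side
    sees y_i only through X y_i modulo X^(J+1), hence not its coefficient of top order. *)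
Lemma no_variable W : W != 0 -> vanishing W ->
  (forall W', vanishing W' -> (mlead W' < mlead W)%O -> W' = 0) ->
  forall i v, own v = i -> kill v W = W.
Proof.
move=> W_neq0 W0 W_min i.
have semi := semiinvariance W0 W_min.
set u := W@_(mlead W) in semi.
have u0 : u != 0 by rewrite mleadc_eq0.
have [k1 _ uk1] := nonroot_ge 0 (@natrN_injective F (c i)`_0) u0.
have [deg0|] := boolP [forall v, (own v == i) ==> (mlead W v == 0%N)]; last first.
  rewrite negb_forall => /existsP[v]; rewrite negb_imply => /andP[/eqP own_v av].
  have kill0 : kill (var i 0) W = 0.
    apply: (@specialize_eq0 _ _ _ _ 1 (@natr_injective F (c i)`_0)) => k2 k2_gt0 Y.
    rewrite specialize_kill specialize_ev; set x := (fun i => \poly_(_ < _) _).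
    have lt_k1 : (k1 < k1 + k2)%N by rewrite -addn1 leq_add2l.
    have [g gE g0] := phi_factor i lt_k1.
    (* m is fixed outside the roots of u, while m + K = c_i(0) + k2 takes infinitely many values; k2
       > 0 puts k1 below K. *)
    pose K := (k1 + k2)%N; pose m := (c i)`_0 - k1%:R.
    have [z zE] : exists z : 'I_n -> {poly F}, forall j, eqJ (phi j K m * z j) (x j).
      suff /fin_all_exists[z zE] : forall j, exists z, eqJ (phi j K m * z) (x j).
        by exists z.
      (* At the index i both sides are divisible by X, the constant term of [x i] having been set to
         0; the equation is divided by X and solved with [g]. *)
      move=> j; have [<-|ij] := eqVneq i j; last exact/eqJ_solve/phi0_neq0.
      pose x' : {poly F} := \poly_(l < J) (x i)`_l.+1.
      have [z zE] := eqJ_solve x' g0; exists z => l le_l.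
      rewrite gE -mulrA coefXM; case: l le_l => [|l] lt_l /=.
        by rewrite coef_poly eqxx.
      by rewrite zE ?(ltnW lt_l) // coef_poly lt_l.
    have := semi K m z; rewrite {1}/m -addrA addrA natrD addrA subrK.
    rewrite (ev_eqJ _ _ zE) => /eqP.
    rewrite (bigD1 v) //= own_v gE coefXM /= expr0n (negPf av) mul0r mulr0 mul0r.
    by rewrite mulf_eq0 (negPf uk1) => /eqP.
  have [W' WE] := kill0_div kill0.
  have W'0 : W' != 0 by apply: contraNneq W_neq0 => E; rewrite WE E mulr0.
  suff : W' = 0 by move=> E; rewrite E eqxx in W'0.
  (* Since y_i(0) never vanishes on the given jets, the quotient [W'] is again a relation, with a
     smaller leading monomial. *)
  apply: W_min => [m|].
    have := W0 m; rewrite WE /ev /specialize rmorphM /= mmapX mmap1U.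
    by rewrite own_var // od_var // => /eqP; rewrite mulf_eq0 (negPf (y0 _ _)) => /eqP.
  rewrite WE mleadM // ?mleadXm; last first.
    by apply: contraNneq W_neq0 => E; rewrite WE E mul0r.
  by rewrite -[X in (X < _)%O]add0m ltmc_add2l lt_mdeg_ltmc // mdeg0 mdeg1.
have [k2 k2_gt0 uk2] := nonroot_ge 1 (@natr_injective F (c i)`_0) u0.
(* Descending induction on the order: variables of index i and of order above [od v] are already
   known not to occur. *)
suff kill_lt d v : own v = i -> (J - od v < d)%N -> kill v W = W.
  by move=> v own_v; apply: (kill_lt (J - od v).+1).
elim: d v => // d IHd v own_v lt_d; apply/eqP; rewrite -subr_eq0; apply/eqP.
apply: (@specialize_eq0 _ _ _ _ 0 (@natrN_injective F (c i)`_0)) => k _ Y.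
rewrite /specialize raddfB /=; apply/eqP; rewrite subr_eq0; apply/eqP.
rewrite -!/(specialize _ _ _) specialize_kill !specialize_ev.
set x' := (fun i => \poly_(_ < _) _); set x := (fun i => \poly_(_ < _) Y _).
(* The roles are exchanged: m + K = c_i(0) + k2 is fixed outside the roots of u and m takes
   infinitely many values. *)
pose K := (k + k2)%N; pose m := (c i)`_0 - k%:R.
have lt_k : (k < K)%N by rewrite -addn1 leq_add2l.
have [g gE g0] := phi_factor i lt_k.
have x_own j : j != i -> x' j = x j.
  move=> ji; apply: eq_poly => l lt_l; case: eqP => // E; move: ji.
  by rewrite -own_v -E own_var ?eqxx.
(* The coefficient of order [od w] of X g x_i involves x_i in orders below [od w] only. For
   [od w <= od v], setting the coefficient of order [od v] to 0 has no effect. *)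
have E : ev (m + K%:R) (fun i => phi i K m * x' i) W =
         ev (m + K%:R) (fun i => phi i K m * x i) W.
  rewrite /ev /specialize /mmap !big_seq; apply: eq_bigr => mu mu_in; congr (_ * _).
  apply: eq_bigr => w _; have [own_w|own_w] := eqVneq (own w) i; last by rewrite x_own.
  have [le_w|lt_w] := leqP (od w) (od v); last first.
    have lt_wJ : (od v < J)%N := leq_trans lt_w (od_le w).
    have lt_wd : (J - od w < d)%N := leq_trans (ltn_sub2l lt_wJ lt_w) lt_d.
    by rewrite (killP (IHd w own_w lt_wd) mu_in) !expr0.
  congr (_ ^+ _); rewrite own_w gE -!mulrA !coefXM; case: eqP => // /eqP w0.
  rewrite !coefM; apply: eq_bigr => l _; congr (_ * _).
  rewrite !coef_poly; case: ltnP => // lt_l; case: eqP => // Ev.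
  have : (od v < od w)%N by rewrite -Ev od_var // (leq_ltn_trans (leq_subr _ _)) // prednK ?lt0n.
  by rewrite ltnNge le_w.
have coef_neq0 : u.[m + K%:R] * (\prod_w (phi (own w) K m)`_0 ^+ mlead W w) != 0.
  rewrite {1}/m natrD addrA subrK mulf_neq0 //; apply/prodf_neq0 => w _.
  have := forallP deg0 w; have [own_w /eqP ->|own_w _] := eqVneq (own w) i.
    by rewrite expr0 oner_neq0.
  by rewrite expf_neq0 // phi0_neq0 // eq_sym.
by apply: (mulfI coef_neq0); rewrite -!semi E.
Qed.

(** Induction on the leading monomial, for a well-founded order, supplies the minimality required by
    [no_variable]. *)
Theorem vanishing_eq0 W : vanishing W -> W = 0.
Proof.
move Ea : (mlead W) => a.
elim/(well_founded_ind (@ltom_wf N)) : a W Ea => a IH W Ea W0.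
apply: contraTeq isT => W_neq0.
have W_var v : kill v W = W.
  by apply: (no_variable W_neq0 W0 _ (erefl (own v))) => W' W'0; rewrite Ea => /IH; apply.
have WC : W = (W@_0%MM)%:MP.
  apply/mpolyP => mu; rewrite mcoeffC; case: eqP => [->|mu0]; first by rewrite mulr1.
  rewrite mulr0; apply/eqP; rewrite mcoeff_eq0; apply/negP => mu_in; case: mu0.
  by apply/mnmP => v; rewrite mnmE (killP (W_var v)).
suff W00 : W@_0%MM = 0 by rewrite WC W00 mpolyC0 eqxx in W_neq0.
apply: (@poly_injective_roots _ _ _ 0 (@natr_injective F 0)) => k _.
by have := W0 k; rewrite WC /ev /specialize mmapC add0r mcoeffC eqxx mulr1.
Qed.

End Semiinvariant.

(** * Numbering of the jet variables *)

Section JetVariables.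
Variables n J : nat.

(* Variables of higher order come first, hence are larger in the monomial
   order: multiplying a jet by a jet is then triangular. *)
Lemma jet_var_subproof (i : 'I_n) j : ((J - j) * n + i < J.+1 * n)%N.
Proof.
by rewrite mulSnr -addnS leq_add // leq_mul2r leq_subr orbT.
Qed.
Definition jet_var i j : 'I_(J.+1 * n) := Ordinal (jet_var_subproof i j).

Lemma jet_own_subproof (v : 'I_(J.+1 * n)) : (v %% n < n)%N.
Proof. by rewrite ltn_pmod //; case: n v => [|//] [v]; rewrite muln0. Qed.
Definition jet_own v : 'I_n := Ordinal (jet_own_subproof v).

Definition jet_order (v : 'I_(J.+1 * n)) : nat := (J - v %/ n)%N.

Lemma jet_order_le v : (jet_order v <= J)%N. Proof. exact: leq_subr. Qed.

Lemma jet_own_var i j : (j <= J)%N -> jet_own (jet_var i j) = i.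
Proof. by move=> _; apply: val_inj; rewrite /= modnMDl modn_small. Qed.

Lemma jet_order_var i j : (j <= J)%N -> jet_order (jet_var i j) = j.
Proof.
move=> le_j; have n_gt0 : (0 < n)%N by apply: leq_ltn_trans (ltn_ord i).
by rewrite /jet_order /= divnMDl // divn_small // addn0 subKn.
Qed.

Lemma jet_var_own v : jet_var (jet_own v) (jet_order v) = v.
Proof.
apply: val_inj; rewrite /= /jet_order subKn -?divn_eq //.
by rewrite -ltnS ltn_divLR ?ltn_ord // (leq_ltn_trans _ (jet_own_subproof v)).
Qed.

Lemma jet_var_anti i j j' :
  (j < j' <= J)%N -> (jet_var i j' < jet_var i j)%N.
Proof.
case/andP=> lt_j le_j'; rewrite /= ltn_add2r ltn_pmul2r ?ltn_sub2l //.
  exact: leq_trans lt_j le_j'.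
exact: leq_ltn_trans (ltn_ord i).
Qed.

End JetVariables.

(** The permutation [tau] depends on m, so the product of the [W tau] over all permutations is
    formed: it is a relation for every m. Its vanishing makes one factor zero, and that factor is
    [P] up to an injective renaming and a rescaling of the variables. The scalars [f] absorb the
    factorials between derivatives and Taylor coefficients. *)
Theorem jets_algebraically_independent (F : numFieldType) (n J d : nat)
    (c : 'I_n -> {poly F}) (y : 'I_n -> nat -> {poly F})
    (x : 'I_d -> 'I_n * nat) (f : 'I_d -> F) (P : {mpoly {poly F}[d]}) :
  (forall (i j : 'I_n) (k l : nat),
     i != j -> (c i)`_0 + k%:R != (c j)`_0 + l%:R) ->
  (forall i, (c i)`_1 != 0) ->
  (forall i (m j : nat), (j <= J)%N ->
     (y i m.+1)`_j = ((m%:R%:P - c i) * y i m)`_j) ->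
  (forall i (m : nat), (y i m)`_0 != 0) ->
  injective x -> (forall l, (x l).2 <= J)%N -> (forall l, f l != 0) ->
  (forall m : nat, exists2 tau : 'I_n -> 'I_n, injective tau &
     specialize m%:R (fun l => f l * (y (tau (x l).1) m)`_(x l).2) P = 0) ->
  P = 0.
Proof.
move=> c_dist c_deriv y_rec y0 x_inj x_le f0 P0.
pose u (tau : {ffun 'I_n -> 'I_n}) l := jet_var J (tau (x l).1) (x l).2.
pose W tau : {mpoly {poly F}[J.+1 * n]} :=
  mmap (@mpolyC _ _) (fun l => (f l)%:P *: 'X_(u tau l)) P.
have W_eval tau m Y : specialize m Y (W tau) = specialize m (fun l => f l * Y (u tau l)) P.
  rewrite /W /specialize [mmap (@mpolyC _ _) _ _]/mmap raddf_sum [RHS]/mmap.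
  apply: eq_bigr => mu _ /=; rewrite rmorphM /= mmapC; congr (_ * _).
  rewrite /mmap1 (rmorph_prod (mmap (horner_eval m) Y)); apply: eq_bigr => l _.
  by rewrite rmorphXn /= mmapZ mmapX mmap1U /= /horner_eval hornerC.
have : \prod_(tau : {ffun 'I_n -> 'I_n} | injectiveb tau) W tau = 0.
  apply: (@vanishing_eq0 F n J _ (@jet_own n J) (@jet_order n J) (@jet_var n J)
    (@jet_order_le n J) (@jet_own_var n J) (@jet_order_var n J)
    (@jet_var_own n J) (@jet_var_anti n J) c c_dist c_deriv y y_rec y0) => m.
  have [tau tau_inj E] := P0 m; pose t := [ffun i => tau i].
  have t_inj : injectiveb t by apply/injectiveP => i j; rewrite !ffunE => /tau_inj.
  rewrite /ev /specialize rmorph_prod (bigD1 t) //=.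
  have := W_eval t m%:R; rewrite /specialize => ->.
  rewrite [X in X * _](_ : _ = 0) ?mul0r // -[RHS]E.
  apply: eq_bigr => mu _; congr (_ * _); apply: mmap1_eq => l.
  by rewrite jet_own_var ?jet_order_var // ffunE.
move/eqP; rewrite prodf_seq_eq0 => /hasP[tau _ /andP[/injectiveP tau_inj /eqP W0]].
apply: (@specialize_eq0 _ _ _ _ 0 (@natr_injective F 0)) => k _ Z.
have u_inj : injective (u tau).
  move=> l l' E; apply: x_inj; rewrite [x l]surjective_pairing [x l']surjective_pairing.
  have := congr1 (@jet_own n J) E; have := congr1 (@jet_order n J) E.
  by rewrite !jet_own_var ?jet_order_var // => -> /tau_inj ->.
pose Y v := if [pick l | u tau l == v] is Some l then (f l)^-1 * Z l else 0.
have := W_eval tau (0 + k%:R) Y; rewrite W0 /specialize raddf0 => E; rewrite [RHS]E.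
apply: eq_bigr => mu _; congr (_ * _); apply: mmap1_eq => l; rewrite /Y.
case: pickP => [l' /eqP/u_inj ->|/(_ l)]; last by rewrite eqxx.
by rewrite mulrA mulfV ?mul1r.
Qed.

(* An alias that carries its [eqType] structure where [mpoly] is not imported. *)
Definition exponent d : eqType := 'X_{1..d}.
Definition mult d (mu : exponent d) : 'I_d -> nat := fun_of_multinom mu.

Lemma eval_meval (S T : comNzRingType) (ev : {rmorphism S -> T}) (d : nat)
    (v : 'I_d -> S) (P : {mpoly S[d]}) :
  ev (meval v P) = \sum_(mu <- (msupp P : seq (exponent d)))
    ev P@_mu * \prod_l ev (v l) ^+ mult mu l.
Proof.
rewrite mevalE raddf_sum; apply: eq_bigr => mu _ /=; rewrite rmorphM rmorph_prod.
by congr (_ * _); apply: eq_bigr => l _; rewrite rmorphXn.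
Qed.

(** The relation is presented as a plain finite sum, the form in which the analytic side produces
    it. *)
Corollary jet_relations_trivial (F : numFieldType) (n J d : nat)
    (c : 'I_n -> {poly F}) (y : 'I_n -> nat -> {poly F})
    (x : 'I_d -> 'I_n * nat) (f : 'I_d -> F)
    (s : seq (exponent d)) (P : exponent d -> {poly F}) :
  (forall (i j : 'I_n) (k l : nat),
     i != j -> (c i)`_0 + k%:R != (c j)`_0 + l%:R) ->
  (forall i, (c i)`_1 != 0) ->
  (forall i (m j : nat), (j <= J)%N ->
     (y i m.+1)`_j = ((m%:R%:P - c i) * y i m)`_j) ->
  (forall i (m : nat), (y i m)`_0 != 0) ->
  injective x -> (forall l, (x l).2 <= J)%N -> (forall l, f l != 0) ->
  uniq s ->
  (forall m : nat, exists2 tau : 'I_n -> 'I_n, injective tau &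
     \sum_(mu <- s) (P mu).[m%:R] *
       \prod_l (f l * (y (tau (x l).1) m)`_(x l).2) ^+ mult mu l = 0) ->
  forall mu, mu \in s -> P mu = 0.
Proof.
move=> c_dist c_deriv y_rec y0 x_inj x_le f0 s_uniq rel mu mu_s.
pose W : {mpoly {poly F}[d]} := \sum_(mu <- s) P mu *: 'X_[mu].
have : W = 0.
  apply: (jets_algebraically_independent c_dist c_deriv y_rec y0 x_inj x_le f0).
  move=> m; have [tau tau_inj E] := rel m; exists tau => //; rewrite -[RHS]E.
  rewrite /specialize raddf_sum; apply: eq_bigr => nu _ /=.
  by rewrite mmapZ mmapX.
move=> /(congr1 (mcoeff mu)); rewrite mcoeff0 raddf_sum (bigD1_seq mu) //=.
rewrite mcoeffZ mcoeffX eqxx mulr1 big1 ?addr0 // => nu nu_mu.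
by rewrite mcoeffZ mcoeffX (negPf nu_mu) mulr0.
Qed.

End HolderAlgebra.

From mathcomp Require Import all_classical all_reals all_analysis.
From mathcomp Require Import perm separable cyclic cyclotomic.
From mathcomp Require Import ring lra.
Require Import Defs.
Import Order.TTheory GRing.Theory Num.Theory.
Import numFieldNormedType.Exports.
Local Open Scope classical_set_scope.
Local Open Scope ring_scope.

(** * Holomorphic functions *)

Section ComplexNorm.
Variable R : realType.
Local Notation C := (CC R).
Implicit Types (z w : C) (x : R).

(** The norm of [CC R] takes its values in [CC R] itself; values in the totally ordered field [R]
    make linear arithmetic available. *)
Definition nrm z : R := complex.Re `|z|.

Definition ofR x : C := (x%:C)%C.

Lemma normE z : `|z| = ofR (nrm z).
Proof. by rewrite /nrm /ofR RRe_real // normr_real. Qed.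

Lemma ofR_is_additive : additive ofR.
Proof. by move=> x y; rewrite /ofR rmorphB. Qed.

Lemma ofR_is_multiplicative : multiplicative ofR.
Proof. by split => [x y|]; rewrite /ofR ?rmorphM ?rmorph1. Qed.

HB.instance Definition _ := GRing.isAdditive.Build R C ofR ofR_is_additive.
HB.instance Definition _ :=
  GRing.isMultiplicative.Build R C ofR ofR_is_multiplicative.

Lemma ofR_inj : injective ofR. Proof. exact: complexI. Qed.
Lemma ler_ofR x y : (ofR x <= ofR y) = (x <= y). Proof. exact: lecR. Qed.
Lemma ltr_ofR x y : (ofR x < ofR y) = (x < y). Proof. exact: ltcR. Qed.

Lemma nrm_ge0 z : 0 <= nrm z.
Proof. by rewrite -ler_ofR -normE rmorph0 normr_ge0. Qed.
Lemma nrm0 : nrm 0 = 0. Proof. by apply: ofR_inj; rewrite -normE normr0 rmorph0. Qed.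
Lemma nrm1 : nrm 1 = 1. Proof. by apply: ofR_inj; rewrite -normE normr1 rmorph1. Qed.
Lemma nrm_eq0 z : (nrm z == 0) = (z == 0).
Proof. by rewrite -(inj_eq ofR_inj) -normE rmorph0 normr_eq0. Qed.
Lemma nrm_gt0 z : (0 < nrm z) = (z != 0).
Proof. by rewrite lt_neqAle nrm_ge0 andbT eq_sym nrm_eq0. Qed.
Lemma nrmN z : nrm (- z) = nrm z. Proof. by rewrite /nrm normrN. Qed.
Lemma nrmBC z w : nrm (z - w) = nrm (w - z). Proof. by rewrite /nrm distrC. Qed.
Lemma nrmD z w : nrm (z + w) <= nrm z + nrm w.
Proof. by rewrite -ler_ofR rmorphD -!normE ler_normD. Qed.
Lemma nrmB z w : nrm (z - w) <= nrm z + nrm w.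
Proof. by rewrite -(nrmN w) nrmD. Qed.
Lemma nrm_ge z w : nrm z - nrm w <= nrm (z - w).
Proof. by rewrite lerBlDr -{1}(subrK w z) nrmD. Qed.
Lemma nrm_triangle w z u : nrm (z - u) <= nrm (z - w) + nrm (w - u).
Proof. by rewrite -{1}(subrK w z) -addrA nrmD. Qed.
Lemma nrmM z w : nrm (z * w) = nrm z * nrm w.
Proof. by apply: ofR_inj; rewrite rmorphM -!normE normrM. Qed.
Lemma nrmX z n : nrm (z ^+ n) = nrm z ^+ n.
Proof. by apply: ofR_inj; rewrite rmorphXn -!normE normrX. Qed.
Lemma nrmV z : nrm z^-1 = (nrm z)^-1.
Proof. by apply: ofR_inj; rewrite fmorphV -!normE normfV. Qed.
Lemma nrm_ofR x : nrm (ofR x) = `|x|.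
Proof.
apply: ofR_inj; rewrite -normE; have [x_ge0|/ltW x_le0] := lerP 0 x.
  by rewrite !ger0_norm // -(rmorph0 ofR) ler_ofR.
by rewrite !ler0_norm // ?rmorphN // -(rmorph0 ofR) ler_ofR.
Qed.
Lemma nrm_nat n : nrm n%:R = n%:R.
Proof. by rewrite -(rmorph_nat ofR) nrm_ofR normr_nat. Qed.
Lemma nrm_sum (I : Type) (r : seq I) (P : pred I) (f : I -> C) :
  nrm (\sum_(i <- r | P i) f i) <= \sum_(i <- r | P i) nrm (f i).
Proof.
elim/big_rec2: _ => [|i x z _ le_zx]; first by rewrite nrm0.
by apply: le_trans (nrmD _ _) _; rewrite lerD2l.
Qed.

Lemma nrmE z : nrm z = Num.sqrt (complex.Re z ^+ 2 + complex.Im z ^+ 2).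
Proof. by apply: ofR_inj; rewrite -normE normc_def. Qed.
Lemma Re_le_nrm z : `|complex.Re z| <= nrm z.
Proof. by rewrite nrmE -sqrtr_sqr ler_wsqrtr // lerDl sqr_ge0. Qed.
Lemma Im_le_nrm z : `|complex.Im z| <= nrm z.
Proof. by rewrite nrmE -sqrtr_sqr ler_wsqrtr // lerDr sqr_ge0. Qed.
Lemma nrm_le_ReIm z : nrm z <= `|complex.Re z| + `|complex.Im z|.
Proof.
rewrite nrmE -[leRHS]ger0_norm ?addr_ge0 // -(sqrtr_sqr (_ + _)) ler_wsqrtr //.
by rewrite sqrrD !real_normK ?num_real // lerD2r lerDl mulrn_wge0 // mulr_ge0.
Qed.

Lemma ReB z w : complex.Re (z - w) = complex.Re z - complex.Re w.
Proof. by case: z w => [? ?] [? ?]. Qed.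
Lemma ImB z w : complex.Im (z - w) = complex.Im z - complex.Im w.
Proof. by case: z w => [? ?] [? ?]. Qed.

Lemma pos_ofR (e : C) : 0 < e -> exists2 x, 0 < x & e = ofR x.
Proof.
case: e => a b; rewrite ltcE /= => /andP[/eqP -> a_gt0].
by exists a.
Qed.

Lemma nearP z0 (P : C -> Prop) :
  (\forall z \near z0, P z) <->
  exists2 r : R, 0 < r & forall z, nrm (z - z0) < r -> P z.
Proof.
split.
  move=> /nbhs_normP[e /= /pos_ofR[r r0 ->] sub].
  by exists r => // z lt_z; apply: sub; rewrite /= distrC normE ltr_ofR.
case=> r r0 H; apply/nbhs_normP; exists (ofR r) => /=.
  by rewrite -(rmorph0 ofR) ltr_ofR.
by move=> z /=; rewrite distrC normE ltr_ofR; apply: H.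
Qed.

Lemma dnearP z0 (P : C -> Prop) :
  (\forall z \near z0^', P z) <->
  exists2 r : R, 0 < r & forall z, nrm (z - z0) < r -> z != z0 -> P z.
Proof. exact: (nearP z0 (fun z => z != z0 -> P z)). Qed.

Lemma openP (U : set C) :
  open U <-> forall z, U z -> exists2 r : R, 0 < r & forall w, nrm (w - z) < r -> U w.
Proof.
rewrite openE; split=> [oU z /oU /nearP //|H z /H Hz].
exact/nearP.
Qed.

Lemma cvgnP (u : nat -> C) l : u @ \oo --> l <->
  forall e : R, 0 < e -> exists N, forall n, (N <= n)%N -> nrm (u n - l) < e.
Proof.
split=> [/cvgrPdistC_lt H e e0|H].
  have /H[N _ HN] : 0 < ofR e by rewrite -(rmorph0 ofR) ltr_ofR.
  by exists N => n /HN /=; rewrite normE ltr_ofR.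
apply/cvgrPdistC_lt => _ /pos_ofR[e /H[N HN] ->]; exists N => // n /= /HN.
by rewrite normE ltr_ofR.
Qed.

Lemma complete_C (u : nat -> C) :
  (forall e : R, 0 < e -> exists N, forall n m, (N <= n)%N -> (N <= m)%N ->
     nrm (u n - u m) < e) ->
  exists l, forall e : R, 0 < e -> exists N, forall n, (N <= n)%N -> nrm (u n - l) < e.
Proof.
move=> u_cauchy.
have real_lim (f : C -> R) : (forall z w, `|f z - f w| <= nrm (z - w)) ->
    exists l : R, forall e : R, 0 < e ->
      exists N, forall n, (N <= n)%N -> `|f (u n) - l| < e.
  move=> f_le; have : cvgn (f \o u).
    apply/cauchy_cvgP/cauchy_exP => e e0; have [N HN] := u_cauchy e e0.
    exists (f (u N)); exists N => // n /= le_n.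
    by apply: le_lt_trans (f_le _ _) _; apply: HN.
  move=> /cvgrPdistC_lt H; exists (limn (f \o u)) => e /H[N _ HN].
  by exists N => n /HN.
have [|a Ha] := real_lim (@complex.Re R).
  by move=> z w; rewrite -ReB Re_le_nrm.
have [|b Hb] := real_lim (@complex.Im R).
  by move=> z w; rewrite -ImB Im_le_nrm.
exists (a +i* b)%C => e e0; have e2 : 0 < e / 2 by rewrite divr_gt0.
have [[N1 H1] [N2 H2]] := (Ha _ e2, Hb _ e2).
exists (maxn N1 N2) => n; rewrite geq_max => /andP[/H1 lt1 /H2 lt2].
apply: le_lt_trans (nrm_le_ReIm _) _; rewrite ReB ImB /= [e]splitr.
exact: ltrD.
Qed.

Definition has_derivative (f : C -> C) z d := forall e : R, 0 < e ->
  exists2 r : R, 0 < r &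
    forall h, nrm h < r -> nrm (f (z + h) - f z - d * h) <= e * nrm h.

Lemma has_derivativeE (f : C -> C) z d : has_derivative f z d -> derive1 f z = d.
Proof.
move=> fd; apply: cvg_lim => //.
apply/cvgrPdistC_lt => _ /pos_ofR[e e0 ->].
have e2 : 0 < e / 2 by rewrite divr_gt0.
have [r r0 Hr] := fd _ e2; apply/dnearP; exists r => // h.
rewrite subr0 => lt_h h0; rewrite normE ltr_ofR.
have -> : h^-1 *: (f (h + z) - f z) - d = h^-1 * (f (z + h) - f z - d * h).
  by rewrite mulrBr [h^-1 * (d * h)]mulrC mulfK // (addrC h).
rewrite nrmM nrmV mulrC ltr_pdivrMr ?nrm_gt0 //.
by apply: le_lt_trans (Hr _ lt_h) _; rewrite ltr_pM2r ?nrm_gt0 // ltr_pdivrMr // ltr_pMr // ltr1n.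
Qed.

End ComplexNorm.

(** * Uniform limits of polynomials on a disc *)

Section Approximation.
Variable R : realType.
Local Notation C := (CC R).
Implicit Types (z w : C) (f g : C -> C) (p q : {poly C}) (r e : R).

(* Uniform limits of polynomials on a disc replace power series: they are stable
   under all the operations needed, and in particular under locally uniform
   limits, without any appeal to path integrals. *)
Definition apx f z0 r := forall e, 0 < e ->
  exists p, forall z, nrm (z - z0) < r -> nrm (f z - p.[z]) < e.

Lemma poly_bounded p (M : R) : exists2 B, 0 < B & forall z, nrm z <= M -> nrm p.[z] <= B.
Proof.
elim/poly_ind: p => [|p c [B B0 IH]].
  by exists 1 => // z _; rewrite horner0 nrm0.
have M1 : 0 < `|M| + 1 by rewrite ltr_wpDl.
exists (B * (`|M| + 1) + nrm c + 1) => [|z le_z].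
  by rewrite ltr_wpDl // addr_ge0 ?nrm_ge0 // mulr_ge0 // ltW.
rewrite hornerMXaddC; apply: le_trans (nrmD _ _) _; rewrite nrmM.
rewrite -addrA [nrm c + 1]addrC addrA lerD2r ler_wpDr // ler_pM ?nrm_ge0 ?IH //.
by apply: le_trans le_z _; rewrite ler_wpDr // ler_norm.
Qed.

Lemma poly_lipschitz p (M : R) : exists2 L, 0 < L & forall z w,
  nrm z <= M -> nrm w <= M -> nrm (p.[z] - p.[w]) <= L * nrm (z - w).
Proof.
elim/poly_ind: p => [|p c [L L0 IH]].
  by exists 1 => // z w _ _; rewrite !horner0 subrr nrm0 mul1r nrm_ge0.
have [B B0 HB] := poly_bounded p M.
exists (L * (`|M| + 1) + B) => [|z w le_z le_w].
  by rewrite ltr_wpDl // mulr_ge0 ?addr_ge0 // ltW.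
have -> : (p * 'X + c%:P).[z] - (p * 'X + c%:P).[w] =
  (p.[z] - p.[w]) * z + p.[w] * (z - w) by rewrite !hornerMXaddC; ring.
apply: le_trans (nrmD _ _) _; rewrite !nrmM mulrDl lerD //; last first.
  by rewrite ler_wpM2r ?nrm_ge0 ?HB.
rewrite -mulrA [_ * nrm (z - w)]mulrC mulrA ler_pM ?nrm_ge0 ?IH //.
by apply: le_trans le_z _; rewrite ler_wpDr // ler_norm.
Qed.

Lemma apx_poly p z0 r : apx (horner p) z0 r.
Proof. by move=> e e0; exists p => z _; rewrite subrr nrm0. Qed.

Lemma apx_ext f g z0 r : (forall z, nrm (z - z0) < r -> f z = g z) ->
  apx g z0 r -> apx f z0 r.
Proof. by move=> fg Hg e /Hg[p Hp]; exists p => z Hz; rewrite fg ?Hp. Qed.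

Lemma apx_sub f z0 r z1 r1 : nrm (z1 - z0) + r1 <= r -> apx f z0 r -> apx f z1 r1.
Proof.
move=> le_r Hf e /Hf[p Hp]; exists p => z lt_z; apply: Hp.
apply: le_lt_trans (nrm_triangle z1 _ _) _; apply: lt_le_trans le_r.
by rewrite addrC ltrD2l.
Qed.

Lemma apx_le f z0 r r1 : r1 <= r -> apx f z0 r -> apx f z0 r1.
Proof. by move=> le_r; apply: apx_sub; rewrite subrr nrm0 add0r. Qed.

Lemma apx_bounded f z0 r : apx f z0 r ->
  exists2 M, 0 < M & forall z, nrm (z - z0) < r -> nrm (f z) <= M.
Proof.
move=> /(_ 1 ltr01)[p Hp]; have [B B0 HB] := poly_bounded p (nrm z0 + r).
exists (B + 1) => [|z lt_z]; first by rewrite addr_gt0.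
rewrite -(subrK p.[z] (f z)) addrC; apply: le_trans (nrmD _ _) _.
rewrite lerD ?(ltW (Hp _ _)) // HB // -(subrK z0 z) addrC.
by apply: le_trans (nrmD _ _) _; rewrite lerD2l ltW.
Qed.

Lemma apx_cst c z0 r : apx (fun=> c) z0 r.
Proof. by apply: apx_ext (apx_poly c%:P z0 r) => z _; rewrite hornerC. Qed.

Lemma apx_id z0 r : apx (fun z => z) z0 r.
Proof. by apply: apx_ext (apx_poly 'X z0 r) => z _; rewrite hornerX. Qed.

Lemma apxD f g z0 r : apx f z0 r -> apx g z0 r -> apx (fun z => f z + g z) z0 r.
Proof.
move=> Hf Hg e e0; have e2 : 0 < e / 2 by rewrite divr_gt0.
have [[p Hp] [q Hq]] := (Hf _ e2, Hg _ e2); exists (p + q) => z lt_z.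
rewrite hornerD opprD addrACA [e]splitr.
by apply: le_lt_trans (nrmD _ _) _; rewrite ltrD ?Hp ?Hq.
Qed.

Lemma apxN f z0 r : apx f z0 r -> apx (fun z => - f z) z0 r.
Proof.
move=> Hf e /Hf[p Hp]; exists (- p) => z lt_z.
by rewrite hornerN -opprD nrmN Hp.
Qed.

Lemma apxB f g z0 r : apx f z0 r -> apx g z0 r -> apx (fun z => f z - g z) z0 r.
Proof. by move=> Hf Hg; apply: apxD Hf (apxN Hg). Qed.

Lemma apxM f g z0 r : apx f z0 r -> apx g z0 r -> apx (fun z => f z * g z) z0 r.
Proof.
move=> Hf Hg e e0.
have [[A A0 HA] [B B0 HB]] := (apx_bounded Hf, apx_bounded Hg).
(* Approximations within d <= 1 give a product within d B + A d + d^2, which is at most d (A + B +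
   1). *)
pose d := Num.min 1 (e / (A + B + 1)).
have S0 : 0 < A + B + 1 by lra.
have d0 : 0 < d by rewrite lt_min ltr01 divr_gt0.
have d1 : d <= 1 by rewrite ge_min lexx.
have de : d * (A + B + 1) <= e by rewrite -ler_pdivlMr // ge_min lexx orbT.
have [[p Hp] [q Hq]] := (Hf _ d0, Hg _ d0); exists (p * q) => z lt_z.
have -> : f z * g z - (p * q).[z] = (f z - p.[z]) * g z + f z * (g z - q.[z])
    - (f z - p.[z]) * (g z - q.[z]) by rewrite hornerM; ring.
apply: lt_le_trans de; apply: le_lt_trans (nrmB _ _) _.
apply: le_lt_trans (lerD (nrmD _ _) (lexx _)) _; rewrite !nrmM.
have a0 := nrm_ge0 (f z - p.[z]); have b0 := nrm_ge0 (g z - q.[z]).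
have pd := Hp _ lt_z; have qd := Hq _ lt_z.
have h1 : nrm (f z - p.[z]) * nrm (g z) <= d * B.
  by apply: ler_pM; rewrite ?nrm_ge0 ?HB // ltW.
have h2 : nrm (f z) * nrm (g z - q.[z]) <= A * d.
  by apply: ler_pM; rewrite ?nrm_ge0 ?HA // ltW.
have h3 : nrm (f z - p.[z]) * nrm (g z - q.[z]) < d.
  apply: le_lt_trans (_ : d * nrm (g z - q.[z]) < d); first by rewrite ler_wpM2r // ltW.
  by rewrite -[ltRHS]mulr1 ltr_pM2l // (lt_le_trans qd).
by rewrite mulrDr mulrDr mulr1; lra.
Qed.

Lemma apx_lim f z0 r : (forall e, 0 < e -> exists2 g, apx g z0 r &
   forall z, nrm (z - z0) < r -> nrm (f z - g z) < e) -> apx f z0 r.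
Proof.
move=> H e e0; have e2 : 0 < e / 2 by rewrite divr_gt0.
have [g /(_ _ e2)[p Hp] Hg] := H _ e2; exists p => z lt_z.
apply: le_lt_trans (nrm_triangle (g z) _ _) _.
by rewrite [e]splitr ltrD ?Hp ?Hg.
Qed.

Lemma apxX f n z0 r : apx f z0 r -> apx (fun z => f z ^+ n) z0 r.
Proof.
move=> Hf; elim: n => [|n IHn].
  by apply: apx_ext (apx_cst 1 z0 r) => z _; rewrite expr0.
by apply: apx_ext (apxM Hf IHn) => z _; rewrite exprS.
Qed.

Lemma apx_sum (I : Type) (s : seq I) (P : pred I) (F : I -> C -> C) z0 r :
  (forall i, P i -> apx (F i) z0 r) -> apx (fun z => \sum_(i <- s | P i) F i z) z0 r.
Proof.
move=> HF; elim: s => [|i s IHs].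
  by apply: apx_ext (apx_cst 0 z0 r) => z _; rewrite big_nil.
case: (boolP (P i)) => Pi; last first.
  by apply: apx_ext IHs => z _; rewrite big_cons (negPf Pi).
by apply: apx_ext (apxD (HF i Pi) IHs) => z _; rewrite big_cons Pi.
Qed.


Lemma apx_horner p f z0 r : apx f z0 r -> apx (fun z => p.[f z]) z0 r.
Proof.
move=> Hf; apply: apx_ext (_ : apx (fun z => \sum_(i < size p) p`_i * f z ^+ i) z0 r).
  by move=> z _; rewrite horner_coef.
by apply: apx_sum => i _; apply: apxM (apx_cst _ _ _) (apxX _ Hf).
Qed.

Lemma apx_comp f g z0 r w0 s :
  apx f z0 r -> apx g w0 s -> (forall z, nrm (z - z0) < r -> nrm (f z - w0) < s) ->
  apx (fun z => g (f z)) z0 r.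
Proof.
move=> Hf Hg fs; apply: apx_lim => e /Hg[q Hq].
by exists (fun z => q.[f z]) => [|z lt_z]; [apply: apx_horner|apply/Hq/fs].
Qed.

Lemma apx_continuous f z0 r z : apx f z0 r -> nrm (z - z0) < r ->
  forall e, 0 < e -> exists2 d, 0 < d & forall w, nrm (w - z) < d -> nrm (f w - f z) < e.
Proof.
move=> Hf lt_z e e0; have e3 : 0 < e / 3 by rewrite divr_gt0.
have [p Hp] := Hf _ e3; have [L L0 HL] := poly_lipschitz p (nrm z0 + r).
exists (Num.min (r - nrm (z - z0)) (e / 3 / L)) => [|w].
  by rewrite lt_min subr_gt0 lt_z divr_gt0.
rewrite lt_min => /andP[w1 w2].
have lt_w : nrm (w - z0) < r.
  by apply: le_lt_trans (nrm_triangle z _ _) _; rewrite -ltrBrDr.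
have in_ball u : nrm (u - z0) < r -> nrm u <= nrm z0 + r.
  move=> lt_u; rewrite -(subrK z0 u) addrC; apply: le_trans (nrmD _ _) _.
  by rewrite lerD2l ltW.
have H1 := Hp _ lt_z; have H2 := Hp _ lt_w.
have H3 : nrm (p.[w] - p.[z]) < e / 3.
  apply: le_lt_trans (HL _ _ _ _) _; rewrite ?in_ball // mulrC.
  by rewrite -ltr_pdivlMr.
have := nrm_triangle p.[w] (f w) (f z); have := nrm_triangle p.[z] p.[w] (f z).
rewrite [nrm (p.[z] - f z)]nrmBC.
by move: H1 H2 H3; set a := nrm _; set b := nrm _; set c := nrm _; set d := nrm _; lra.
Qed.

Lemma prim_root_exists n : (0 < n)%N -> exists x : C, n.-primitive_root x.
Proof.
move=> n_gt0; pose p : {poly C} := 'X^n - 1.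
have [s Dp] := closed_field_poly_normal p.
rewrite (monicP _) ?monicXnsubC // scale1r in Dp.
have s1 : all n.-unity_root s by apply/allP => x; rewrite -root_prod_XsubC -Dp.
have sz_s : (n < (size s).+1)%N by rewrite -(size_prod_XsubC s id) -Dp size_XnsubC.
have [|x] := hasP (has_prim_root n_gt0 s1 _ sz_s); last by exists x.
by rewrite -separable_prod_XsubC -Dp separable_Xn_sub_1 // pnatr_eq0 -lt0n.
Qed.

(* Averaging over roots of unity replaces Cauchy's integral. *)
Lemma cauchy_estimate p (rho M : R) k : 0 < rho ->
  (forall z, nrm z = rho -> nrm p.[z] <= M) -> nrm p`_k * rho ^+ k <= M.
Proof.
(* [N] exceeds [k] and all exponents of [p], so these are distinct modulo [N] and averaging against
   the powers of x^(-k) isolates the coefficient of index [k]. *)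
move=> rho0 pM; pose N := (size p + k).+1.
have [x x_prim] : exists x : C, N.-primitive_root x by apply: prim_root_exists.
have xN : x ^+ N = 1 := prim_expr_order x_prim.
have x1 : nrm x = 1.
  apply/eqP; rewrite -(@pexpr_eq1 R _ N) ?nrm_ge0 // -nrmX xN nrm1 //.
have x0 : x != 0 by rewrite -nrm_eq0 x1 oner_eq0.
pose u j := ofR rho * x ^+ j.
have nu j : nrm (u j) = rho.
  by rewrite nrmM nrmX x1 expr1n mulr1 nrm_ofR gtr0_norm.
have sum_pow i : (i < N)%N -> i != k ->
    \sum_(j < N) (x ^+ i / x ^+ k) ^+ j = 0.
  move=> lt_i ik; set y := x ^+ i / x ^+ k.
  have yN : y ^+ N = 1 by rewrite expr_div_n -!exprM ![(_ * N)%N]mulnC !exprM xN !expr1n divr1.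
  have y1 : y - 1 != 0.
    rewrite subr_eq0; apply: contra ik => /eqP E.
    have : x ^+ i == x ^+ k by rewrite -[x ^+ i](divfK (expf_neq0 k x0)) -/y E mul1r.
    rewrite (eq_prim_root_expr x_prim) !modn_small // /N ltnS.
    by rewrite leq_addl.
  by apply: (mulfI y1); rewrite mulr0 -subrX1 yN subrr.
have key : N%:R * (p`_k * ofR rho ^+ k) = \sum_(j < N) p.[u j] / x ^+ k ^+ j.
  transitivity (\sum_(i < N) p`_i * ofR rho ^+ i * \sum_(j < N) (x ^+ i / x ^+ k) ^+ j).
    have lt_k : (k < N)%N by rewrite ltnS leq_addl.
    rewrite (bigD1 (Ordinal lt_k)) //= [X in _ + X]big1 => [|i ik].
      rewrite divff ?expf_neq0 // addr0 mulrC; congr (_ * _).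
      by under eq_bigr do rewrite expr1n; rewrite sumr_const card_ord.
    by rewrite sum_pow ?mulr0.
  under eq_bigr do rewrite mulr_sumr; rewrite exchange_big; apply: eq_bigr => j _.
  rewrite (@horner_coef_wide _ N) ?mulr_suml; last by rewrite leqW // leq_addr.
  apply: eq_bigr => i _.
  by rewrite /u expr_div_n exprMn (exprAC x i j) !mulrA.
have N0 : 0 < N%:R :> R by rewrite ltr0n.
rewrite -(ler_pM2l N0) -nrm_nat -{1}(gtr0_norm rho0) -nrm_ofR -nrmX -!nrmM key.
apply: le_trans (nrm_sum _ _ _) _.
apply: le_trans (_ : \sum_(j < N) M <= _); last first.
  by rewrite sumr_const card_ord nrm_nat mulr_natl.
apply: ler_sum => j _; rewrite nrmM nrmV !nrmX x1 !expr1n invr1 mulr1.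
exact/pM/nu.
Qed.

End Approximation.

(** * Taylor coefficients as limits of coefficients of approximants *)

Section Taylor.
Variable R : realType.
Local Notation C := (CC R).
Implicit Types (z w : C) (f g : C -> C) (p q : {poly C}) (r e : R) (a b : nat -> C).

(** Taylor coefficients are characterized by approximation: a polynomial within e of [f] on the disc
    has its coefficient of index k within e / rho^k of [a k]. Cauchy's inequalities are thereby
    built into the definition. *)
Definition taylor f z0 r a := forall rho e p, 0 < rho < r ->
  (forall z, nrm (z - z0) < r -> nrm (f z - p.[z - z0]) <= e) ->
  forall k, nrm (p`_k - a k) * rho ^+ k <= e.

Lemma apx_recenter f z0 r e : apx f z0 r -> 0 < e ->
  exists p, forall z, nrm (z - z0) < r -> nrm (f z - p.[z - z0]) < e.
Proof.
move=> Hf /Hf[p Hp]; exists (p \Po ('X + z0%:P)) => z /Hp.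
by rewrite horner_comp !hornerE subrK.
Qed.

Lemma approx_coef_close f z0 r rho p q e d k : 0 < rho < r ->
  (forall z, nrm (z - z0) < r -> nrm (f z - p.[z - z0]) <= e) ->
  (forall z, nrm (z - z0) < r -> nrm (f z - q.[z - z0]) <= d) ->
  nrm (p`_k - q`_k) * rho ^+ k <= e + d.
Proof.
case/andP=> rho0 rho_r Hp Hq; rewrite -coefB; apply: cauchy_estimate => // z z_rho.
have lt_z : nrm (z + z0 - z0) < r by rewrite addrK z_rho.
have := Hp _ lt_z; have := Hq _ lt_z; rewrite addrK => Hq' Hp'.
rewrite hornerD hornerN; apply: le_trans (nrm_triangle (f (z + z0)) _ _) _.
by rewrite lerD // nrmBC.
Qed.

(** By Cauchy's estimate for the difference of two approximants, the coefficients of index k of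
    approximants with error 1/(m+1) form a Cauchy sequence, whose limit is [a k]. *)
Lemma taylor_exists f z0 r : 0 < r -> apx f z0 r -> exists a, taylor f z0 r a.
Proof.
move=> r0 Hf.
have inv0 m : 0 < (m.+1%:R : R)^-1 by rewrite invr_gt0 ltr0n.
have /choice[q Hq] m := apx_recenter Hf (inv0 m).
have small d : 0 < d -> exists N, forall n, (N <= n)%N -> (n.+1%:R : R)^-1 < d.
  move=> d0; exists (Num.bound d^-1) => n le_n.
  rewrite -[ltRHS]invrK ltf_pV2 ?posrE ?invr_gt0 ?ltr0n //.
  have := archi_boundP (ltW (_ : 0 < d^-1)); rewrite invr_gt0 => /(_ d0) lt_d.
  by apply: lt_le_trans lt_d _; rewrite ler_nat (leq_trans le_n).
have rho2 : 0 < r / 2 < r by rewrite divr_gt0 //= ltr_pdivrMr // ltr_pMr // ltr1n.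
have close rho m n k : 0 < rho < r ->
    nrm ((q m)`_k - (q n)`_k) * rho ^+ k <= (m.+1%:R)^-1 + (n.+1%:R)^-1.
  by move=> Hrho; apply: (@approx_coef_close f z0 r rho _ _ _ _ k Hrho) => z /Hq/ltW.
have /choice[a Ha] k : exists l, forall e, 0 < e ->
    exists N, forall n, (N <= n)%N -> nrm ((q n)`_k - l) < e.
  apply: complete_C => e e0.
  have rk0 : 0 < (r / 2) ^+ k by rewrite exprn_gt0 // (andP rho2).1.
  have d0 : 0 < e * (r / 2) ^+ k / 2 by rewrite divr_gt0 // mulr_gt0.
  have [N HN] := small _ d0; exists N => n m le_n le_m.
  rewrite -(ltr_pM2r rk0); apply: le_lt_trans (close _ _ _ _ rho2) _.
  by rewrite [ltRHS]splitr ltrD // HN.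
exists a => rho e p Hrho Hp k; apply/ler_addgt0Pr => d d0.
have rk0 : 0 < rho ^+ k by rewrite exprn_gt0 // (andP Hrho).1.
have d2 : 0 < d / 2 by rewrite divr_gt0.
have [N1 H1] := small _ d2.
have [N2 H2] := Ha k _ (divr_gt0 d2 rk0).
pose m := maxn N1 N2.
have h1 := approx_coef_close k Hrho Hp (fun z Hz => ltW (Hq m z Hz)).
have h2 := H1 m (leq_maxl _ _); have := H2 m (leq_maxr _ _).
rewrite ltr_pdivlMr // => h3.
have := nrm_triangle (q m)`_k p`_k (a k).
rewrite -(ler_pM2r rk0) mulrDl => h4; apply: le_trans h4 _.
apply: le_trans (lerD h1 (ltW h3)) _.
by rewrite -addrA lerD2l [leRHS]splitr lerD2r ltW.
Qed.

(** The zero polynomial is an approximant with error [M]. *)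
Lemma taylor_bound f z0 r a rho (M : R) k : taylor f z0 r a -> 0 < rho < r ->
  (forall z, nrm (z - z0) < r -> nrm (f z) <= M) -> nrm (a k) * rho ^+ k <= M.
Proof.
move=> Ta Hrho HM; rewrite -nrmN -sub0r -(@coef0 C k); apply: Ta => //.
by move=> z /HM; rewrite horner0 subr0.
Qed.

Lemma geometric_tail (t : R) n m : 0 <= t < 1 ->
  \sum_(n <= k < m) t ^+ k <= t ^+ n / (1 - t).
Proof.
case/andP=> t0 t1; have t1' : 0 < 1 - t by rewrite subr_gt0.
have [le_mn|lt_nm] := leqP m n.
  by rewrite big_geq // divr_ge0 ?exprn_ge0 // ltW.
rewrite ler_pdivlMr // mulrC.
have -> : (1 - t) * \sum_(n <= k < m) t ^+ k = t ^+ n - t ^+ m.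
  rewrite mulr_sumr -[RHS]opprB -(telescope_sumr _ (ltnW lt_nm)) -sumrN.
  by apply: eq_bigr => k _; rewrite exprS; ring.
by rewrite gerBl exprn_ge0.
Qed.

Lemma taylor_remainder f z0 r a rho (M : R) n z : apx f z0 r -> taylor f z0 r a ->
  0 < rho < r -> (forall z, nrm (z - z0) < r -> nrm (f z) <= M) ->
  nrm (z - z0) < rho ->
  nrm (f z - \sum_(k < n) a k * (z - z0) ^+ k) <=
    M * ((nrm (z - z0) / rho) ^+ n / (1 - nrm (z - z0) / rho)).
Proof.
move=> Hf Ta Hrho HM lt_z; have /andP[rho0 rho_r] := Hrho.
set h := z - z0 in lt_z *; set t := nrm h / rho.
have t0 : 0 <= t by rewrite divr_ge0 ?nrm_ge0 // ltW.
have t1 : t < 1 by rewrite ltr_pdivrMr // mul1r.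
have t01 : 0 <= t < 1 by rewrite t0.
have t1' : 0 < 1 - t by rewrite subr_gt0.
have h_t k : nrm h ^+ k = rho ^+ k * t ^+ k.
  by rewrite -exprMn mulrC divfK // gt_eqF.
apply/ler_addgt0Pr => d d0.
(* The three terms are the multiples of e lost on f - p, on the first n coefficients and on the tail
   of p; with e = d / K they add up to d. *)
pose K := 1 + (1 - t)^-1 + t ^+ n / (1 - t).
have K0 : 0 < K.
  by rewrite /K !ltr_wpDr ?divr_ge0 ?exprn_ge0 ?invr_ge0 // ltW.
have [p Hp] := apx_recenter Hf (divr_gt0 d0 K0); set e := d / K in Hp.
have e0 : 0 < e := divr_gt0 d0 K0.
have lt_zr : nrm (z - z0) < r := lt_trans lt_z rho_r.
have pE : p.[h] = \sum_(k < n) p`_k * h ^+ k + \sum_(n <= k < maxn n (size p)) p`_k * h ^+ k.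
  rewrite (horner_coef_wide _ (leq_maxr n (size p))) -(big_mkord xpredT (fun k => p`_k * h ^+ k)).
  by rewrite -(big_mkord xpredT (fun k => p`_k * h ^+ k)) (@big_cat_nat _ _ _ n) // leq_maxl.
have -> : f z - \sum_(k < n) a k * h ^+ k = (f z - p.[h]) +
   \sum_(k < n) (p`_k - a k) * h ^+ k + \sum_(n <= k < maxn n (size p)) p`_k * h ^+ k.
  under [X in _ = _ + X + _]eq_bigr do rewrite mulrBl.
  by rewrite sumrB pE; ring.
apply: le_trans (nrmD _ _) _; apply: le_trans (lerD (nrmD _ _) (lexx _)) _.
have b1 : nrm (f z - p.[h]) <= e by apply/ltW/Hp.
have b2 : nrm (\sum_(k < n) (p`_k - a k) * h ^+ k) <= e * (1 - t)^-1.
  apply: le_trans (nrm_sum _ _ _) _.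
  apply: le_trans (_ : \sum_(k < n) e * t ^+ k <= _).
    apply: ler_sum => k _; rewrite nrmM nrmX h_t mulrA ler_wpM2r ?exprn_ge0 //.
    by apply: Ta => // w /Hp/ltW.
  rewrite -mulr_sumr ler_pM2l //.
  rewrite -(big_mkord xpredT (fun k => t ^+ k)).
  by apply: le_trans (geometric_tail 0 n t01) _; rewrite expr0 div1r.
have b3 : nrm (\sum_(n <= k < maxn n (size p)) p`_k * h ^+ k) <= (M + e) * (t ^+ n / (1 - t)).
  apply: le_trans (nrm_sum _ _ _) _.
  apply: le_trans (_ : \sum_(n <= k < maxn n (size p)) (M + e) * t ^+ k <= _).
    apply: ler_sum => k _; rewrite nrmM nrmX h_t mulrA ler_wpM2r ?exprn_ge0 //.
    apply: cauchy_estimate => // w w_rho.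
    have lt_w : nrm (w + z0 - z0) < r by rewrite addrK w_rho.
    rewrite -(subrK (f (w + z0)) p.[w]) addrC.
    apply: le_trans (nrmD _ _) _; rewrite lerD ?HM // nrmBC.
    by have := Hp _ lt_w; rewrite addrK => /ltW.
  rewrite -mulr_sumr ler_wpM2l ?geometric_tail // addr_ge0 ?(ltW e0) //.
  exact: le_trans (nrm_ge0 _) (HM _ lt_zr).
have -> : d = e + e * (1 - t)^-1 + e * (t ^+ n / (1 - t)).
  by rewrite -{1}[e]mulr1 -!mulrDr -/K /e divfK // gt_eqF.
rewrite mulrDl in b3.
by apply: le_trans (lerD (lerD b1 b2) b3) _; rewrite [leLHS]addrCA.
Qed.

End Taylor.

(** * Germs of holomorphic and meromorphic functions *)

Section Holomorphic.
Variable R : realType.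
Local Notation C := (CC R).
Implicit Types (z w : C) (f g : C -> C) (p q : {poly C}) (r e : R) (a b : nat -> C).

Definition holo f z0 := exists2 r, 0 < r & apx f z0 r.

Lemma pow_small (t e : R) : 0 <= t < 1 -> 0 < e ->
  exists N, forall n, (N <= n)%N -> t ^+ n < e.
Proof.
case/andP=> t0 t1 e0.
have /cvgrPdistC_lt/(_ e e0)[N _ HN] : (GRing.exp t @ \oo --> (0 : R)).
  by apply: cvg_expr; rewrite ger0_norm.
by exists N => n /HN; rewrite /= subr0 ger0_norm // exprn_ge0.
Qed.

Lemma small_of_bound (x M t : R) : 0 <= t < 1 -> (forall n, x <= M * t ^+ n) -> x <= 0.
Proof.
move=> t01 H; rewrite leNgt; apply/negP => x0.
have M0 : 0 < M by have := H 0%N; rewrite expr0 mulr1; apply: lt_le_trans.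
have [N HN] := pow_small t01 (divr_gt0 x0 M0).
have := HN N (leqnn _); rewrite ltr_pdivlMr // ltNge mulrC.
by move/negP; apply; apply: H.
Qed.

Lemma half_itv r : 0 < r -> 0 < r / 2 < r.
Proof. by move=> r0; apply/andP; split; lra. Qed.

Lemma nrm_eq0_small z : (forall e, 0 < e -> nrm z <= e) -> z = 0.
Proof.
move=> H; apply/eqP; rewrite -nrm_eq0 eq_le nrm_ge0 andbT.
by apply/ler_addgt0Pr => e e0; rewrite add0r H.
Qed.

Lemma taylor0 f z0 r a : 0 < r -> apx f z0 r -> taylor f z0 r a -> a 0%N = f z0.
Proof.
move=> r0 Hf Ta; have [M _ HM] := apx_bounded Hf.
have := taylor_remainder 1 Hf Ta (half_itv r0) HM (z := z0).
rewrite subrr nrm0 mul0r expr1 !mul0r mulr0 big_ord1 expr0 mulr1 divr_gt0 // => /(_ isT).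
by rewrite le_eqVlt ltNge nrm_ge0 orbF nrm_eq0 subr_eq0 => /eqP.
Qed.

Lemma taylor_eq0 f z0 r a : apx f z0 r -> taylor f z0 r a -> (forall k, a k = 0) ->
  forall z, nrm (z - z0) < r -> f z = 0.
Proof.
move=> Hf Ta a0 z lt_z; have [M _ HM] := apx_bounded Hf.
pose rho := (nrm (z - z0) + r) / 2.
have z_ge0 := nrm_ge0 (z - z0).
have Hrho : 0 < rho < r by apply/andP; rewrite /rho; split; lra.
have z_rho : nrm (z - z0) < rho by rewrite /rho; lra.
pose t := nrm (z - z0) / rho; have rho0 : 0 < rho by case/andP: Hrho.
have t01 : 0 <= t < 1 by rewrite divr_ge0 ?(ltW rho0) //= ltr_pdivrMr // mul1r.
apply/eqP; rewrite -nrm_eq0 eq_le nrm_ge0 andbT.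
apply: (small_of_bound (M := M / (1 - t)) t01) => n.
have := taylor_remainder n Hf Ta Hrho HM z_rho.
rewrite big1 => [|k _]; last by rewrite a0 mul0r.
by rewrite subr0 -/t mulrAC -mulrA.
Qed.

(** The quotient g is a uniform limit of partial sums of the Taylor series divided by (z - z0)^k; on
    the disc of radius r/4 the remainder, taken at radius r/2, is geometric with ratio below 1/2. *)
Lemma taylor_factor f z0 r a k : 0 < r -> apx f z0 r -> taylor f z0 r a ->
  a k != 0 -> (forall i, (i < k)%N -> a i = 0) ->
  exists g, [/\ apx g z0 (r / 4), g z0 = a k &
    forall z, nrm (z - z0) < r / 4 -> f z = (z - z0) ^+ k * g z].
Proof.
move=> r0 Hf Ta ak a0; have [M M0 HM] := apx_bounded Hf.
pose g z := if z == z0 then a k else f z / (z - z0) ^+ k.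
exists g.
have fz0 : (0 < k)%N -> f z0 = 0 by move=> k0; rewrite -(taylor0 r0 Hf Ta) a0.
split=> [||z lt_z]; last 2 first; first by rewrite /g eqxx.
  rewrite /g; case: eqP => [->|/eqP z_neq].
    rewrite subrr expr0n; case: (posnP k) => [k0|k0]; last by rewrite fz0 // mul0r.
    by rewrite mul1r -(taylor0 r0 Hf Ta) k0.
  by rewrite mulrC divfK // expf_neq0 // subr_eq0.
apply: apx_lim => e e0.
pose rho := r / 2; have rho0 : 0 < rho by rewrite /rho; lra.
have rk0 : 0 < rho ^+ k by rewrite exprn_gt0.
have half01 : 0 <= (2^-1 : R) < 1 by apply/andP; split; lra.
(* After division by h^k the remainder is at most M t^(N+1) / ((1 - t) rho^k), with 1 / (1 - t) <=
   2; hence the requirement that 2^(-N) be below e rho^k / (2 M). *)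
have [N HN] := pow_small half01 (divr_gt0 (mulr_gt0 e0 rk0) (mulr_gt0 (ltr0Sn R 1) M0)).
exists (fun z => \sum_(j < N.+1) a (k + j)%N * (z - z0) ^+ j).
  apply: apx_sum => j _; apply: apxM; first exact: apx_cst.
  by apply: apxX; apply: apxB (apx_id _ _) (apx_cst _ _ _).
move=> z lt_z; rewrite /g; case: eqP => [->|/eqP z_neq].
  rewrite big_ord_recl [X in _ - (_ + X)]big1 => [|j _].
    by rewrite addr0 addn0 expr0 mulr1 subrr nrm0.
  by rewrite subrr expr0n mulr0.
set h := z - z0 in lt_z *; have h0 : h != 0 by rewrite subr_eq0.
have hk0 : 0 < nrm h ^+ k by rewrite exprn_gt0 // nrm_gt0.
have [t tE] : exists t, nrm h / rho = t by exists (nrm h / rho).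
have t_half : t < 2^-1 by rewrite -tE ltr_pdivrMr // /rho; lra.
have t0 : 0 <= t by rewrite -tE divr_ge0 ?nrm_ge0 // ltW.
have h_rho : nrm h < rho by rewrite /rho; lra.
have rem := taylor_remainder (k + N.+1) Hf Ta (half_itv r0) HM h_rho.
have sumE : \sum_(j < k + N.+1) a j * h ^+ j = h ^+ k * \sum_(j < N.+1) a (k + j)%N * h ^+ j.
  rewrite big_split_ord /= big1 ?add0r => [|i _]; last by rewrite a0 ?mul0r.
  by rewrite mulr_sumr; apply: eq_bigr => j _; rewrite exprD; ring.
rewrite -(ltr_pM2l hk0) -nrmX -nrmM mulrBr mulrCA mulfV ?expf_neq0 // mulr1.
rewrite -/h sumE -/rho tE in rem; apply: le_lt_trans rem _.
have hE : nrm h = rho * t by rewrite -tE mulrC divfK // gt_eqF.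
rewrite nrmX hE exprMn exprD.
have tN : t ^+ N.+1 <= 2^-1 ^+ N.+1 by rewrite lerXn2r ?nnegrE ?(ltW t_half) // (andP half01).1.
have lt_N := HN N.+1 (leqnSn _).
have inv_t : (1 - t)^-1 <= 2 by rewrite -[leRHS]invrK lef_pV2 ?posrE; lra.
have tk0 : 0 < t ^+ k by rewrite exprn_gt0 // -tE divr_gt0 // nrm_gt0.
rewrite ltr_pdivlMr ?mulr_gt0 // in lt_N.
rewrite (_ : M * _ = t ^+ k * (M * (t ^+ N.+1 * (1 - t)^-1))); last by ring.
rewrite (_ : rho ^+ k * _ * e = t ^+ k * (e * rho ^+ k)); last by ring.
rewrite ltr_pM2l //; apply: le_lt_trans lt_N.
rewrite [leRHS]mulrC -mulrA [leRHS]mulrCA ler_pM2l // [leRHS]mulrC.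
by apply: ler_pM; rewrite ?exprn_ge0 // invr_ge0; lra.
Qed.

Definition vanishing_order f z0 k g r :=
  [/\ 0 < r, apx g z0 r, (forall z, nrm (z - z0) < r -> g z != 0) &
    forall z, nrm (z - z0) < r -> f z = (z - z0) ^+ k * g z].

Lemma apx_neq0 g z0 r : 0 < r -> apx g z0 r -> g z0 != 0 ->
  exists2 d, 0 < d <= r & forall z, nrm (z - z0) < d -> g z != 0.
Proof.
move=> r0 Hg g0; have lt0 : nrm (z0 - z0) < r by rewrite subrr nrm0.
have [|d d0 Hd] := apx_continuous Hg lt0 (e := nrm (g z0)); first by rewrite nrm_gt0.
exists (Num.min d r) => [|z]; first by rewrite lt_min d0 r0 ge_min lexx orbT.
rewrite lt_min => /andP[/Hd lt_d _]; apply: contraTneq lt_d => ->.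
by rewrite sub0r nrmN ltxx.
Qed.

Lemma holo_dichotomy f z0 r : 0 < r -> apx f z0 r ->
  (forall z, nrm (z - z0) < r -> f z = 0) \/
  exists k g d, vanishing_order f z0 k g d.
Proof.
move=> r0 Hf; have [a Ta] := taylor_exists r0 Hf.
have [a0|] := pselect (forall k, a k = 0); first by left; apply: (taylor_eq0 Hf Ta a0).
move=> /existsNP[k0 /eqP ak0]; right.
have ex : exists k, a k != 0 by exists k0.
case: (ex_minnP ex) => k ak k_min.
have [|g [Hg gz0 fE]] := taylor_factor r0 Hf Ta ak.
  by move=> i; rewrite ltnNge; apply: contraNeq => /k_min.
have r4 : 0 < r / 4 by lra.
rewrite -gz0 in ak; have [d /andP[d0 le_d] Hd] := apx_neq0 r4 Hg ak.
exists k, g, d; split => //; first exact: apx_le Hg.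
by move=> z lt_z; apply: fE; apply: lt_le_trans le_d.
Qed.


Lemma vanishing_order_neq0 f z0 k g r : vanishing_order f z0 k g r ->
  forall z, nrm (z - z0) < r -> z != z0 -> f z != 0.
Proof.
case=> _ _ gn0 fE z lt_z z_neq; rewrite fE // mulf_neq0 ?gn0 //.
by rewrite expf_neq0 // subr_eq0.
Qed.

Lemma taylor_derivative f z0 r a : 0 < r -> apx f z0 r -> taylor f z0 r a ->
  has_derivative f z0 (a 1%N).
Proof.
move=> r0 Hf Ta e e0; have [M M0 HM] := apx_bounded Hf.
pose rho := r / 2; have rho0 : 0 < rho by rewrite /rho; lra.
(* The first bound gives t < 1/2, so 1 / (1 - t) <= 2; the second makes the quadratic remainder 2 M
   t^2 at most e |h|. *)
exists (Num.min (rho / 2) (e * rho ^+ 2 / (2 * M))) => [|h].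
  by rewrite lt_min !divr_gt0 ?mulr_gt0 ?exprn_gt0.
rewrite lt_min => /andP[h1 h2].
have h_rho : nrm (z0 + h - z0) < rho by rewrite addrC addKr; lra.
have := taylor_remainder 2 Hf Ta (half_itv r0) HM h_rho.
rewrite (_ : z0 + h - z0 = h) ?(addrC z0) ?addrK //.
rewrite !big_ord_recr big_ord0 /= add0r expr0 mulr1 expr1 (taylor0 r0 Hf Ta).
rewrite opprD addrA (addrC h) -/rho => rem.
apply: le_trans rem _; have [t tE] : exists t, nrm h / rho = t by exists (nrm h / rho).
have t_half : t < 2^-1 by rewrite -tE ltr_pdivrMr //; lra.
have t0 : 0 <= t by rewrite -tE divr_ge0 ?nrm_ge0 // ltW.
have inv_t : (1 - t)^-1 <= 2 by rewrite -[leRHS]invrK lef_pV2 ?posrE; lra.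
have hE : nrm h = rho * t by rewrite -tE mulrC divfK // gt_eqF.
rewrite ltr_pdivlMr ?mulr_gt0 // hE expr2 in h2.
have h3 : t * (2 * M) <= e * rho.
  by rewrite -(ler_pM2l rho0) mulrA [leRHS]mulrCA ltW.
rewrite tE hE (_ : M * _ = t * (t * (M * (1 - t)^-1))); last by ring.
rewrite (_ : e * _ = t * (e * rho)); last by ring.
apply: ler_wpM2l => //; apply: le_trans h3; rewrite [2 * M]mulrC.
by apply: ler_wpM2l => //; rewrite ler_pM2l.
Qed.

Lemma has_derivativeD f g z c d : has_derivative f z c -> has_derivative g z d ->
  has_derivative (fun z => f z + g z) z (c + d).
Proof.
move=> Hf Hg e e0; have e2 : 0 < e / 2 by rewrite divr_gt0.
have [[r1 r10 H1] [r2 r20 H2]] := (Hf _ e2, Hg _ e2).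
exists (Num.min r1 r2) => [|h]; first by rewrite lt_min r10.
rewrite lt_min => /andP[/H1 h1 /H2 h2].
have -> : f (z + h) + g (z + h) - (f z + g z) - (c + d) * h =
  (f (z + h) - f z - c * h) + (g (z + h) - g z - d * h) by ring.
by apply: le_trans (nrmD _ _) _; rewrite [e]splitr mulrDl lerD.
Qed.

Lemma has_derivative_poly p z : has_derivative (horner p) z (p^`()).[z].
Proof.
have [a Ta] := taylor_exists ltr01 (apx_poly p z 1).
have := taylor_derivative ltr01 (apx_poly p z 1) Ta.
pose q := p \Po ('X + z%:P).
(* [p] recentred at z is an approximant with error 0, so its coefficients are the Taylor
   coefficients. *)
have := Ta (1 / 2) 0 q (half_itv ltr01) _ 1%N.
have q1 : q`_1 = (p^`()).[z].
  have -> : q`_1 = (q^`()).[0] by rewrite horner_coef0 coef_deriv mulr1n.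
  rewrite /q deriv_comp derivD derivX derivC addr0 mulr1 horner_comp !hornerE //.
move=> H; suff -> : a 1%N = (p^`()).[z] by [].
apply/eqP; rewrite eq_sym -q1 -subr_eq0 -nrm_eq0 eq_le nrm_ge0 andbT.
have half0 : 0 < (1 / 2) ^+ 1 :> R by rewrite expr1; lra.
rewrite -(ler_pM2r half0) mul0r; apply: H => w _.
by rewrite /q horner_comp !hornerE subrK subrr nrm0.
Qed.

(** Cauchy's inequality for the first coefficient of f - p at z: the disc of radius r/2 about z lies
    in the given one, and the radius r/4 yields the factor 4/r. *)
Lemma derive1_close f z0 r p e : 0 < r -> apx f z0 r ->
  (forall z, nrm (z - z0) < r -> nrm (f z - p.[z]) <= e) ->
  forall z, nrm (z - z0) < r / 2 -> nrm (derive1 f z - p^`().[z]) <= e * (4 / r).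
Proof.
move=> r0 Hf Hp z lt_z; have r2 : 0 < r / 2 by rewrite divr_gt0.
have Hfp : apx (fun z => f z - p.[z]) z (r / 2).
  by apply: (apx_sub _ (apxB Hf (apx_poly p z0 r))); lra.
have [b Tb] := taylor_exists r2 Hfp.
have b1 : nrm (b 1%N) * (r / 4) ^+ 1 <= e.
  apply: (taylor_bound 1 Tb) => [|w lt_w]; first by apply/andP; split; lra.
  apply: Hp; apply: le_lt_trans (nrm_triangle z _ _) _.
  by rewrite [r]splitr ltrD.
have fE : derive1 f z = b 1%N + p^`().[z].
  apply: has_derivativeE.
  have := has_derivativeD (taylor_derivative r2 Hfp Tb) (has_derivative_poly p z).
  by under [X in has_derivative X _ _]eq_fun do rewrite subrK.
have -> : 4 / r = (r / 4)^-1 by rewrite invf_div.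
by rewrite fE addrK -[_ * _^-1]/(_ / _) ler_pdivlMr //; lra.
Qed.

Lemma apx_derive1 f z0 r : 0 < r -> apx f z0 r -> apx (derive1 f) z0 (r / 2).
Proof.
move=> r0 Hf e e0; have r4 : 0 < 4 / r by rewrite divr_gt0.
have [p Hp] := Hf _ (divr_gt0 (divr_gt0 e0 r4) (ltr0Sn R 1)).
exists p^`() => z lt_z; apply: le_lt_trans (derive1_close r0 Hf (fun z Hz => ltW (Hp z Hz)) lt_z) _.
by rewrite mulrAC divfK ?gt_eqF //; lra.
Qed.

Lemma taylor_derive1 f z0 r a b : 0 < r -> apx f z0 r -> taylor f z0 r a ->
  taylor (derive1 f) z0 (r / 2) b -> forall k, b k = k.+1%:R * a k.+1.
Proof.
move=> r0 Hf Ta Tb k; apply/eqP; rewrite -subr_eq0; apply/eqP.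
apply: nrm_eq0_small => e e0.
have rk0 : 0 < (r / 4) ^+ k.+1 by rewrite exprn_gt0 //; lra.
have rk1 : 0 < (r / 4) ^+ k by rewrite exprn_gt0 //; lra.
pose K := 4 / r / (r / 4) ^+ k + k.+1%:R / (r / 4) ^+ k.+1.
have K0 : 0 < K by rewrite /K addr_gt0 // !divr_gt0 // ltr0n.
pose d := e / K; have d0 : 0 < d by rewrite divr_gt0.
have [p Hp] := apx_recenter Hf d0.
have Ha : nrm (p`_k.+1 - a k.+1) * (r / 4) ^+ k.+1 <= d.
  by apply: Ta => [|z /Hp/ltW //]; apply/andP; split; lra.
have Hb : nrm ((p^`())`_k - b k) * (r / 4) ^+ k <= d * (4 / r).
  apply: Tb => [|z lt_z]; first by apply/andP; split; lra.
  have := derive1_close (p := p \Po ('X - z0%:P)) (e := d) r0 Hf _ lt_z.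
  rewrite deriv_comp derivB derivX derivC subr0 mulr1 horner_comp !hornerE; apply => w lt_w.
  by rewrite horner_comp !hornerE ltW // Hp.
rewrite coef_deriv -ler_pdivlMr // in Hb; rewrite -ler_pdivlMr // in Ha.
have -> : b k - k.+1%:R * a k.+1 = - (p`_k.+1 *+ k.+1 - b k) + k.+1%:R * (p`_k.+1 - a k.+1).
  by rewrite -mulr_natl; ring.
apply: le_trans (nrmD _ _) _; rewrite nrmN nrmM nrm_nat.
have k0 : 0 <= k.+1%:R :> R by rewrite ler0n.
apply: le_trans (lerD Hb (ler_wpM2l k0 Ha)) _.
have -> : e = d * K by rewrite /d divfK // gt_eqF.
by rewrite /K mulrDr [X in _ <= X + _]mulrA [X in _ + X <= _]mulrCA.
Qed.

Lemma taylor_derive1n f z0 r a j : 0 < r -> apx f z0 r -> taylor f z0 r a ->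
  derive1n j f z0 = j`!%:R * a j.
Proof.
elim: j f r a => [|j IHj] f r a r0 Hf Ta.
  by rewrite fact0 mul1r (taylor0 r0 Hf Ta).
have r2 : 0 < r / 2 by rewrite divr_gt0.
have Hf' := apx_derive1 r0 Hf; have [b Tb] := taylor_exists r2 Hf'.
rewrite derive1Sn (IHj _ _ _ r2 Hf' Tb) (taylor_derive1 r0 Hf Ta Tb).
by rewrite factS natrM; ring.
Qed.

Lemma holo_apx2 f g z0 : holo f z0 -> holo g z0 ->
  exists r, [/\ 0 < r, apx f z0 r & apx g z0 r].
Proof.
case=> r1 r10 Hf [r2 r20 Hg]; exists (Num.min r1 r2); split.
- by rewrite lt_min r10.
- by apply: apx_le Hf; rewrite ge_min lexx.
- by apply: apx_le Hg; rewrite ge_min lexx orbT.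
Qed.

Lemma holoD f g z0 : holo f z0 -> holo g z0 -> holo (fun z => f z + g z) z0.
Proof. by move=> Hf /(holo_apx2 Hf)[r [r0 ? ?]]; exists r => //; apply: apxD. Qed.

Lemma holoB f g z0 : holo f z0 -> holo g z0 -> holo (fun z => f z - g z) z0.
Proof. by move=> Hf /(holo_apx2 Hf)[r [r0 ? ?]]; exists r => //; apply: apxB. Qed.

Lemma holoM f g z0 : holo f z0 -> holo g z0 -> holo (fun z => f z * g z) z0.
Proof. by move=> Hf /(holo_apx2 Hf)[r [r0 ? ?]]; exists r => //; apply: apxM. Qed.

Lemma holo_cst c z0 : holo (fun=> c) z0.
Proof. by exists 1 => //; apply: apx_cst. Qed.

Lemma holo_id z0 : holo (fun z => z) z0.
Proof. by exists 1 => //; apply: apx_id. Qed.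

Lemma holoX f n z0 : holo f z0 -> holo (fun z => f z ^+ n) z0.
Proof. by case=> r r0 Hf; exists r => //; apply: apxX. Qed.

Lemma holo_near f g z0 : (\forall z \near z0, f z = g z) -> holo g z0 -> holo f z0.
Proof.
move=> /nearP[d d0 Hd] [r r0 Hg]; exists (Num.min d r); first by rewrite lt_min d0.
apply: apx_ext (apx_le _ Hg); last by rewrite ge_min lexx orbT.
by move=> z; rewrite lt_min => /andP[/Hd].
Qed.

Lemma holo_ext f g z0 : f =1 g -> holo g z0 -> holo f z0.
Proof. by move=> fg; apply: holo_near; apply/nearP; exists 1. Qed.

Lemma holo_sum (I : Type) (s : seq I) (P : pred I) (F : I -> C -> C) z0 :
  (forall i, P i -> holo (F i) z0) -> holo (fun z => \sum_(i <- s | P i) F i z) z0.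
Proof.
move=> HF; elim: s => [|i s IHs].
  by apply: holo_ext (holo_cst 0 z0) => z; rewrite big_nil.
case: (boolP (P i)) => Pi; last first.
  by apply: holo_ext IHs => z; rewrite big_cons (negPf Pi).
by apply: holo_ext (holoD (HF i Pi) IHs) => z; rewrite big_cons Pi.
Qed.

Lemma holo_prod (I : Type) (s : seq I) (P : pred I) (F : I -> C -> C) z0 :
  (forall i, P i -> holo (F i) z0) -> holo (fun z => \prod_(i <- s | P i) F i z) z0.
Proof.
move=> HF; elim: s => [|i s IHs].
  by apply: holo_ext (holo_cst 1 z0) => z; rewrite big_nil.
case: (boolP (P i)) => Pi; last first.
  by apply: holo_ext IHs => z; rewrite big_cons (negPf Pi).
by apply: holo_ext (holoM (HF i Pi) IHs) => z; rewrite big_cons Pi.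
Qed.

Lemma holo_derive1 f z0 : holo f z0 -> holo (derive1 f) z0.
Proof. by case=> r r0 Hf; exists (r / 2); [rewrite divr_gt0|apply: apx_derive1]. Qed.

Lemma holo_derive1n n f z0 : holo f z0 -> holo (derive1n n f) z0.
Proof. by move=> Hf; elim: n => [//|n IHn]; rewrite derive1nS; apply: holo_derive1. Qed.

Lemma holo_open f z0 : holo f z0 -> \forall z \near z0, holo f z.
Proof.
case=> r r0 Hf; apply/nearP; exists r => // z lt_z.
exists (r - nrm (z - z0)); first by rewrite subr_gt0.
by apply: apx_sub Hf; rewrite addrC subrK.
Qed.

Lemma holo_continuous f z0 e : holo f z0 -> 0 < e ->
  \forall z \near z0, nrm (f z - f z0) < e.
Proof.
case=> r r0 Hf e0; have lt0 : nrm (z0 - z0) < r by rewrite subrr nrm0.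
by have [d d0 Hd] := apx_continuous Hf lt0 e0; apply/nearP; exists d.
Qed.

Lemma holo_neq0 f z0 : holo f z0 -> f z0 != 0 -> \forall z \near z0, f z != 0.
Proof.
case=> r r0 Hf f0; have [d /andP[d0 _] Hd] := apx_neq0 r0 Hf f0.
by apply/nearP; exists d.
Qed.

Lemma holo_comp f g z0 : holo f z0 -> holo g (f z0) -> holo (fun z => g (f z)) z0.
Proof.
move=> Hf [s s0 Hg]; have [d d0 Hd] := (nearP _ _).1 (holo_continuous Hf s0).
case: Hf => r r0 Hf; exists (Num.min d r); first by rewrite lt_min d0.
apply: (apx_comp (apx_le _ Hf) Hg); first by rewrite ge_min lexx orbT.
by move=> z; rewrite lt_min => /andP[/Hd].
Qed.

(** On half the radius, (w0 - z) / w0 has modulus below 1/2 and its geometric series converges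
    uniformly. *)
Lemma apx_inv w0 : w0 != 0 -> apx (fun z => z^-1) w0 (nrm w0 / 2).
Proof.
move=> w0_neq; have w_gt0 : 0 < nrm w0 by rewrite nrm_gt0.
apply: apx_lim => e e0; have half01 : 0 <= (2^-1 : R) < 1 by apply/andP; split; lra.
have [N HN] := pow_small half01 (mulr_gt0 e0 (divr_gt0 w_gt0 (ltr0Sn R 1))).
exists (fun z => w0^-1 * \sum_(k < N) ((w0 - z) / w0) ^+ k).
  apply: apxM (apx_cst _ _ _) _; apply: apx_sum => k _; apply: apxX.
  exact: apxM (apxB (apx_cst _ _ _) (apx_id _ _)) (apx_cst _ _ _).
move=> z lt_z; have [x xE] : exists x, (w0 - z) / w0 = x by exists ((w0 - z) / w0).
under eq_bigr do rewrite xE.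
have z_gt : nrm w0 / 2 < nrm z.
  by have := nrm_ge w0 (w0 - z); rewrite subKr nrmBC; lra.
have z0 : z != 0 by rewrite -nrm_gt0; lra.
have x_lt : nrm x <= 2^-1.
  by rewrite -xE nrmM nrmV ler_pdivrMr // nrmBC; lra.
have zE : z = w0 * (1 - x) by rewrite -xE mulrBr mulr1 [w0 * _]mulrC divfK // subKr.
have x1 : 1 - x != 0 by apply: contraNneq z0 => E; rewrite zE E mulr0.
have -> : z^-1 - w0^-1 * \sum_(k < N) x ^+ k = x ^+ N / z.
  have -> : \sum_(k < N) x ^+ k = (1 - x ^+ N) / (1 - x).
    apply: (mulfI x1); rewrite [RHS]mulrCA mulfV // mulr1.
    by rewrite -[RHS]opprB subrX1 -mulNr opprB.
  by rewrite zE; field; rewrite ?w0_neq ?x1.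
rewrite nrmM nrmV nrmX ltr_pdivrMr ?nrm_gt0 //.
apply: le_lt_trans (_ : 2^-1 ^+ N < _).
  by rewrite lerXn2r ?nnegrE ?nrm_ge0 // (andP half01).1.
by apply: lt_trans (HN N (leqnn _)) _; rewrite ltr_pM2l.
Qed.

Lemma holo_inv_id w0 : w0 != 0 -> holo (fun z => z^-1) w0.
Proof.
move=> w0_neq; exists (nrm w0 / 2); last exact: apx_inv.
by rewrite divr_gt0 // nrm_gt0.
Qed.

Lemma holoV f z0 : holo f z0 -> f z0 != 0 -> holo (fun z => (f z)^-1) z0.
Proof. by move=> Hf f0; apply: (holo_comp Hf (holo_inv_id f0)). Qed.

Lemma analytic_holo f z0 : analytic_at f z0 -> holo f z0.
Proof.
case=> a [_ [/pos_ofR[r r0 ->] Ha]].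
have Hlim z : nrm (z - z0) < r -> forall e, 0 < e -> exists N, forall n, (N <= n)%N ->
    nrm (\sum_(k < n) a k * (z - z0) ^+ k - f z) < e.
  move=> lt_z; have := Ha z; rewrite normE ltr_ofR => /(_ lt_z)/cvgnP H e /H[N HN].
  by exists N => n /HN; rewrite /series /= big_mkord.
pose rho := r / 2; have rho0 : 0 < rho by rewrite /rho; lra.
(* Convergence at the single point [z0 + ofR rho] bounds the terms a_n rho^n, which gives uniform
   convergence on the disc of radius rho/2. *)
have [B B0 HB] : exists2 B, 0 < B & forall n, nrm (a n) * rho ^+ n <= B.
  have z1E : z0 + ofR rho - z0 = ofR rho by rewrite addrC addKr.
  have [|N HN] := Hlim (z0 + ofR rho) _ 1 ltr01.
    by rewrite z1E nrm_ofR gtr0_norm // /rho; lra.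
  rewrite z1E in HN; pose u n := a n * ofR rho ^+ n.
  have uE n : nrm (u n) = nrm (a n) * rho ^+ n.
    by rewrite /u nrmM nrmX nrm_ofR gtr0_norm.
  have S0 : 0 <= \sum_(n < N) nrm (u n) by apply: sumr_ge0 => n _; apply: nrm_ge0.
  exists (\sum_(n < N) nrm (u n) + 2); first by lra.
  move=> n; rewrite -uE; have [le_n|lt_n] := leqP N n.
    have h1 := HN n le_n; have h2 := HN n.+1 (leqW le_n).
    have := nrmB (\sum_(k < n.+1) u k - f (z0 + ofR rho)) (\sum_(k < n) u k - f (z0 + ofR rho)).
    have -> : \sum_(k < n.+1) u k - f (z0 + ofR rho) - (\sum_(k < n) u k - f (z0 + ofR rho)) = u n.
      by rewrite big_ord_recr /=; ring.
    by move: h1 h2; rewrite /u; lra.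
  rewrite (bigD1 (Ordinal lt_n)) //= -addrA lerDl addr_ge0 ?sumr_ge0 //.
  by move=> i _; apply: nrm_ge0.
exists (rho / 2); first by rewrite divr_gt0.
apply: apx_lim => e e0; have half01 : 0 <= (2^-1 : R) < 1 by apply/andP; split; lra.
have eB : 0 < e / (4 * B) by rewrite divr_gt0 // mulr_gt0.
have [N HN] := pow_small half01 eB.
exists (fun z => \sum_(k < N) a k * (z - z0) ^+ k).
  apply: apx_sum => j _; apply: apxM; first exact: apx_cst.
  by apply: apxX; apply: apxB (apx_id _ _) (apx_cst _ _ _).
move=> z lt_z; have lt_zr : nrm (z - z0) < r by rewrite /rho in lt_z rho0; lra.
have e2 : 0 < e / 2 by rewrite divr_gt0.
have [N' HN'] := Hlim z lt_zr _ e2; pose m := maxn N N'.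
have h1 := HN' m (leq_maxr _ _).
apply: le_lt_trans (nrm_triangle (\sum_(k < m) a k * (z - z0) ^+ k) _ _) _.
rewrite [e]splitr; apply: ltr_leD; first by rewrite nrmBC.
have -> : \sum_(k < m) a k * (z - z0) ^+ k - \sum_(k < N) a k * (z - z0) ^+ k
    = \sum_(N <= k < m) a k * (z - z0) ^+ k.
  rewrite -!(big_mkord xpredT (fun k => a k * (z - z0) ^+ k)).
  by rewrite (@big_cat_nat _ _ _ N 0 m) ?leq_maxl //= addrAC subrr add0r.
apply: le_trans (nrm_sum _ _ _) _.
apply: le_trans (_ : \sum_(N <= k < m) B * 2^-1 ^+ k <= _).
  apply: ler_sum => k _; rewrite nrmM nrmX.
  have : nrm (z - z0) ^+ k <= (rho * 2^-1) ^+ k.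
    by rewrite lerXn2r ?nnegrE ?nrm_ge0 // ?ltW // mulr_gt0 // invr_gt0.
  rewrite exprMn => le_k; apply: le_trans (ler_wpM2l (nrm_ge0 _) le_k) _.
  by rewrite mulrA ler_wpM2r ?HB // exprn_ge0 // (andP half01).1.
rewrite -mulr_sumr; apply: le_trans (ler_wpM2l (ltW B0) (geometric_tail N m half01)) _.
have := HN N (leqnn N); rewrite ltr_pdivlMr ?mulr_gt0 // => h2.
rewrite (_ : 1 - 2^-1 = 2^-1 :> R); last by lra.
by rewrite invrK; lra.
Qed.

Lemma holo_analytic f z0 : holo f z0 -> analytic_at f z0.
Proof.
case=> r r0 Hf; have [a Ta] := taylor_exists r0 Hf.
exists a, (ofR (r / 2)); split; first by rewrite -(rmorph0 (@ofR R)) ltr_ofR divr_gt0.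
move=> z; rewrite normE ltr_ofR => lt_z; apply/cvgnP => e e0.
have [M M0 HM] := apx_bounded Hf.
have rem n := taylor_remainder n Hf Ta (half_itv r0) HM lt_z.
have [t tE] : exists t, nrm (z - z0) / (r / 2) = t by exists (nrm (z - z0) / (r / 2)).
have t01 : 0 <= t < 1.
  by rewrite -tE ltr_pdivrMr ?mul1r ?lt_z ?andbT ?divr_ge0 ?nrm_ge0 //; lra.
have t1 : 0 < 1 - t by rewrite subr_gt0; case/andP: t01.
have [N HN] := pow_small t01 (divr_gt0 (mulr_gt0 e0 t1) M0).
exists N => n /HN; rewrite ltr_pdivlMr // => lt_n.
rewrite /series /= big_mkord nrmBC; apply: le_lt_trans (rem n) _.
by rewrite tE mulrCA mulrA ltr_pdivrMr // mulrC.
Qed.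

Definition mer_at f z0 := exists (n : nat) g, holo g z0 /\
  \forall z \near z0^', f z = g z / (z - z0) ^+ n.

Lemma meromorphicP f : meromorphic f <-> forall z, mer_at f z.
Proof.
split=> H z0; have [n [g [Hg fE]]] := H z0; exists n, g; split => //.
  exact: analytic_holo.
exact: holo_analytic.
Qed.

Lemma dnear_and (P Q : C -> Prop) z0 : (\forall z \near z0^', P z) ->
  (\forall z \near z0^', Q z) -> \forall z \near z0^', P z /\ Q z.
Proof. by move=> HP HQ; near=> z; split; near: z. Unshelve. all: by end_near. Qed.

Lemma dnear_mp (P Q : C -> Prop) z0 : (\forall z \near z0^', P z) ->
  (forall z, P z -> Q z) -> \forall z \near z0^', Q z.
Proof. by move=> HP PQ; near=> z; apply: PQ; near: z. Unshelve. all: by end_near. Qed.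

Lemma near_dnear (P : C -> Prop) z0 : (\forall z \near z0, P z) ->
  \forall z \near z0^', P z.
Proof. exact: nbhs_dnbhs. Qed.

Lemma dnear_open (P : C -> Prop) z0 : (\forall z \near z0^', P z) ->
  \forall z \near z0^', \forall w \near z, P w.
Proof.
move=> /dnearP[r r0 H]; apply/dnearP; exists r => // z lt_z z_neq.
apply/nearP; exists (Num.min (r - nrm (z - z0)) (nrm (z - z0))).
  by rewrite lt_min subr_gt0 lt_z nrm_gt0 subr_eq0.
move=> w; rewrite lt_min => /andP[w1 w2]; apply: H.
  by apply: le_lt_trans (nrm_triangle z _ _) _; rewrite -ltrBrDr.
by apply: contraTneq w2 => ->; rewrite nrmBC ltxx.
Qed.

Lemma dnear_exists (P : C -> Prop) z0 : (\forall z \near z0^', P z) ->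
  forall r, 0 < r -> exists2 z, nrm (z - z0) < r & P z.
Proof.
move=> /dnearP[d d0 H] r r0; pose m := Num.min d r / 2.
have mn0 : 0 < Num.min d r by rewrite lt_min d0.
have h1 : Num.min d r <= d by rewrite ge_min lexx.
have h2 : Num.min d r <= r by rewrite ge_min lexx orbT.
have zE : nrm (z0 + ofR m - z0) = m.
  by rewrite addrC addKr nrm_ofR gtr0_norm // /m; lra.
exists (z0 + ofR m); first by rewrite zE /m; lra.
apply: H; first by rewrite zE /m; lra.
by rewrite -subr_eq0 -nrm_eq0 zE /m; apply/eqP; lra.
Qed.

Lemma near_exists (P : C -> Prop) z0 : (\forall z \near z0, P z) -> P z0.
Proof. by move=> /nearP[r r0]; apply; rewrite subrr nrm0. Qed.

Lemma mer_near f g z0 : (\forall z \near z0^', f z = g z) -> mer_at g z0 -> mer_at f z0.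
Proof.
move=> fg [n [h [Hh gE]]]; exists n, h; split => //.
by apply: (dnear_mp (dnear_and fg gE)) => z [-> ->].
Qed.

Lemma holo_mer f z0 : holo f z0 -> mer_at f z0.
Proof.
move=> Hf; exists 0%N, f; split => //; apply/dnearP; exists 1 => // z _ _.
by rewrite expr0 divr1.
Qed.

Lemma dnear_neq z0 : \forall z \near z0^', z != z0.
Proof. by apply/dnearP; exists 1. Qed.

Lemma merD f g z0 : mer_at f z0 -> mer_at g z0 -> mer_at (fun z => f z + g z) z0.
Proof.
move=> [n [h [Hh fE]]] [m [k [Hk gE]]].
exists (n + m)%N, (fun z => h z * (z - z0) ^+ m + k z * (z - z0) ^+ n); split.
  apply: holoD; apply: holoM => //; apply: holoX; exact: holoB (holo_id _) (holo_cst _ _).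
apply: (dnear_mp (dnear_and (dnear_neq z0) (dnear_and fE gE))) => z [z_neq [-> ->]].
have zn : z - z0 != 0 by rewrite subr_eq0.
by rewrite exprD; field; rewrite !expf_neq0.
Qed.

Lemma merM f g z0 : mer_at f z0 -> mer_at g z0 -> mer_at (fun z => f z * g z) z0.
Proof.
move=> [n [h [Hh fE]]] [m [k [Hk gE]]].
exists (n + m)%N, (fun z => h z * k z); split; first exact: holoM.
apply: (dnear_mp (dnear_and fE gE)) => z [-> ->].
by rewrite exprD invfM; ring.
Qed.

Lemma mer_local f z0 : mer_at f z0 -> (\forall z \near z0^', f z = 0) \/
  exists n k g, [/\ holo g z0, g z0 != 0 &
    \forall z \near z0^', f z = (z - z0) ^+ k * g z / (z - z0) ^+ n].
Proof.
case=> n [h [[r r0 Hh] fE]]; have [h0|[k [g [d [d0 Hg gn0 hE]]]]] := holo_dichotomy r0 Hh.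
  left; have nr : \forall z \near z0^', h z = 0 by apply/dnearP; exists r => // z /h0.
  by apply: (dnear_mp (dnear_and fE nr)) => z [-> ->]; rewrite mul0r.
right; exists n, k, g; split; first by exists d.
  by apply: gn0; rewrite subrr nrm0.
have nr : \forall z \near z0^', h z = (z - z0) ^+ k * g z by apply/dnearP; exists d => // z /hE.
by apply: (dnear_mp (dnear_and fE nr)) => z [-> ->].
Qed.

Lemma mer_zero_or_neq0 f z0 : mer_at f z0 ->
  (\forall z \near z0^', f z = 0) \/ (\forall z \near z0^', f z != 0).
Proof.
move=> /mer_local[|[n [k [g [Hg g0 fE]]]]]; [by left|right].
have gn := near_dnear (holo_neq0 Hg g0).
apply: (dnear_mp (dnear_and (dnear_neq z0) (dnear_and fE gn))) => z [z_neq [-> gz]].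
by rewrite !mulf_neq0 ?invr_eq0 ?expf_neq0 // subr_eq0.
Qed.

Lemma merV f z0 : mer_at f z0 -> mer_at (fun z => (f z)^-1) z0.
Proof.
move=> /mer_local[f0|[n [k [g [Hg g0 fE]]]]].
  (* Since 0^-1 = 0, the inverse of a germ that vanishes identically is again meromorphic. *)
  apply: (mer_near (g := fun=> 0)); last exact/holo_mer/holo_cst.
  by apply: (dnear_mp f0) => z ->; rewrite invr0.
exists k, (fun z => (z - z0) ^+ n * (g z)^-1); split.
  apply: holoM; last exact: holoV.
  by apply: holoX; exact: holoB (holo_id _) (holo_cst _ _).
by apply: (dnear_mp fE) => z ->; rewrite !invfM invrK; ring.
Qed.

Lemma mer_holo f z0 : mer_at f z0 -> \forall z \near z0^', holo f z.
Proof.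
case=> n [g [Hg fE]].
have := dnear_and (near_dnear (holo_open Hg)) (dnear_and (dnear_open fE) (dnear_neq z0)).
move=> Hn; apply: (dnear_mp Hn) => z [Hgz [fEz z_neq]].
apply: (holo_near fEz); apply: holoM => //; apply: holoV; last first.
  by rewrite expf_neq0 // subr_eq0.
by apply: holoX; exact: holoB (holo_id _) (holo_cst _ _).
Qed.

Lemma clopen_line (P : R -> Prop) :
  (forall t : R, exists2 d : R, 0 < d & (forall s, `|s - t| < d -> P s) \/
     (forall s, `|s - t| < d -> ~ P s)) ->
  forall s t : R, P s -> P t.
Proof.
move=> H s t Ps.
have oP : open [set t | P t].
  rewrite openE => u Pu; have [d d0 [Hd|Hd]] := H u.
    by apply/nbhs_normP; exists d => // v /=; rewrite distrC; apply: Hd.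
  by case: (Hd u); rewrite ?subrr ?normr0.
have cP : closed [set t | P t].
  rewrite -openC openE => u Pu; have [d d0 [Hd|Hd]] := H u.
    by case: Pu; apply: Hd; rewrite subrr normr0.
  by apply/nbhs_normP; exists d => // v /=; rewrite distrC; apply: Hd.
have R_conn : connected [set: R] by apply/connected_intervalP => ? ? ? ? ?.
suff E : [set t | P t] = [set: R] by have : [set: R] t by []; rewrite -E.
apply: R_conn; first by exists s.
  by exists [set t | P t]; rewrite ?setTI.
by exists [set t | P t]; rewrite ?setTI.
Qed.

Lemma clopen_plane (P : C -> Prop) :
  (forall z, (\forall w \near z, P w) \/ (\forall w \near z, ~ P w)) ->
  forall z w, P z -> P w.
Proof.
move=> H z w Pz; pose u (t : R) := z + ofR t * (w - z).
have : P (u 1); last by rewrite /u rmorph1 mul1r addrC subrK.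
apply: (@clopen_line (P \o u)) (_ : P (u 0)); last by rewrite /u rmorph0 mul0r addr0.
move=> t; pose K := nrm (w - z) + 1; have K0 : 0 < K by rewrite ltr_wpDl ?nrm_ge0.
have near_u (Q : C -> Prop) : (\forall v \near u t, Q v) ->
    exists2 d : R, 0 < d & forall s, `|s - t| < d -> Q (u s).
  move=> /nearP[d d0 Hd]; exists (d / K); first by rewrite divr_gt0.
  move=> s; rewrite ltr_pdivlMr // => lt_s; apply: Hd; apply: le_lt_trans lt_s.
  have -> : u s - u t = ofR (s - t) * (w - z) by rewrite /u rmorphB; ring.
  by rewrite nrmM nrm_ofR ler_wpM2l // /K lerDl.
have [/near_u[d d0 Hd]|/near_u[d d0 Hd]] := H (u t).
  by exists d => //; left.
by exists d => //; right.
Qed.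

(** Identity theorem: a meromorphic germ is zero or free of zeros on a punctured disc, so vanishing
    near z is a locally constant property of z, hence constant on the plane. *)
Lemma mer_propagation f : (forall z, mer_at f z) -> ~ mero_eq setT f 0 ->
  forall z, \forall w \near z^', f w != 0.
Proof.
move=> Hf f0 z; case: (mer_zero_or_neq0 (Hf z)) => // fz; case: f0 => w _.
pose S z := \forall w \near z^', f w = 0; rewrite -/(S w).
have : S z := fz; apply: clopen_plane => {w z fz} z.
have [fz|fz] := mer_zero_or_neq0 (Hf z); have /dnearP[r r0 Hr] := dnear_open fz.
  left; apply/(nearP z S); exists r; first exact: r0.
  move=> w lt_w; have [->|w_neq] := eqVneq w z; first exact: fz.
  exact/near_dnear/Hr.
right; apply/(nearP z (fun w => ~ S w)); exists r; first exact: r0.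
move=> w lt_w Sw.
have fw : \forall v \near w^', f v != 0.
  by have [->|w_neq] := eqVneq w z; [exact: fz|apply/near_dnear/Hr].
have [v _ [/eqP fv fv0]] := dnear_exists (dnear_and fw Sw) ltr01.
by case: fv.
Qed.

(* Distinct bad points are separated by discs with rational data. *)
Lemma countable_bad (U : set C) (G : C -> Prop) :
  (forall z, U z -> \forall w \near z^', G w) -> countable [set z | U z /\ ~ G z].
Proof.
move=> H; set B := [set z | _].
have ex z : exists q : rat * rat * rat, B z ->
    nrm (z - (ratr q.1.1 +i* ratr q.1.2)%C) < ratr q.2 /\
    forall w, B w -> nrm (w - (ratr q.1.1 +i* ratr q.1.2)%C) < ratr q.2 -> w = z.
  have [Bz|nBz] := pselect (B z); last by exists (0, 0, 0).
  have [r r0 Hr] := (dnearP _ _).1 (H z Bz.1).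
  have r8 : 0 < r / 8 by rewrite divr_gt0.
  have dense (x : R) : exists q : rat, `|x - ratr q| < r / 8.
    have [|q] := @rat_in_itvoo R (x - r / 8) (x + r / 8); first by lra.
    rewrite in_itv /= => /andP[q1 q2]; exists q; rewrite ltr_norml.
    by apply/andP; split; lra.
  have [[q1 Hq1] [q2 Hq2]] := (dense (complex.Re z), dense (complex.Im z)).
  have [|q3] := @rat_in_itvoo R (r / 4) (r / 2); first by lra.
  rewrite in_itv /= => /andP[q3a q3b]; exists (q1, q2, q3) => _ /=.
  have zq : nrm (z - (ratr q1 +i* ratr q2)%C) < r / 4.
    apply: le_lt_trans (nrm_le_ReIm _) _; rewrite ReB ImB /=; lra.
  split=> [|w Bw wq]; first exact: lt_trans q3a.
  apply/eqP; apply: contraT => w_neq; case: (Bw.2); apply: Hr => //.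
  apply: le_lt_trans (nrm_triangle (ratr q1 +i* ratr q2)%C _ _) _.
  by rewrite [X in _ + X]nrmBC; lra.
have /choice[q Hq] := ex.
apply/countable_injP; exists (pickle \o q) => z w /set_mem Bz /set_mem Bw /= /(pcan_inj pickleK) E.
have [_ H1] := Hq w Bw; have [H2 _] := Hq z Bz.
by apply: H1; rewrite // -E.
Qed.

End Holomorphic.

(** * The Gamma function *)

Section GammaFunction.
Variable R : realType.
Local Notation C := (CC R).
Implicit Types (z w : C) (x y t : R).

Lemma mvt_bound (f df : R -> R) y (B : R) : 0 <= y ->
  (forall x, is_derive x 1 f (df x)) -> (forall x, 0 <= x <= y -> `|df x| <= B) ->
  `|f y - f 0| <= B * y.
Proof.
move=> y0 fd HB.
have fc : {within `[0, y], continuous f}.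
  apply: continuous_subspaceT => x.
  exact/differentiable_continuous/derivable1_diffP/(@ex_derive _ _ _ _ _ _ _ (fd x)).
have [c] := @MVT_segment R f df 0 y y0 (fun x _ => fd x) fc.
by rewrite in_itv /= => /HB dfc ->; rewrite subr0 normrM (ger0_norm y0) ler_wpM2r.
Qed.

Lemma sin_bound y : `|sin y| <= `|y|.
Proof.
wlog y0 : y / 0 <= y.
  by move=> H; case: (lerP 0 y) => [/H //|/ltW y0]; rewrite -normrN -sinN -(normrN y) H // oppr_ge0.
have := mvt_bound y0 (@is_derive_sin R) (B := 1).
rewrite sin0 subr0 mul1r (ger0_norm y0); apply => x _.
by rewrite ler_norml cos_geN1 cos_le1.
Qed.

Lemma cos_bound y : `|cos y - 1| <= y ^+ 2.
Proof.
wlog y0 : y / 0 <= y.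
  by move=> H; case: (lerP 0 y) => [/H //|/ltW y0]; rewrite -cosN -sqrrN H // oppr_ge0.
have := mvt_bound y0 (@is_derive_cos R) (B := y).
rewrite cos0 expr2; apply => x /andP[x0 xy]; rewrite normrN.
by apply: le_trans (sin_bound x) _; rewrite ger0_norm.
Qed.

Lemma sin_id_bound y : `|y| <= 1 -> `|sin y - y| <= y ^+ 2.
Proof.
wlog y0 : y / 0 <= y.
  move=> H; case: (lerP 0 y) => [/H //|/ltW y0 y1].
  by have := H (- y); rewrite oppr_ge0 normrN sqrrN sinN -opprD normrN; apply.
rewrite ger0_norm // => y1.
have dP x : is_derive x 1 (fun t => sin t - t) (cos x - 1).
  exact: is_deriveB.
have := mvt_bound y0 dP (B := y).
rewrite sin0 !subr0 expr2; apply => x /andP[x0 xy].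
apply: le_trans (cos_bound x) _; rewrite expr2 -[leRHS]mulr1.
by apply: ler_pM => //; exact: le_trans y1.
Qed.

Lemma expR_id_bound x : `|x| <= 1 / 2 -> `|expR x - 1 - x| <= 2 * x ^+ 2.
Proof.
rewrite ler_norml => /andP[x1 x2].
have h1 := expR_ge1Dx x; have h2 := expR_ge1Dx (- x).
have e0 := expR_gt0 x; have eN : expR (- x) * expR x = 1 by rewrite -expRD addNr expR0.
have h3 : (1 - x) * expR x <= 1 by rewrite -[leRHS]eN ler_wpM2r // ltW.
rewrite ler_norml; apply/andP; split; first by rewrite expr2; nra.
rewrite !lerBlDr -(ler_pM2l (_ : 0 < 1 - x)); last by lra.
apply: le_trans h3 _; rewrite expr2; nra.
Qed.

Lemma CexpD z w : Cexp (z + w) = Cexp z * Cexp w.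
Proof.
case: z w => [a b] [c d]; rewrite /Cexp /= expRD cosD sinD.
by apply/eqP; rewrite eq_complex /=; apply/andP; split; apply/eqP; ring.
Qed.

Lemma Cexp0 : Cexp (0 : C) = 1.
Proof.
rewrite /Cexp /= expR0 cos0 sin0 mulr1 mulr0.
by apply/eqP; rewrite eq_complex /= !eqxx.
Qed.

Lemma CexpX z n : Cexp (z *+ n) = Cexp z ^+ n.
Proof. by elim: n => [|n IHn]; rewrite ?mulr0n ?Cexp0 // mulrS CexpD IHn exprS. Qed.

Lemma Cexp_neq0 z : Cexp z != 0.
Proof.
apply/eqP => E; have := CexpD z (- z); rewrite subrr Cexp0 E mul0r => /eqP.
by rewrite oner_eq0.
Qed.

Lemma nrm_Cexp z : nrm (Cexp z) = expR (complex.Re z).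
Proof.
by rewrite nrmE /Cexp /= !exprMn -mulrDr cos2Dsin2 mulr1 sqrtr_sqr ger0_norm ?expR_ge0.
Qed.

(** Accuracy to the second order is what both uses require: the convergence of (1 + z/n)^n to
    [Cexp z] and the estimate 1 + O(1/n^2) of [gamma_ratio]. The constant 4 is crude. *)
Lemma Cexp_bound z : nrm z <= 1 / 2 -> nrm (Cexp z - 1 - z) <= 4 * nrm z ^+ 2.
Proof.
move=> z2; have := Re_le_nrm z; have := Im_le_nrm z.
have n2 : nrm z ^+ 2 = complex.Re z ^+ 2 + complex.Im z ^+ 2.
  by rewrite nrmE sqr_sqrtr // addr_ge0 ?sqr_ge0.
rewrite n2; case: z z2 {n2} => x y /= z2 yz xz.
have x2 : `|x| <= 1 / 2 by lra. have y2 : `|y| <= 1 / 2 by lra.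
have ex := expR_id_bound x2; have sy := sin_bound y; have cy := cos_bound y.
have sy2 : `|sin y - y| <= y ^+ 2 by apply: sin_id_bound; lra.
apply: le_trans (nrm_le_ReIm _) _; rewrite /Cexp !ReB !ImB /= subr0.
have X2 : x ^+ 2 = `|x| ^+ 2 by rewrite real_normK ?num_real.
have Y2 : y ^+ 2 = `|y| ^+ 2 by rewrite real_normK ?num_real.
have cle : `|cos y| <= 1 by rewrite ler_norml cos_geN1 cos_le1.
have -> : expR x * cos y - 1 - x = (expR x - 1 - x) * cos y + (1 + x) * (cos y - 1) by ring.
have -> : expR x * sin y - y = (expR x - 1 - x) * sin y + (x * sin y + (sin y - y)) by ring.
have h1 : `|(expR x - 1 - x) * cos y| <= 2 * x ^+ 2.
  by rewrite normrM -[leRHS]mulr1; apply: ler_pM.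
have x1 : `|1 + x| <= 3 / 2 by apply: le_trans (ler_normD _ _) _; rewrite normr1; lra.
have h2 : `|(1 + x) * (cos y - 1)| <= 3 / 2 * y ^+ 2.
  by rewrite normrM; apply: ler_pM.
have h3 : `|(expR x - 1 - x) * sin y| <= 2 * x ^+ 2 * (1 / 2).
  by rewrite normrM; apply: ler_pM => //; lra.
have h4 : `|x * sin y| <= (x ^+ 2 + y ^+ 2) / 2.
  rewrite normrM; apply: le_trans (_ : `|x| * `|y| <= _); first by rewrite ler_wpM2l.
  by rewrite X2 Y2; have := sqr_ge0 (`|x| - `|y|); rewrite !expr2; nra.
have := ler_normD ((expR x - 1 - x) * cos y) ((1 + x) * (cos y - 1)).
have := ler_normD ((expR x - 1 - x) * sin y) (x * sin y + (sin y - y)).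
have := ler_normD (x * sin y) (sin y - y).
have := sqr_ge0 x; have := sqr_ge0 y.
by move: h1 h2 h3 h4 sy2; lra.
Qed.

Lemma expr_close (a b : C) (B : R) n : nrm a <= B -> nrm b <= B ->
  nrm (a ^+ n.+1 - b ^+ n.+1) <= nrm (a - b) * (n.+1%:R * B ^+ n).
Proof.
move=> aB bB; have B0 : 0 <= B := le_trans (nrm_ge0 a) aB.
rewrite subrXX nrmM; apply: ler_wpM2l; first exact: nrm_ge0.
apply: le_trans (nrm_sum _ _ _) _.
apply: le_trans (_ : \sum_(i < n.+1) B ^+ n <= _).
  apply: ler_sum => i _; rewrite nrmM !nrmX.
  have le_i : (i <= n)%N by rewrite -ltnS.
  have -> : B ^+ n = B ^+ (n - i) * B ^+ i by rewrite -exprD subnK.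
  by apply: ler_pM; rewrite ?exprn_ge0 ?nrm_ge0 // lerXn2r ?nnegrE ?nrm_ge0.
by rewrite sumr_const card_ord mulr_natl.
Qed.

(** The approximants are (1 + z/n)^n, compared with Cexp(z/n)^n: the difference of the bases is of
    order (M/n)^2 and the n-th power multiplies it by at most n exp(M). *)
Lemma apx_Cexp z0 r : apx (@Cexp R) z0 r.
Proof.
move=> e e0; pose M := `|r| + nrm z0 + 1.
have M1 : 1 <= M by rewrite /M lerDr addr_ge0 ?nrm_ge0.
have K0 : 0 < 4 * M ^+ 2 * expR M by rewrite !mulr_gt0 ?exprn_gt0 ?expR_gt0 //; lra.
(* With n + 1 in place of n, the first bound puts M/n below 1/2, as [Cexp_bound] requires, and the
   second brings the total error 4 M^2 exp(M) / n below e. *)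
pose n := Num.bound (Num.max (2 * M) (4 * M ^+ 2 * expR M / e)).
have n_gt : Num.max (2 * M) (4 * M ^+ 2 * expR M / e) < n.+1%:R.
  apply: lt_trans (archi_boundP _) _; last by rewrite ltr_nat.
  by rewrite le_max; apply/orP; left; lra.
move: n_gt; rewrite gt_max => /andP[nM]; rewrite ltr_pdivrMr // => ne.
exists ((1 + (n.+1%:R^-1) *: 'X) ^+ n.+1) => z lt_z.
have n0 : 0 < n.+1%:R :> R by rewrite ltr0n.
have n0C : n.+1%:R != 0 :> C by rewrite pnatr_eq0.
have zM : nrm z <= M.
  rewrite -(subrK z0 z); apply: le_trans (nrmD _ _) _.
  by rewrite /M; have := ler_norm r; lra.
rewrite horner_exp !hornerE; set h := n.+1%:R^-1 * z.
have nh : nrm h = nrm z / n.+1%:R by rewrite nrmM nrmV nrm_nat mulrC.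
have -> : Cexp z = Cexp h ^+ n.+1.
  by rewrite -CexpX -mulr_natl mulrA mulfV // mul1r.
have hM : nrm h <= M / n.+1%:R by rewrite nh ler_wpM2r // invr_ge0 ltW.
have h_half : nrm h <= 1 / 2.
  by apply: le_trans hM _; rewrite ler_pdivrMr //; lra.
have aB : nrm (Cexp h) <= expR (M / n.+1%:R).
  rewrite nrm_Cexp ler_expR; apply: le_trans hM; apply: le_trans (Re_le_nrm _).
  exact: ler_norm.
have bB : nrm (1 + h) <= expR (M / n.+1%:R).
  apply: le_trans (nrmD _ _) _; rewrite nrm1.
  by apply: le_trans (expR_ge1Dx _); rewrite lerD2l.
apply: le_lt_trans (expr_close n aB bB) _.
have close : nrm (Cexp h - (1 + h)) <= 4 * (M / n.+1%:R) ^+ 2.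
  rewrite opprD addrA; apply: le_trans (Cexp_bound h_half) _.
  by rewrite ler_pM2l // lerXn2r ?nnegrE ?nrm_ge0 // divr_ge0 //; lra.
have eM : expR (M / n.+1%:R) ^+ n <= expR M.
  rewrite -expRM_natl ler_expR mulrCA ler_piMr //; first by lra.
  by rewrite ler_pdivrMr // mul1r ler_nat.
apply: le_lt_trans (_ : 4 * (M / n.+1%:R) ^+ 2 * (n.+1%:R * expR M) < e).
  apply: ler_pM; [exact: nrm_ge0| |exact: close|].
    by rewrite mulr_ge0 ?exprn_ge0 ?expR_ge0 // ltW.
  by rewrite ler_wpM2l // ltW.
rewrite (_ : _ * _ = 4 * M ^+ 2 * expR M / n.+1%:R); last first.
  by move: (n.+1%:R : R) n0 => N N0; field; rewrite gt_eqF.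
by rewrite ltr_pdivrMr // [ltRHS]mulrC.
Qed.

(** Increments relative to x_n are O(1/n^2), hence dominated by the telescoping differences 1/n -
    1/(n+1). The lower bound on |x_n| is the source of the nonvanishing of Gamma, the other estimate
    that of uniform convergence. *)
Lemma almost_constant (x : nat -> C) (N : nat) (B : R) : (0 < N)%N -> 0 <= B ->
  4 * B <= N%:R ->
  (forall n, (N <= n)%N -> nrm (x n.+1 - x n) <= nrm (x n) * (B * n%:R^-1 ^+ 2)) ->
  forall n, (N <= n)%N -> nrm (x N) / 2 <= nrm (x n) /\
    forall m, (n <= m)%N -> nrm (x m - x n) <= 4 * nrm (x N) * B * n%:R^-1.
Proof.
move=> N0 B0 BN step; set X := nrm (x N); have X0 : 0 <= X := nrm_ge0 _.
have inv_n n : (N <= n)%N -> [/\ 0 < n%:R^-1 :> R, N%:R * n%:R^-1 <= 1 :> R,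
    n%:R^-1 - n.+1%:R^-1 = n%:R^-1 * n.+1%:R^-1 :> R & n%:R^-1 <= 2 * n.+1%:R^-1 :> R].
  move=> le_n; have n0 : 0 < n%:R :> R by rewrite ltr0n (leq_trans N0).
  have n1 : 0 < n.+1%:R :> R by rewrite ltr0n.
  have nn : n.+1%:R = n%:R + 1 :> R by rewrite -natr1.
  have n_ge1 : 1 <= n%:R :> R by rewrite ler1n (leq_trans N0).
  split; first by rewrite invr_gt0.
  - by rewrite ler_pdivrMr // mul1r ler_nat.
  - by rewrite nn; field; rewrite ?gt_eqF ?andbT -?nn.
  - rewrite -[leLHS]mul1r ler_pdivrMr // mulrAC ler_pdivlMr // mul1r nn; lra.
have key n : (N <= n)%N -> B * n%:R^-1 ^+ 2 <= N%:R * (n%:R^-1 - n.+1%:R^-1) / 2 /\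
    B * n%:R^-1 ^+ 2 <= 2 * B * (n%:R^-1 - n.+1%:R^-1).
  move=> /inv_n[]; move: (n%:R^-1 : R) (n.+1%:R^-1 : R) => a b a0 Na ab a2b.
  rewrite ab expr2; have aa : a * a <= a * (2 * b) by rewrite ler_pM2l.
  have := ler_wpM2l B0 aa; have : 0 <= a * b by nra.
  by move=> ab0 h; split; nra.
(* The terms N/n make the bounds inductive: both are equalities at n = N, and each increment is paid
   for by the decrease of N/n. *)
have bounds n : (N <= n)%N ->
    X * (1 + N%:R * n%:R^-1) / 2 <= nrm (x n) <= X * (2 - N%:R * n%:R^-1).
  move=> le_n; rewrite -(subnK le_n); elim: (n - N)%N => [|k IHk].
    by rewrite add0n mulfV ?pnatr_eq0 -?lt0n //; apply/andP; split; rewrite -/X; lra.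
  set m := (k + N)%N in IHk *; have le_m : (N <= m)%N by rewrite leq_addl.
  rewrite addSn -/m; case/andP: IHk => lo hi.
  have [h1 h2] := key m le_m; have [a0 Na ab a2b] := inv_n m le_m.
  have st := step m le_m.
  have up := nrmD (x m.+1 - x m) (x m); rewrite subrK in up.
  have dn := nrmD (x m - x m.+1) (x m.+1); rewrite subrK nrmBC in dn.
  have [d dE] : exists d : R, N%:R * (m%:R^-1 - m.+1%:R^-1) / 2 = d by eexists.
  have N_ge0 : 0 <= N%:R :> R by [].
  have b0 : 0 < m.+1%:R^-1 :> R by rewrite invr_gt0 ltr0n.
  have d0 : 0 <= d by rewrite -dE divr_ge0 // ab mulr_ge0 // mulr_ge0 // ltW.
  have dE2 : 2 * d = N%:R * m%:R^-1 - N%:R * m.+1%:R^-1 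
    by rewrite -dE mulrC divfK ?pnatr_eq0 // mulrBr.
  have Nb0 : 0 <= N%:R * m.+1%:R^-1 :> R by rewrite mulr_ge0 // ltW.
  rewrite dE in h1; have {st} st : nrm (x m.+1 - x m) <= nrm (x m) * d.
    by apply: le_trans st _; apply: ler_wpM2l (nrm_ge0 _) _ _ h1.
  move: Na Nb0 dE2 lo hi; move: (N%:R * m%:R^-1 : R) (N%:R * m.+1%:R^-1 : R) => p q p1 q0 dE2 lo hi.
  have p0 : 0 <= p by lra.
  have hid : nrm (x m) * (1 + d) <= X * (2 - p) * (1 + d) by apply: ler_wpM2r => //; lra.
  have lod : X * (1 + p) / 2 * (1 - d) <= nrm (x m) * (1 - d) by apply: ler_wpM2r => //; lra.
  have hiX : X * ((2 - p) * (1 + d)) <= X * (2 - q).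
    by apply: ler_wpM2l => //; have := mulr_ge0 p0 d0; lra.
  have loX : X * ((1 + q) / 2) <= X * ((1 + p) / 2 * (1 - d)).
    have pd : p * d <= 1 * d by apply: ler_wpM2r.
    by apply: ler_wpM2l => //; lra.
  by apply/andP; split; lra.
move=> n le_n; split.
  have /andP[lo _] := bounds n le_n; apply: le_trans lo.
  have [a0 _ _ _] := inv_n n le_n; rewrite -[X in X / 2]mulr1 ler_pM2r ?invr_gt0 //.
  by rewrite ler_wpM2l // lerDl mulr_ge0 // ltW.
suff diff m : (n <= m)%N -> nrm (x m - x n) <= 4 * X * B * (n%:R^-1 - m%:R^-1).
  move=> m le_m; apply: le_trans (diff m le_m) _; rewrite ler_wpM2l //.
    by rewrite !mulr_ge0.
  by rewrite gerBl invr_ge0.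
move=> le_m; rewrite -(subnK le_m); elim: (m - n)%N => [|k IHk].
  by rewrite add0n !subrr nrm0 mulr0.
set j := (k + n)%N in IHk *; have le_j : (N <= j)%N by rewrite (leq_trans le_n) ?leq_addl.
rewrite addSn -/j; have [_ h2] := key j le_j; have /andP[_ hi] := bounds j le_j.
have [a0 Na ab _] := inv_n j le_j.
have d0 : 0 <= j%:R^-1 - j.+1%:R^-1 :> R.
  by rewrite ab mulr_ge0 ?invr_ge0.
have h3 : nrm (x j.+1 - x j) <= 2 * X * (2 * B * (j%:R^-1 - j.+1%:R^-1)).
  apply: le_trans (step j le_j) _; apply: ler_pM; rewrite ?nrm_ge0 //.
    by rewrite mulr_ge0 ?exprn_ge0 // ltW.
  apply: le_trans hi _; rewrite [2 * X]mulrC ler_wpM2l // gerBl mulr_ge0 // ltW //.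
have := nrm_triangle (x j) (x j.+1) (x n).
move: IHk h3; move: (j%:R^-1 : R) (j.+1%:R^-1 : R) (n%:R^-1 : R) => p q s IHk h3 tr.
apply: le_trans tr _; apply: le_trans (lerD h3 IHk) _.
by rewrite le_eqVlt; apply/orP; left; apply/eqP; ring.
Qed.

Definition gamma_seq (n : nat) z : C :=
  n`!%:R * Cexp (z * ofR (ln (n%:R : R))) / \prod_(k < n.+1) (z + k%:R).

Definition log_step (n : nat) : R := ln n.+1%:R - ln n%:R.

Definition gamma_ratio (n : nat) z : C :=
  n.+1%:R * Cexp (z * ofR (log_step n)) / (z + n.+1%:R).

Lemma gamma_seqS n z : gamma_seq n.+1 z = gamma_seq n z * gamma_ratio n z.
Proof.
rewrite /gamma_seq /gamma_ratio big_ord_recr /= factS natrM invfM.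
have -> : z * ofR (ln n.+1%:R) = z * ofR (ln n%:R) + z * ofR (log_step n).
  by rewrite -mulrDr -rmorphD /log_step addrC subrK.
by rewrite CexpD; ring.
Qed.

Lemma log_step_bounds n : (0 < n)%N ->
  n.+1%:R^-1 <= log_step n <= n%:R^-1.
Proof.
move=> n0; have nR : 0 < n%:R :> R by rewrite ltr0n.
have n1 : 0 < n.+1%:R :> R by rewrite ltr0n.
rewrite /log_step -ln_div ?posrE //; apply/andP; split.
  rewrite -lerN2 -lnV ?posrE ?divr_gt0 // invf_div.
  have -> : n%:R / n.+1%:R = 1 + - n.+1%:R^-1 :> R.
    apply: (mulIf (lt0r_neq0 n1)); rewrite divfK ?gt_eqF // mulrDl mulNr mulVf ?gt_eqF //.
    by rewrite mul1r -natr1 addrK.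
  apply: le_ln1Dx; rewrite ltrN2 invf_lt1 // ltr1n ltnS //.
have -> : n.+1%:R / n%:R = 1 + n%:R^-1 :> R by rewrite -natr1 mulrDl divff ?gt_eqF // mul1r.
by apply: le_ln1Dx; rewrite (lt_trans _ (_ : 0 < n%:R^-1)) ?invr_gt0 // ltrN10.
Qed.

Lemma gamma_ratio_bound (M : R) n z : 1 <= M -> 2 * M <= n%:R -> nrm z <= M ->
  nrm (gamma_ratio n z - 1) <= (8 * M ^+ 2 + 2 * M) * n%:R^-1 ^+ 2.
Proof.
move=> M1 nM zM; have n_gt0 : (0 < n)%N by rewrite -(ltr_nat R); lra.
have nR : 0 < n%:R :> R by rewrite ltr0n.
have nn : n.+1%:R = n%:R + 1 :> R by rewrite -natr1.
have /andP[L1 L2] := log_step_bounds n_gt0.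
have [L LE] : exists L : R, log_step n = L by eexists.
have [a aE] : exists a : R, n%:R^-1 = a by eexists.
rewrite /gamma_ratio; rewrite LE aE in L1 L2 *.
have a0 : 0 < a by rewrite -aE invr_gt0.
have na : n%:R * a = 1 by rewrite -aE mulfV // gt_eqF.
have L0 : 0 <= L by apply: le_trans L1; rewrite invr_ge0.
have nL : 1 <= n.+1%:R * L by rewrite -ler_pdivrMl ?mulr1 // ltr0n.
have den : n.+1%:R / 2 <= nrm (z + n.+1%:R).
  have := nrm_ge n.+1%:R (- z); rewrite opprK nrmN nrm_nat [n.+1%:R + z]addrC nn; lra.
have den0 : 0 < nrm (z + n.+1%:R) by apply: lt_le_trans den; rewrite divr_gt0 // ltr0n.
have den_neq : z + n.+1%:R != 0 by rewrite -nrm_gt0.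
set h := z * ofR L; have nh : nrm h <= M * a.
  by rewrite nrmM nrm_ofR ger0_norm //; apply: ler_pM => //; apply: nrm_ge0.
have h_half : nrm h <= 1 / 2.
  by apply: le_trans nh _; have := ler_wpM2r (ltW a0) nM; rewrite na; lra.
(* The first-order terms cancel, since (n+1) L = 1 + O(1/n); the numerator keeps the second-order
   remainder of [Cexp] and a term of order 1/n. *)
have numE : n.+1%:R * Cexp h / (z + n.+1%:R) - 1 =
    (n.+1%:R * (Cexp h - 1 - h) + z * ofR (n.+1%:R * L - 1)) / (z + n.+1%:R).
  have -> : z * ofR (n.+1%:R * L - 1) = n.+1%:R * h - z.
    by rewrite rmorphB rmorph1 rmorphM rmorph_nat /h; ring.
  by rewrite -[X in _ - X](divff den_neq) -mulrBl; congr (_ / _); ring.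
rewrite numE nrmM nrmV ler_pdivrMr //.
apply: le_trans (_ : (8 * M ^+ 2 + 2 * M) * a ^+ 2 * (n.+1%:R / 2) <= _); last first.
  by apply: ler_wpM2l => //; rewrite mulr_ge0 ?exprn_ge0 ?(ltW a0) //; nra.
apply: le_trans (nrmD _ _) _; rewrite !nrmM nrm_nat nrm_ofR ger0_norm; last by lra.
have h1 : n.+1%:R * nrm (Cexp h - 1 - h) <= n.+1%:R * (4 * (M * a) ^+ 2).
  rewrite ler_wpM2l //; apply: le_trans (Cexp_bound h_half) _.
  by rewrite ler_pM2l // lerXn2r ?nnegrE ?nrm_ge0 // mulr_ge0 ?ltW //; lra.
have h2 : nrm z * (n.+1%:R * L - 1) <= M * a.
  apply: ler_pM; rewrite ?nrm_ge0 //; first by lra.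
  by have := ler_wpM2l (ler0n R n.+1) L2; rewrite nn; lra.
apply: le_trans (lerD h1 h2) _.
have -> : (8 * M ^+ 2 + 2 * M) * a ^+ 2 * (n.+1%:R / 2) =
   n.+1%:R * (4 * (M * a) ^+ 2) + M * a * (n%:R * a + a) by rewrite nn; field.
by rewrite na lerD2l mulrDr mulr1 lerDl !mulr_ge0 ?(ltW a0) //; lra.
Qed.

Lemma apx_gamma_ratio (M : R) n z0 : nrm z0 + 1 <= M -> 2 * M + 4 <= n%:R ->
  apx (gamma_ratio n) z0 1.
Proof.
move=> z0M nM; have n0 := nrm_ge0 z0; apply: apxM; first apply: apxM.
- exact: apx_cst.
- have K0 : 0 < `|log_step n| + 1 by rewrite ltr_wpDl.
  apply: (@apx_comp _ _ _ _ _ (z0 * ofR (log_step n)) (`|log_step n| + 1)).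
  + exact: apxM (apx_id _ _) (apx_cst _ _ _).
  + exact: apx_Cexp.
  + move=> z lt_z; rewrite -mulrBl nrmM nrm_ofR.
    apply: le_lt_trans (_ : 1 * `|log_step n| < _); last by rewrite mul1r ltrDl.
    by rewrite ler_wpM2r // ltW.
(* A modulus of at least 4 keeps the disc of radius 1 inside the half-radius disc of [apx_inv]. *)
- have big : 4 <= nrm (z0 + n.+1%:R).
    have := nrm_ge n.+1%:R (- z0); rewrite opprK nrmN nrm_nat [n.+1%:R + z0]addrC -[n.+1%:R in X in X -> _]natr1; lra.
  have neq0 : z0 + n.+1%:R != 0 by rewrite -nrm_gt0; lra.
  apply: apx_comp (apxD (apx_id _ _) (apx_cst _ _ _)) (apx_inv neq0) _ => z lt_z.
  by rewrite opprD addrACA subrr addr0; lra.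
Qed.

Lemma holo_gamma_seq n z0 : (forall k : nat, z0 + k%:R != 0) -> holo (gamma_seq n) z0.
Proof.
move=> z0k; apply: holoM; first apply: holoM.
- exact: holo_cst.
- apply: (holo_comp (g := @Cexp R)); last by exists 1 => //; apply: apx_Cexp.
  exact: holoM (holo_id _) (holo_cst _ _).
- apply: holoV; last by apply/prodf_neq0 => k _.
  by apply: holo_prod => k _; apply: holoD (holo_id _) (holo_cst _ _).
Qed.

Lemma Gamma_limn z l : gamma_seq ^~ z @ \oo --> l -> Gamma z = l.
Proof. by move=> H; apply: cvg_lim. Qed.

(** [almost_constant] applies with the same N and B throughout the disc of radius 1 about z0: it
    makes [gamma_seq] converge there and keeps its modulus above half of that of the term of rank
    N. *)
Theorem Gamma_spec z0 : (forall k : nat, z0 + k%:R != 0) ->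
  [/\ holo (@Gamma R) z0, Gamma z0 != 0 & gamma_seq ^~ z0 @ \oo --> Gamma z0].
Proof.
move=> z0k; pose M := nrm z0 + 1; have M1 : 1 <= M by rewrite lerDr nrm_ge0.
pose B := 8 * M ^+ 2 + 2 * M; have B0 : 0 < B by rewrite /B; nra.
pose N := (Num.bound (Num.max (4 * B) (2 * M + 4))).+1.
have : Num.max (4 * B) (2 * M + 4) < N%:R.
  apply: lt_trans (archi_boundP _) _; last by rewrite ltr_nat.
  by rewrite le_max; apply/orP; left; lra.
rewrite gt_max => /andP[/ltW BN /ltW MN].
have N0 : (0 < N)%N by [].
have step z : nrm (z - z0) < 1 -> forall n, (N <= n)%N ->
    nrm (gamma_seq n.+1 z - gamma_seq n z) <= nrm (gamma_seq n z) * (B * n%:R^-1 ^+ 2).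
  move=> lt_z n le_n; rewrite gamma_seqS -{2}[gamma_seq n z]mulr1 -mulrBr nrmM.
  apply: (ler_wpM2l (nrm_ge0 _)); apply: gamma_ratio_bound => //.
    have : N%:R <= n%:R :> R by rewrite ler_nat. lra.
  by rewrite /M -(subrK z0 z); apply: le_trans (nrmD _ _) _; lra.
have AC z lt_z := almost_constant N0 (ltW B0) BN (step z lt_z).
have inv_small e : 0 < e -> exists K, forall n, (K <= n)%N -> (n%:R^-1 : R) < e.
  move=> e0; exists (Num.bound e^-1).+1 => n le_n.
  have n0 : 0 < n%:R :> R by rewrite ltr0n (leq_trans _ le_n).
  rewrite -[ltRHS]invrK ltf_pV2 ?posrE ?invr_gt0 //.
  have := archi_boundP (ltW (_ : 0 < e^-1)); rewrite invr_gt0 => /(_ e0) lt_d.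
  by apply: lt_le_trans lt_d _; rewrite ler_nat ltnW.
have unif z (lt_z : nrm (z - z0) < 1) : gamma_seq ^~ z @ \oo --> Gamma z.
  have [|l Hl] := @complete_C R (gamma_seq ^~ z).
    move=> e e0; pose X := 4 * nrm (gamma_seq N z) * B + 1.
    have X0 : 0 < X by rewrite /X; have := nrm_ge0 (gamma_seq N z); nra.
    have [K HK] := inv_small _ (divr_gt0 e0 X0).
    suff H n m : (maxn N K <= n)%N -> (n <= m)%N -> nrm (gamma_seq m z - gamma_seq n z) < e.
      exists (maxn N K) => n m le_n le_m; have [le_nm|/ltnW le_mn] := leqP n m.
        by rewrite nrmBC; apply: H.
      exact: H.
    rewrite geq_max => /andP[le_Nn le_Kn] le_nm.
    have [_ /(_ m le_nm) h] := AC z lt_z n le_Nn.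
    have n0 : 0 <= n%:R^-1 :> R by rewrite invr_ge0.
    apply: le_lt_trans h _; apply: le_lt_trans (_ : X * n%:R^-1 < _).
      by rewrite ler_wpM2r // /X lerDl.
    by rewrite mulrC -ltr_pdivlMr // HK.
  have cv : gamma_seq ^~ z @ \oo --> l by apply/cvgnP.
  by rewrite (Gamma_limn cv).
have lt0 : nrm (z0 - z0) < 1 by rewrite subrr nrm0.
have GN0 : 0 < nrm (gamma_seq N z0).
  rewrite nrm_gt0 /gamma_seq !mulf_neq0 ?Cexp_neq0 ?pnatr_eq0 -?lt0n ?fact_gt0 //.
  by rewrite invr_eq0; apply/prodf_neq0 => k _.
split; last exact: unif; last first.
  apply/eqP => G0; have /cvgnP/(_ _ (divr_gt0 GN0 (ltr0Sn R 1)))[K HK] := unif z0 lt0.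
  have [lo _] := AC z0 lt0 (maxn N K) (leq_maxl _ _).
  by have := HK (maxn N K) (leq_maxr _ _); rewrite G0 subr0 ltNge lo.
have [r r0 HGN] := holo_gamma_seq N z0k.
pose d := Num.min r 1; have d0 : 0 < d by rewrite lt_min r0 /=.
have HGN' : apx (gamma_seq N) z0 d by apply: apx_le HGN; rewrite ge_min lexx.
exists d => //; apply: apx_lim => e e0.
have [X X0 HX] := apx_bounded HGN'.
have K0 : 0 < 4 * X * B by rewrite !mulr_gt0.
have e2 : 0 < e / 2 by rewrite divr_gt0.
have [K HK] := inv_small _ (divr_gt0 e2 K0); pose n := maxn N K.
exists (gamma_seq n).
  (* The radius given by [holo_gamma_seq] depends on the rank, so it is used at rank N only; later
     terms are obtained by multiplying by [gamma_ratio], approximable on a disc of fixed radius. *)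
  rewrite /n -(subnK (leq_maxl N K)); elim: (_ - _)%N => [//|k IHk].
  rewrite addSn; apply: apx_ext (apxM IHk _); first by move=> z _; apply: gamma_seqS.
  apply: apx_le (_ : apx _ z0 1); first by rewrite ge_min lexx orbT.
  apply: (@apx_gamma_ratio M) => //; apply: le_trans MN _.
  by rewrite ler_nat leq_addl.
move=> z lt_z; have lt_z1 : nrm (z - z0) < 1.
  by apply: lt_le_trans lt_z _; rewrite ge_min lexx orbT.
have /cvgnP/(_ _ e2)[K' HK'] := unif z lt_z1; pose m := maxn n K'.
apply: le_lt_trans (nrm_triangle (gamma_seq m z) _ _) _; rewrite [e]splitr.
apply: ltrD; first by rewrite nrmBC; apply/HK'/leq_maxr.
have [_ /(_ m (leq_maxl _ _)) h] := AC z lt_z1 n (leq_maxl _ _).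
apply: le_lt_trans h _; apply: le_lt_trans (_ : 4 * X * B * n%:R^-1 < _).
  apply: ler_wpM2r; first by rewrite invr_ge0.
  by apply: ler_wpM2r; [exact: ltW|rewrite ler_pM2l ?HX].
by rewrite mulrC -ltr_pdivlMr // HK // leq_maxr.
Qed.

(** At finite rank the equation holds up to the factor n / (z + n + 1), which tends to 1. *)
Theorem Gamma_rec z : (forall k : nat, z + k%:R != 0) -> Gamma (z + 1) = z * Gamma z.
Proof.
move=> zk; have z1k k : z + 1 + k%:R != 0 by rewrite -addrA nat1r.
have [_ _ cv] := Gamma_spec zk; have [_ _ cv1] := Gamma_spec z1k.
have seqE n : (0 < n)%N -> gamma_seq n (z + 1) =
    z * gamma_seq n z * (n%:R / (z + n.+1%:R)).
  move=> n0; rewrite /gamma_seq.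
  have -> : \prod_(k < n.+1) (z + 1 + k%:R) =
      (\prod_(k < n.+1) (z + k%:R)) / z * (z + n.+1%:R).
    have z0 : z != 0 by have := zk 0%N; rewrite addr0.
    rewrite [in RHS]big_ord_recl /= addr0 [z * _]mulrC mulfK // big_ord_recr /=.
    congr (_ * _); last by rewrite -addrA nat1r.
    by apply: eq_bigr => k _; rewrite /bump /= -addrA nat1r.
  have -> : Cexp ((z + 1) * ofR (ln n%:R)) = Cexp (z * ofR (ln n%:R)) * n%:R.
    rewrite mulrDl mul1r CexpD; congr (_ * _).
    rewrite /Cexp /ofR /= cos0 sin0 mulr0 mulr1 lnK ?posrE ?ltr0n //.
    by rewrite -[RHS](rmorph_nat (@ofR R)).
  by rewrite !invfM invrK; ring.
have lim1 : (fun n => n%:R / (z + n.+1%:R)) @ \oo --> (1 : C).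
  apply/cvgnP => e e0; pose K := Num.bound (nrm (z + 1) / e + nrm z).
  exists K => n le_n.
  have neq : z + n.+1%:R != 0 by apply: zk.
  have -> : n%:R / (z + n.+1%:R) - 1 = - ((z + 1) / (z + n.+1%:R)).
    rewrite -[X in _ - X](divff neq) -mulrBl -mulNr; congr (_ / _).
    by rewrite -natr1; ring.
  rewrite nrmN nrmM nrmV ltr_pdivrMr ?nrm_gt0 //.
  have : nrm (z + 1) / e + nrm z < n.+1%:R.
    apply: lt_le_trans (archi_boundP _) _.
      by rewrite addr_ge0 ?nrm_ge0 // divr_ge0 ?nrm_ge0 // ltW.
    by rewrite ler_nat leqW.
  have := nrm_ge n.+1%:R (- z); rewrite opprK nrmN nrm_nat [n.+1%:R + z]addrC => h1 h2.
  by rewrite [ltRHS]mulrC -ltr_pdivrMr //; lra.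
have cvp : (fun n => z * gamma_seq n z * (n%:R / (z + n.+1%:R))) @ \oo --> z * Gamma z.
  rewrite -[z * Gamma z]mulr1; apply: cvgM lim1.
  by apply: cvgM cv; apply: cvg_cst.
apply: Gamma_limn; apply/cvgnP => e e0.
have [K HK] := (cvgnP _ _).1 cvp e e0; exists K.+1 => n le_n.
by rewrite seqE ?(leq_trans _ le_n) //; apply/HK/ltnW.
Qed.

End GammaFunction.


(** * Continuation of the roots of a polynomial *)

Section LocalRoots.
Variable R : realType.
Local Notation C := (CC R).
Implicit Types (z w x : C) (p q : {poly C}) (e : R).

(** It makes the Newton map a contraction: without linear term at x0, q is a constant plus h^2 s(h),
    whose Lipschitz constant shrinks with the radius. *)
Lemma poly_flat q x0 (eta : R) : (q^`()).[x0] = 0 -> 0 < eta ->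
  exists2 e, 0 < e & forall x y, nrm (x - x0) <= e -> nrm (y - x0) <= e ->
    nrm (q.[x] - q.[y]) <= eta * nrm (x - y).
Proof.
move=> q'0 eta0; pose p := q \Po ('X + x0%:P).
have pE h : q.[x0 + h] = p.[h] by rewrite horner_comp !hornerE addrC.
have p1 : p`_1 = 0.
  have -> : p`_1 = (p^`()).[0] by rewrite horner_coef0 coef_deriv mulr1n.
  by rewrite /p deriv_comp derivD derivX derivC addr0 mulr1 horner_comp !hornerE.
pose s := \poly_(i < size p) p`_i.+2.
have pS h : p.[h] = p.[0] + h ^+ 2 * s.[h].
  have -> : p = (p.[0])%:P + 'X^2 * s.
    apply/polyP => -[|[|i]]; rewrite coefD coefC coefXnM /=.
    - by rewrite addr0 horner_coef0.
    - by rewrite p1 addr0.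
    rewrite add0r !subSS subn0 coef_poly; case: ltnP => // le_i.
    by rewrite nth_default // ltnW // ltnW.
  by rewrite !hornerE ?hornerXn ?expr0n ?mul0r ?addr0.
have [B B0 HB] := poly_bounded s 1; have [L L0 HL] := poly_lipschitz s 1.
have K0 : 0 < 2 * B + L by rewrite addr_gt0 // mulr_gt0.
exists (Num.min 1 (eta / (2 * B + L))) => [|x y].
  by rewrite lt_min ltr01 divr_gt0.
rewrite !le_min => /andP[x1 xe] /andP[y1 ye].
have [h hE] : exists h, x - x0 = h by eexists.
have [k kE] : exists k, y - x0 = k by eexists.
have -> : x = x0 + h by rewrite -hE addrC subrK.
have -> : y = x0 + k by rewrite -kE addrC subrK.
rewrite hE in x1 xe; rewrite kE in y1 ye.
rewrite !pE pS (pS k) opprD addrACA subrr add0r [x0 + h]addrC addrKA.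
have -> : h ^+ 2 * s.[h] - k ^+ 2 * s.[k] =
  (h - k) * ((h + k) * s.[h]) + k ^+ 2 * (s.[h] - s.[k]) by ring.
apply: le_trans (nrmD _ _) _.
rewrite [nrm (k ^+ 2 * _)]nrmM nrmX nrmM [nrm ((h + k) * _)]nrmM.
rewrite ler_pdivlMr // in xe; rewrite ler_pdivlMr // in ye.
have hk := nrm_ge0 (h - k); have h0 := nrm_ge0 h; have k0 := nrm_ge0 k.
have b1 : nrm (h + k) * nrm s.[h] <= (nrm h + nrm k) * B.
  by apply: ler_pM; rewrite ?nrm_ge0 ?nrmD ?HB.
have b2 : nrm k ^+ 2 * nrm (s.[h] - s.[k]) <= nrm k * (L * nrm (h - k)).
  apply: ler_pM; rewrite ?exprn_ge0 ?nrm_ge0 ?HL // expr2.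
  by rewrite -[leRHS]mulr1 ler_wpM2l.
have b3 := ler_wpM2l hk b1.
apply: le_trans (lerD b3 b2) _.
rewrite (_ : _ + _ = ((nrm h + nrm k) * B + nrm k * L) * nrm (h - k)); last by ring.
by apply: ler_wpM2r => //; nra.
Qed.

Lemma near_poly_coef (P : C -> {poly C}) N w0 x : (forall w, (size (P w) <= N)%N) ->
  (forall k, holo (fun w => (P w)`_k) w0) -> holo (fun w => (P w).[x]) w0.
Proof.
move=> PN Ph; apply: (holo_ext (g := fun w => \sum_(k < N) (P w)`_k * x ^+ k)).
  by move=> w; rewrite (horner_coef_wide _ (PN w)).
by apply: holo_sum => k _; apply: holoM (holo_cst _ _).
Qed.

Lemma pow_lipschitz (M : R) N : exists2 L, 0 < L & forall k x y, (k < N)%N ->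
  nrm x <= M -> nrm y <= M -> nrm (x ^+ k - y ^+ k) <= L * nrm (x - y).
Proof.
elim: N => [|N [L L0 IH]]; first by exists 1.
have [L' L'0 HL] := poly_lipschitz 'X^N M; exists (L + L'); first by rewrite addr_gt0.
move=> k x y; rewrite ltnS leq_eqVlt => /predU1P[->|lt_k] xM yM.
  have := HL x y xM yM; rewrite !hornerXn => /le_trans; apply.
  by rewrite ler_wpM2r ?nrm_ge0 // lerDr ltW.
apply: le_trans (IH k x y lt_k xM yM) _.
by rewrite ler_wpM2r ?nrm_ge0 // lerDl ltW.
Qed.

Lemma holo_apx_common (I : finType) (F : I -> C -> C) w0 :
  (forall i, holo (F i) w0) -> exists2 r : R, 0 < r & forall i, apx (F i) w0 r.
Proof.
move=> HF; suff [r r0 Hr] : exists2 r : R, 0 < r & forall i, i \in enum I -> apx (F i) w0 r.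
  by exists r => // i; apply: Hr; rewrite mem_enum.
elim: (enum I) => [|i s [r r0 Hr]]; first by exists 1.
have [d d0 Hd] := HF i; exists (Num.min d r) => [|j]; first by rewrite lt_min d0.
rewrite inE => /predU1P[->|/Hr Hj].
  by apply: apx_le Hd; rewrite ge_min lexx.
by apply: apx_le Hj; rewrite ge_min lexx orbT.
Qed.

Lemma near_finite (I : finType) (P : I -> C -> Prop) w0 :
  (forall i, \forall w \near w0, P i w) -> \forall w \near w0, forall i, P i w.
Proof.
move=> HP; suff /nearP[r r0 Hr] : \forall w \near w0, forall i, i \in enum I -> P i w.
  by apply/nearP; exists r => // w /Hr H i; apply: H; rewrite mem_enum.
elim: (enum I) => [|i s IHs]; first by apply/nearP; exists 1.
near=> w => j; rewrite inE => /predU1P[->|]; first by near: w; apply: HP.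
by move: j; near: w.
Unshelve. all: by end_near. Qed.

Lemma near_dnear_finite (I : finType) (P : I -> C -> Prop) w0 :
  (forall i, \forall w \near w0^', P i w) -> \forall w \near w0^', forall i, P i w.
Proof.
move=> HP; have [|r r0 Hr] := (nearP w0 _).1 (near_finite (P := fun i w => w != w0 -> P i w) _).
  by move=> i; have /dnearP[r r0 Hr] := HP i; apply/nearP; exists r.
by apply/dnearP; exists r => // w lt_w w_neq i; apply: Hr.
Qed.

(* Simplified Newton iteration x |-> x - P_w(x) / P_w0'(x0). *)
Theorem local_root (P : C -> {poly C}) N w0 x0 : (forall w, (size (P w) <= N)%N) ->
  (forall k, holo (fun w => (P w)`_k) w0) ->
  (P w0).[x0] = 0 -> ((P w0)^`()).[x0] != 0 ->
  exists r : C -> C, [/\ holo r w0, r w0 = x0 & \forall w \near w0, (P w).[r w] = 0].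
Proof.
move=> PN Ph Px0; have [D DE] : exists D, ((P w0)^`()).[x0] = D by eexists.
rewrite DE => D0; have nD : 0 < nrm D by rewrite nrm_gt0.
have D4 : 0 < nrm D / 4 by rewrite divr_gt0.
have [|e e0 flat] := @poly_flat (P w0 - D *: 'X) x0 _ _ D4.
  by rewrite derivB derivZ derivX !hornerE DE subrr.
pose M := nrm x0 + e; have [L L0 HL] := pow_lipschitz M N.
have [rc rc0 Hrc] := holo_apx_common (fun k : 'I_N => Ph k).
(* The contraction constant 1/2 is the sum of 1/4 from [flat] and 1/4 from the variation of the N
   coefficients, weighted by the Lipschitz constant L of the powers. *)
have tol : 0 < nrm D / 4 / (N%:R + 1) / L.
  by rewrite !divr_gt0 // ltr_wpDl.
have [d1 d10 Hd1] := (nearP w0 _).1 (near_finite (fun k : 'I_N => holo_continuous (Ph k) tol)).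
(* The first step then moves x0 by at most e/4, so the iterates of the contraction stay within e/2
   of x0. *)
have De : 0 < nrm D * e / 4 by rewrite divr_gt0 // mulr_gt0.
have [d2 d20 Hd2] := (nearP w0 _).1 (holo_continuous (near_poly_coef x0 PN Ph) De).
pose d := Num.min rc (Num.min d1 d2).
have d0 : 0 < d by rewrite !lt_min rc0 d10.
pose T w x := x - (P w).[x] / D.
have Tc w x y : nrm (w - w0) < d -> nrm (x - x0) <= e -> nrm (y - x0) <= e ->
    nrm (T w x - T w y) <= 2^-1 * nrm (x - y).
  rewrite !lt_min => /and3P[_ /Hd1 Hw _] xe ye.
  have in_M u : nrm (u - x0) <= e -> nrm u <= M.
    move=> ue; rewrite -(subrK x0 u) addrC; apply: le_trans (nrmD _ _) _.
    by rewrite lerD2l.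
  have h1 := flat x y xe ye.
  have h2 : nrm (\sum_(k < N) ((P w)`_k - (P w0)`_k) * (x ^+ k - y ^+ k)) <= nrm D / 4 * nrm (x - y).
    apply: le_trans (nrm_sum _ _ _) _.
    apply: le_trans (_ : \sum_(k < N) nrm D / 4 / (N%:R + 1) * nrm (x - y) <= _).
      apply: ler_sum => k _; rewrite nrmM.
      rewrite (_ : _ * nrm (x - y) = nrm D / 4 / (N%:R + 1) / L * (L * nrm (x - y))).
        by apply: ler_pM; rewrite ?nrm_ge0 ?HL ?in_M // ltW.
      by rewrite mulrA divfK // gt_eqF.
    rewrite sumr_const card_ord -[leLHS]mulr_natl mulrA; apply: ler_wpM2r; first exact: nrm_ge0.
    rewrite mulrCA -[leRHS]mulr1; apply: ler_wpM2l; first exact: ltW.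
    by rewrite ler_pdivrMr ?ltr_wpDl // mul1r lerDl.
  have E : D * (T w x - T w y) = - (((P w0 - D *: 'X).[x] - (P w0 - D *: 'X).[y]) +
      \sum_(k < N) ((P w)`_k - (P w0)`_k) * (x ^+ k - y ^+ k)).
    have -> : \sum_(k < N) ((P w)`_k - (P w0)`_k) * (x ^+ k - y ^+ k) =
        (P w).[x] - (P w).[y] - ((P w0).[x] - (P w0).[y]).
      rewrite !(horner_coef_wide _ (PN _)) -!sumrB; apply: eq_bigr => k _; ring.
    by rewrite /T !(hornerD, hornerN, hornerZ, hornerX); field.
  rewrite -(ler_pM2l nD) -nrmM E nrmN; apply: le_trans (nrmD _ _) _.
  by apply: le_trans (lerD h1 h2) _; lra.
have T0 w : nrm (w - w0) < d -> nrm (T w x0 - x0) <= e / 4.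
  rewrite !lt_min => /and3P[_ _ /Hd2]; rewrite Px0 subr0 => /ltW Hw.
  rewrite /T addrAC subrr add0r nrmN nrmM nrmV ler_pdivrMr //.
  by rewrite [leRHS]mulrC mulrA.
pose X k w := iter k (T w) x0.
have Xb w k : nrm (w - w0) < d -> nrm (X k w - x0) <= e / 2 /\
    nrm (X k.+1 w - X k w) <= e / 4 * 2^-1 ^+ k.
  move=> lt_w; elim: k => [|k [IH1 IH2]].
    by rewrite /X /= subrr nrm0 expr0 mulr1 T0 // divr_ge0 // ltW.
  have e2e : e / 2 <= e by lra.
  have X1 : nrm (X k.+1 w - x0) <= e / 2.
    apply: le_trans (nrm_triangle (T w x0) _ _) _; have := T0 w lt_w.
    have := Tc w (X k w) x0 lt_w (le_trans IH1 e2e); rewrite subrr nrm0 => /(_ (ltW e0)).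
    by rewrite /X /=; lra.
  split => //; have := Tc w _ _ lt_w (le_trans X1 e2e) (le_trans IH1 e2e).
  move=> h; apply: le_trans h _; rewrite exprS mulrCA ler_pM2l // invr_gt0 //.
have Xd w k m : nrm (w - w0) < d -> nrm (X (k + m)%N w - X k w) <= e / 2 * (2^-1 ^+ k - 2^-1 ^+ (k + m)).
  move=> lt_w; elim: m => [|m IHm]; first by rewrite addn0 !subrr nrm0 mulr0.
  rewrite addnS; apply: le_trans (nrm_triangle (X (k + m)%N w) _ _) _.
  have [_ h] := Xb w (k + m)%N lt_w; apply: le_trans (lerD h IHm) _.
  by rewrite exprS; lra.
have half01 : 0 <= (2^-1 : R) < 1 by apply/andP; split; lra.
have half_ge0 k : 0 <= 2^-1 ^+ k :> R by rewrite exprn_ge0 // invr_ge0.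
have lim w : exists l, nrm (w - w0) < d -> forall eps : R, 0 < eps ->
    exists K, forall k, (K <= k)%N -> nrm (X k w - l) < eps.
  have [lt_w|] := pselect (nrm (w - w0) < d : Prop); last by exists 0.
  have [|l Hl] := @complete_C R (X ^~ w); last by exists l.
  move=> eps eps0; have [K HK] := pow_small half01 (divr_gt0 eps0 e0).
  suff H n m : (K <= n)%N -> (n <= m)%N -> nrm (X m w - X n w) < eps.
    exists K => n m le_n le_m; have [le_nm|/ltnW le_mn] := leqP n m; last exact: H.
    by rewrite nrmBC; apply: H.
  move=> /HK; rewrite ltr_pdivlMr // => lt_n le_m; rewrite -(subnKC le_m).
  apply: le_lt_trans (Xd _ _ _ lt_w) _; apply: le_lt_trans lt_n.
  by have := half_ge0 (n + (m - n))%N; have := half_ge0 n; nra.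
have /choice[r Hr] := lim.
have rX w k : nrm (w - w0) < d -> nrm (r w - X k w) <= e * 2^-1 ^+ k.
  move=> lt_w; apply/ler_addgt0Pr => eps eps0; have [K HK] := Hr w lt_w eps eps0.
  apply: le_trans (nrm_triangle (X (k + K)%N w) _ _) _.
  have h1 := HK (k + K)%N (leq_addl _ _); rewrite nrmBC in h1.
  have h2 := Xd w k K lt_w; have := half_ge0 (k + K)%N; have := half_ge0 k.
  by move: h1 h2; nra.
have x0E k : X k w0 = x0 by elim: k => // k IHk; rewrite /X /= -/(X k w0) IHk /T Px0 mul0r subr0.
have w00 : nrm (w0 - w0) < d by rewrite subrr nrm0.
exists r; split.
(* Each iterate comes from the coefficients of P by ring operations, hence is approximable on one
   common disc, and the convergence is uniform in w. *)
- exists d => //; apply: apx_lim => eps eps0.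
  have [K HK] := pow_small half01 (divr_gt0 eps0 e0).
  exists (X K); last first.
    move=> w lt_w; apply: le_lt_trans (rX w K lt_w) _.
    by have := HK K (leqnn _); rewrite ltr_pdivlMr // mulrC.
  elim: K {HK} => [|k IHk]; first exact: apx_cst.
  apply: apx_ext (apxB IHk (apxM (_ : apx (fun w => (P w).[X k w]) w0 d) (apx_cst D^-1 _ _))) => //.
  apply: (apx_ext (g := fun w => \sum_(j < N) (P w)`_j * X k w ^+ j)).
    by move=> w _; rewrite (horner_coef_wide _ (PN w)).
  apply: apx_sum => j _; apply: apxM (apxX _ IHk).
  by apply: apx_le (Hrc j); rewrite ge_min lexx.
- apply/eqP; rewrite -subr_eq0; apply/eqP; apply: nrm_eq0_small => eps eps0.
  have [K HK] := Hr w0 w00 eps eps0.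
  by have := HK K (leqnn _); rewrite x0E nrmBC => /ltW.
- apply/nearP; exists d => // w lt_w.
  have [B B0 HB] := poly_lipschitz (P w) (nrm x0 + 2 * e).
  have inM k : nrm (X k w) <= nrm x0 + 2 * e.
    have [h _] := Xb w k lt_w; rewrite -(subrK x0 (X k w)) addrC.
    by apply: le_trans (nrmD _ _) _; lra.
  have rM : nrm (r w) <= nrm x0 + 2 * e.
    have := rX w 0%N lt_w; rewrite expr0 mulr1 => h; rewrite -(subrK x0 (r w)) addrC.
    by apply: le_trans (nrmD _ _) _; move: h; rewrite /X /=; lra.
  apply/eqP; rewrite -nrm_eq0 eq_le nrm_ge0 andbT.
  apply: (small_of_bound (M := (B + nrm D) * e) half01) => k.
  have PX : (P w).[X k w] = - D * (X k.+1 w - X k w).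
    by rewrite /X /= -/(X k w) /T; field.
  have h1 := HB (r w) (X k w) rM (inM k); have h2 := rX w k lt_w.
  have [_ h3] := Xb w k lt_w.
  have : nrm (P w).[r w] <= nrm ((P w).[r w] - (P w).[X k w]) + nrm (P w).[X k w].
    by apply: le_trans (nrmD _ _); rewrite subrK.
  move=> /le_trans; apply; rewrite [X in _ + nrm X]PX nrmM nrmN.
  have h4 := ler_wpM2l (ltW B0) h2; have h5 := ler_wpM2l (ltW nD) h3.
  apply: le_trans (lerD (le_trans h1 h4) h5) _.
  rewrite (_ : (B + nrm D) * e * 2^-1 ^+ k = B * (e * 2^-1 ^+ k) + nrm D * (e * 2^-1 ^+ k)); last by ring.
  rewrite lerD2l ler_pM2l // ler_wpM2r //; lra.
Qed.

End LocalRoots.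

(** * Continuation of a relation along a horizontal line *)

Section Continuation.
Variable R : realType.
Local Notation C := (CC R).
Implicit Types (z w x : C) (p q : {poly C}) (e : R).

Lemma near_open (P : C -> Prop) w0 : (\forall w \near w0, P w) ->
  \forall w \near w0, \forall v \near w, P v.
Proof.
move=> /nearP[r r0 Hr]; apply/nearP; exists r => // w lt_w.
apply/nearP; exists (r - nrm (w - w0)); first by rewrite subr_gt0.
move=> v lt_v; apply: Hr; apply: le_lt_trans (nrm_triangle w _ _) _.
by rewrite -ltrBrDr.
Qed.

Lemma near_mp (P Q : C -> Prop) w0 : (\forall w \near w0, P w) ->
  (forall w, P w -> Q w) -> \forall w \near w0, Q w.
Proof. by move=> /nearP[r r0 Hr] PQ; apply/nearP; exists r => // w /Hr/PQ. Qed.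

Lemma near_and (P Q : C -> Prop) w0 : (\forall w \near w0, P w) ->
  (\forall w \near w0, Q w) -> \forall w \near w0, P w /\ Q w.
Proof. by move=> HP HQ; near=> w; split; near: w. Unshelve. all: by end_near. Qed.

Lemma prod_codom n (f : 'I_n -> C) :
  \prod_i ('X - (f i)%:P) = \prod_(z <- codom f) ('X - z%:P).
Proof. by rewrite big_map big_enum. Qed.

Lemma separable_injective n (f : 'I_n -> C) :
  separable_poly (\prod_i ('X - (f i)%:P)) -> injective f.
Proof. by rewrite prod_codom separable_prod_XsubC => /injectiveP. Qed.

Lemma root_prod n (f : 'I_n -> C) x :
  (\prod_i ('X - (f i)%:P)).[x] = 0 -> exists i, x = f i.
Proof.
move=> /eqP; rewrite -[_ == 0]/(root _ _) prod_codom root_prod_XsubC => /codomP.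
by case=> i ->; exists i.
Qed.

Lemma monic_roots_prod p n (f : 'I_n -> C) : p \is monic -> size p = n.+1 ->
  injective f -> (forall i, p.[f i] = 0) -> p = \prod_i ('X - (f i)%:P).
Proof.
move=> p_monic sz_p f_inj pf; rewrite prod_codom.
rewrite [LHS](@all_roots_prod_XsubC _ p (codom f)) ?(monicP p_monic) ?scale1r //.
- by rewrite size_codom card_ord.
- by apply/allP => x /codomP[i ->]; apply/rootP.
- by rewrite uniq_rootsE; apply/injectiveP.
Qed.

Variables (A : C -> {poly C}) (n : nat).
Hypothesis A_monic : forall w, A w \is monic.
Hypothesis A_size : forall w, size (A w) = n.+1.

Definition splits (r : 'I_n -> C -> C) w :=
  (forall i, holo (r i) w) /\ \forall v \near w, A v = \prod_i ('X - (r i v)%:P).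

Lemma splits_open r w : splits r w -> \forall v \near w, splits r v.
Proof.
case=> r_holo rA; have h1 := near_finite (fun i => holo_open (r_holo i)).
by apply: (near_mp (near_and h1 (near_open rA))).
Qed.

Lemma local_splitting w0 : (forall k, holo (fun w => (A w)`_k) w0) ->
  separable_poly (A w0) -> exists r, splits r w0.
Proof.
move=> A_holo A_sep; have [s sE] := closed_field_poly_normal (A w0).
rewrite (monicP (A_monic w0)) scale1r in sE.
have s_uniq : uniq s by rewrite -separable_prod_XsubC -sE.
have s_size : size s = n.
  by apply/eqP; rewrite -eqSS -(A_size w0) sE size_prod_XsubC.
have sz w : (size (A w) <= n.+1)%N by rewrite A_size.
have /fin_all_exists[r Hr] : forall i : 'I_n, exists r, [/\ holo r w0, r w0 = s`_i &
    \forall w \near w0, (A w).[r w] = 0].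
  move=> i; have s_root : root (A w0) s`_i.
    by rewrite sE root_prod_XsubC mem_nth // s_size.
  apply: (local_root sz A_holo); first exact/rootP.
  by have := A_sep; rewrite unlock => /coprimep_root; apply.
have r_holo i : holo (r i) w0 by case: (Hr i).
exists r; split => //.
have r_root : \forall w \near w0, forall i, (A w).[r i w] = 0.
  by apply: near_finite => i; case: (Hr i).
have r_inj : \forall w \near w0, forall ij : 'I_n * 'I_n, ij.1 != ij.2 -> r ij.1 w - r ij.2 w != 0.
  apply: near_finite => -[i j] /=; have [->|ij] := eqVneq i j; first by apply/nearP; exists 1.
  have := holo_neq0 (holoB (r_holo i) (r_holo j)) _; move=> H.
  apply: near_mp (H _) _ => //; case: (Hr i) => _ -> _; case: (Hr j) => _ -> _.
  by rewrite subr_eq0 nth_uniq ?s_size.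
apply: (near_mp (near_and r_root r_inj)) => w [rw iw].
apply: monic_roots_prod => // i j E; apply/eqP; apply: contraT => ij.
by have := iw (i, j) ij; rewrite /= E subrr eqxx.
Qed.

(** At w0 both families list the same distinct roots; by continuity r_i stays away from every s_j
    other than its partner, so the matching persists. *)
Lemma splitting_unique (r s : 'I_n -> C -> C) w0 : separable_poly (A w0) ->
  splits r w0 -> splits s w0 ->
  exists2 tau : 'I_n -> 'I_n, injective tau &
    \forall w \near w0, forall i, r i w = s (tau i) w.
Proof.
move=> A_sep [r_holo rA] [s_holo sA].
have r_inj : injective (r ^~ w0) by apply: separable_injective; rewrite -(near_exists rA).
have s_inj : injective (s ^~ w0) by apply: separable_injective; rewrite -(near_exists sA).
have root_rs w : A w = \prod_i ('X - (r i w)%:P) -> A w = \prod_i ('X - (s i w)%:P) ->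
    forall i, exists j, r i w = s j w.
  move=> Er Es i; apply: root_prod; rewrite -Es Er (bigD1 i) //= hornerM.
  by rewrite hornerXsubC subrr mul0r.
have /fin_all_exists[tau tauE] := root_rs _ (near_exists rA) (near_exists sA).
exists tau; first by move=> i j E; apply: r_inj; rewrite !tauE E.
have sep : \forall w \near w0, forall ij : 'I_n * 'I_n, ij.2 != tau ij.1 -> r ij.1 w - s ij.2 w != 0.
  apply: near_finite => -[i j] /=; have [->|ij] := eqVneq j (tau i).
    by apply/nearP; exists 1.
  apply: near_mp (holo_neq0 (holoB (r_holo i) (s_holo j)) _) _ => //.
  by rewrite tauE subr_eq0 (inj_eq s_inj) eq_sym.
apply: (near_mp (near_and (near_and rA sA) sep)) => w [[Er Es] sw] i.
have [j E] := root_rs w Er Es i; have [<-//|ij] := eqVneq j (tau i).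
by have := sw (i, j) ij; rewrite /= E subrr eqxx.
Qed.

Variables (z : C) (Rel : ('I_n -> C -> C) -> C -> C).
Let line (t : R) : C := z + ofR t.
Hypothesis A_holo : forall t k, holo (fun w => (A w)`_k) (line t).
Hypothesis A_sep : forall t, separable_poly (A (line t)).
Hypothesis Rel_holo : forall t r, splits r (line t) -> holo (Rel r) (line t).
Hypothesis Rel_local : forall t (r s : 'I_n -> C -> C),
  (\forall w \near line t, forall i, r i w = s i w) ->
  \forall w \near line t, Rel r w = Rel s w.

(** The ordering of the roots is quantified afresh at each point, so no path of orderings has to be
    tracked and monodromy is harmless. *)
Definition relation_at w := exists2 r, splits r w & \forall v \near w, Rel r v = 0.

(** The parameters where the relation holds form an open and closed set. Near a given point all
    orderings are permutations of one local splitting; if none of them satisfies the relation there,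
    each of these finitely many holomorphic functions is nonzero on a punctured neighbourhood. *)
Theorem relation_continuation : relation_at z -> forall t, relation_at (line t).
Proof.
move=> Ez t; have line0 : line 0 = z by rewrite /line rmorph0 addr0.
have near_line (Q : C -> Prop) u : (\forall v \near line u, Q v) ->
    exists2 d : R, 0 < d & forall s, `|s - u| < d -> Q (line s).
  move=> /nearP[d d0 Hd]; exists d => // s lt_s; apply: Hd.
  by rewrite /line opprD addrACA subrr add0r -rmorphB nrm_ofR.
apply: (@clopen_line R (relation_at \o line) _ 0 t); last by rewrite /= line0.
move=> u /=; have [r r_split] := local_splitting (A_holo u) (A_sep u).
pose rs (sigma : {ffun 'I_n -> 'I_n}) (i : 'I_n) := r (sigma i).
have rs_split (sigma : {ffun 'I_n -> 'I_n}) v : injective sigma -> splits r v -> splits (rs sigma) v.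
  move=> s_inj [r_holo rA]; split=> [i|]; first exact: r_holo.
  by apply: (near_mp rA) => w ->; rewrite (reindex_inj s_inj).
have [[sigma s_inj Rel0]|none] := pselect (exists2 sigma : {ffun 'I_n -> 'I_n},
    injective sigma & \forall v \near line u, Rel (rs sigma) v = 0).
  have /near_line[d d0 Hd] : \forall v \near line u, relation_at v.
    apply: (near_mp (near_and (splits_open r_split) (near_open Rel0))) => v [rv Rv].
    by exists (rs sigma) => //; apply: rs_split.
  by exists d => //; left.
have Rel_neq0 : \forall v \near (line u)^', forall sigma : {ffun 'I_n -> 'I_n},
    injective sigma -> Rel (rs sigma) v != 0.
  apply: near_dnear_finite => sigma.
  have [s_inj|] := pselect (injective sigma); last by move=> ns; apply/dnearP; exists 1.
  have [d d0 Hd] := Rel_holo (rs_split sigma _ s_inj r_split).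
  have [R0|[k [g [d' V]]]] := holo_dichotomy d0 Hd.
    by case: none; exists sigma => //; apply/nearP; exists d.
  apply/dnearP; exists d'; first by case: V.
  by move=> v lt_v v_neq _; apply: vanishing_order_neq0 V _ lt_v v_neq.
have /dnearP[d1 d10 Hd1] := Rel_neq0; have /nearP[d2 d20 Hd2] := splits_open r_split.
exists (Num.min d1 d2); first by rewrite lt_min d10.
right=> s; rewrite lt_min => /andP[s1 s2] [r' r'_split r'0].
have dist : nrm (line s - line u) = `|s - u|.
  by rewrite /line opprD addrACA subrr add0r -rmorphB nrm_ofR.
have rs_s := Hd2 (line s); rewrite dist in rs_s.
have [tau tau_inj tauE] := splitting_unique (A_sep s) r'_split (rs_s s2).
pose sigma := [ffun i => tau i] : {ffun 'I_n -> 'I_n}.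
have s_inj : injective sigma by move=> i j; rewrite !ffunE => /tau_inj.
have RelE : \forall w \near line s, Rel (rs sigma) w = 0.
  have loc : \forall w \near line s, Rel r' w = Rel (rs sigma) w.
    apply: Rel_local; apply: (near_mp tauE) => w E i.
    by rewrite E /rs ffunE.
  by apply: (near_mp (near_and loc r'0)) => w [<-].
have [E|neq] := eqVneq (line s) (line u).
  by apply: none; exists sigma; [exact: s_inj|rewrite -E; exact: RelE].
have := Hd1 (line s); rewrite dist => /(_ s1 neq sigma s_inj).
by rewrite (near_exists RelE) eqxx.
Qed.

End Continuation.

(** * Polynomials over the field of periodic functions *)

Section PeriodicField.
Variable R : realType.
Local Notation C := (CC R).
Local Notation fn := (C -> C).
Implicit Types (z w : C) (f g : fn) (p q : {poly fn}).

Definition evalf w f : C := f w.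

Lemma evalf_is_additive w : additive (evalf w). Proof. by []. Qed.
Lemma evalf_is_multiplicative w : multiplicative (evalf w). Proof. by split. Qed.
HB.instance Definition _ w := GRing.isAdditive.Build fn C (evalf w) (evalf_is_additive w).
HB.instance Definition _ w :=
  GRing.isMultiplicative.Build fn C (evalf w) (evalf_is_multiplicative w).

(** Elements of k are representatives up to [mero_eq], so [{poly fn}] has zero divisors. The algebra
    is carried out on [pev w p], in C[X], at all points w of a punctured neighbourhood. *)
Definition pev w p : {poly C} := map_poly (evalf w) p.

Lemma pev_coef w p i : (pev w p)`_i = p`_i w.
Proof. by rewrite coef_map. Qed.

Lemma pev_horner w p f : (pev w p).[f w] = p.[f] w.
Proof. by rewrite -[f w]/(evalf w f) horner_map. Qed.

Lemma pev_monic w p : p \is monic -> pev w p \is monic.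
Proof. exact: monic_map. Qed.

Lemma pev_size w p : p \is monic -> size (pev w p) = size p.
Proof.
move=> p_monic; rewrite /pev size_map_poly_id0 // (monicP p_monic).
by rewrite rmorph1 oner_eq0.
Qed.

Lemma periodic_fieldP f : periodic_field f <->
  (forall z, mer_at f z) /\ (forall z, \forall w \near z^', f (w + 1) = f w).
Proof.
split=> [[/meromorphicP Hf Hp]|[Hf Hp]]; split.
- exact: Hf.
- by move=> z; apply: Hp.
- exact/meromorphicP.
- by move=> z _; apply: Hp.
Qed.

Lemma pf_binop (op : C -> C -> C) f g :
  (forall z, mer_at f z -> mer_at g z -> mer_at (fun w => op (f w) (g w)) z) ->
  periodic_field f -> periodic_field g -> periodic_field (fun w => op (f w) (g w)).
Proof.
move=> mer_op /periodic_fieldP[mf pf] /periodic_fieldP[mg pg].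
apply/periodic_fieldP; split=> z; first exact: mer_op.
by apply: (dnear_mp (dnear_and (pf z) (pg z))) => w [-> ->].
Qed.

Lemma pfD f g : periodic_field f -> periodic_field g -> periodic_field (f + g).
Proof. exact: (pf_binop (op := +%R) (fun z => @merD R f g z)). Qed.

Lemma pfM f g : periodic_field f -> periodic_field g -> periodic_field (f * g).
Proof. exact: (pf_binop (op := *%R) (fun z => @merM R f g z)). Qed.

Lemma pf_cst c : periodic_field (fun=> c : C).
Proof.
apply/periodic_fieldP; split=> z; first exact/holo_mer/holo_cst.
by apply/dnearP; exists 1.
Qed.

Lemma pf0 : periodic_field (0 : fn). Proof. exact: (pf_cst 0). Qed.
Lemma pf1 : periodic_field (1 : fn). Proof. exact: (pf_cst 1). Qed.

Lemma pfN f : periodic_field f -> periodic_field (- f).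
Proof.
move=> Hf; have -> : - f = (fun=> -1) * f :> fn.
  by apply/funext => w /=; rewrite -[RHS]/(-1 * f w) mulN1r.
exact: pfM (pf_cst _) Hf.
Qed.

Lemma pfB f g : periodic_field f -> periodic_field g -> periodic_field (f - g).
Proof. by move=> Hf /pfN; apply: pfD. Qed.

Lemma pfMn f n : periodic_field f -> periodic_field (f *+ n).
Proof.
move=> Hf; elim: n => [|n IHn]; first by rewrite mulr0n; apply: pf0.
by rewrite mulrS; apply: pfD.
Qed.

Lemma pf_div f g : periodic_field f -> periodic_field g ->
  periodic_field (fun w => f w / g w).
Proof. by apply: (pf_binop (op := fun a b => a / b)) => z Hf Hg; apply: merM Hf (merV Hg). Qed.

Lemma pf_sum (I : Type) (s : seq I) (P : pred I) (F : I -> fn) :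
  (forall i, P i -> periodic_field (F i)) -> periodic_field (\sum_(i <- s | P i) F i).
Proof. by move=> HF; elim/big_ind: _ => //; [exact: pf0|exact: pfD]. Qed.

Lemma pf_prod (I : Type) (s : seq I) (P : pred I) (F : I -> fn) :
  (forall i, P i -> periodic_field (F i)) -> periodic_field (\prod_(i <- s | P i) F i).
Proof. by move=> HF; elim/big_ind: _ => //; [exact: pf1|exact: pfM]. Qed.

Lemma pf_propagation f z : periodic_field f -> ~ mero_eq setT f 0 ->
  \forall w \near z^', f w != 0.
Proof. by move=> /periodic_fieldP[mf _] f0; apply: mer_propagation. Qed.

Definition kpoly p := forall i, periodic_field p`_i.

Lemma kpolyD p q : kpoly p -> kpoly q -> kpoly (p + q).
Proof. by move=> Hp Hq i; rewrite coefD; apply: pfD. Qed.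

Lemma kpolyB p q : kpoly p -> kpoly q -> kpoly (p - q).
Proof. by move=> Hp Hq i; rewrite coefB; apply: pfB. Qed.

Lemma kpolyM p q : kpoly p -> kpoly q -> kpoly (p * q).
Proof. by move=> Hp Hq i; rewrite coefM; apply: pf_sum => j _; apply: pfM. Qed.

Lemma kpoly1 : kpoly 1.
Proof. by move=> i; rewrite coef1; case: eqP => _; [exact: pf1|exact: pf0]. Qed.

Lemma kpoly_prod (I : Type) (s : seq I) (F : I -> {poly fn}) :
  (forall i, kpoly (F i)) -> kpoly (\prod_(i <- s) F i).
Proof. by move=> HF; elim/big_ind: _ => //; [exact: kpoly1|exact: kpolyM]. Qed.

Lemma kpoly_deriv p : kpoly p -> kpoly p^`().
Proof. by move=> Hp i; rewrite coef_deriv; apply: pfMn. Qed.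

Lemma kpoly_CXn c n : periodic_field c -> kpoly (c%:P * 'X^n).
Proof.
move=> Hc i; rewrite coefCM coefXn.
by case: eqP => _; rewrite ?mulr1 ?mulr0 //; apply: pf0.
Qed.

(** Long division is redone so that quotient and remainder visibly keep their coefficients in k; a
    monic divisor avoids inverting functions. *)
Lemma kpoly_divmod p d : kpoly p -> kpoly d -> d \is monic ->
  exists q r, [/\ kpoly q, kpoly r, p = q * d + r & (size r < size d)%N].
Proof.
move=> + Hd d_monic; move: {2}(size p) (leqnn (size p)) => n.
elim: n p => [|n IHn] p le_p Hp.
  exists 0, p; rewrite mul0r add0r; split=> //; first by move=> i; rewrite coef0; apply: pf0.
  by apply: leq_ltn_trans le_p _; rewrite size_poly_gt0 monic_neq0.
have [lt_pd|le_dp] := ltnP (size p) (size d).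
  by exists 0, p; rewrite mul0r add0r; split=> // i; rewrite coef0; apply: pf0.
have d_gt0 : (0 < size d)%N by rewrite size_poly_gt0 monic_neq0.
pose t := (p`_(size p).-1)%:P * 'X^(size p - size d).
have Ht : kpoly t by apply: kpoly_CXn.
have [||q [r [Hq Hr pE lt_r]]] := IHn (p - t * d).
- apply/leq_sizeP => j le_nj; rewrite coefB /t -mulrA coefCM coefXnM.
  have [lt_j|le_sj] := ltnP j (size p).-1.
    by move: le_nj; rewrite leqNgt => /negP[]; rewrite (leq_trans lt_j) // -ltnS prednK // (leq_trans d_gt0).
  have sp_gt0 : (0 < size p)%N := leq_trans d_gt0 le_dp.
  have ltF : (j < size p - size d)%N = false.
    apply/negbTE; rewrite -leqNgt; apply: leq_trans le_sj.
    by rewrite -subn1 leq_sub2l.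
  rewrite ltF; move: le_sj; rewrite leq_eqVlt => /predU1P[<-|lt_sj].
    have -> : ((size p).-1 - (size p - size d))%N = (size d).-1.
      by rewrite -!subn1 subnAC subKn.
    by rewrite -/(lead_coef d) (monicP d_monic) mulr1 subrr.
  have le_pj : (size p <= j)%N by rewrite -(prednK sp_gt0).
  rewrite (nth_default _ le_pj) [X in _ * X]nth_default ?mulr0 ?subrr //.
  by rewrite leq_subRL ?subnK // (leq_trans (leq_subr _ _)).
- exact: kpolyB Hp (kpolyM Ht Hd).
exists (t + q), r; split=> //; first exact: kpolyD.
by rewrite mulrDl -addrA -pE addrC subrK.
Qed.

Lemma monicize p : kpoly p -> (exists i, ~ mero_eq setT p`_i 0) ->
  exists q, [/\ q \is monic, kpoly q, (size q <= size p)%N &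
    forall z, \forall w \near z^', exists2 c : C, c != 0 & pev w p = c *: pev w q].
Proof.
move=> Hp [i0 Hi0].
have lt_size i : ~ mero_eq setT p`_i 0 -> (i < size p)%N.
  move=> Hi; rewrite ltnNge; apply/negP => le_i; apply: Hi => z _.
  by apply/dnearP; exists 1 => // w _ _; rewrite nth_default.
have ex : exists i, `[< ~ mero_eq setT p`_i 0 >] by exists i0; apply/asboolP.
have ub i : `[< ~ mero_eq setT p`_i 0 >] -> (i <= size p)%N by move/asboolP/lt_size/ltnW.
(* The formal degree of p is unreliable, as its leading coefficient may be zero up to [mero_eq]; d
   is the last index with a nonzero class. *)
case: (ex_maxnP ex ub) => d /asboolP Hd d_max.
(* The coefficient of index d is 1 rather than p_d / p_d, which is 0 at the zeros of p_d; so q is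
   monic at every point. *)
pose q := \poly_(j < d.+1) (if j == d then 1 else (fun w => p`_j w / p`_d w) : fn).
have q_coef j : q`_j = if (j < d.+1)%N then (if j == d then 1 else (fun w => p`_j w / p`_d w)) else 0.
  by rewrite coef_poly.
have q_d : q`_d = 1 by rewrite q_coef ltnSn eqxx.
have q_size : size q = d.+1.
  apply/eqP; rewrite eqn_leq size_poly ltnNge; apply/negP => le_d.
  by have := q_d; rewrite nth_default // => /esym/eqP; rewrite oner_eq0.
exists q; split.
- by rewrite monicE lead_coefE q_size q_d.
- move=> j; rewrite q_coef; case: ltnP => _; last exact: pf0.
  by case: eqP => _; [exact: pf1|exact: pf_div].
- by rewrite q_size lt_size.
move=> z; have p_hi : \forall w \near z^', forall j : 'I_(size p), (d < j)%N -> p`_j w = 0.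
  apply: near_dnear_finite => j; have [lt_j|le_j] := ltnP d j; last by apply/dnearP; exists 1.
  have /contrapT : ~ ~ mero_eq setT p`_j 0.
    by move=> /asboolP /d_max; rewrite leqNgt lt_j.
  by move=> /(_ z I) H; apply: (dnear_mp H).
apply: (dnear_mp (dnear_and (pf_propagation z (Hp d) Hd) p_hi)) => w [pd_neq0 p_hi0].
exists (p`_d w) => //; apply/polyP => j; rewrite coefZ !pev_coef q_coef.
have [le_j|lt_j] := leqP j d; rewrite ltnS.
  rewrite le_j; case: eqP => [->|_]; first by rewrite mulr1.
  by rewrite mulrC divfK.
rewrite leqNgt lt_j /= mulr0.
have [lt_js|le_js] := ltnP j (size p); last by rewrite nth_default.
by rewrite (p_hi0 (Ordinal lt_js)).
Qed.

End PeriodicField.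

(** * Minimal polynomials over the field of periodic functions *)

Section ConjugatePolynomial.
Variable R : realType.
Local Notation C := (CC R).
Local Notation fn := (C -> C).
Implicit Types (z w : C) (f g : fn) (p q A B : {poly fn}).

Definition vanishes_at p f z := \forall w \near z^', (pev w p).[f w] = 0.

Lemma merX f n z : mer_at f z -> mer_at (fun w => f w ^+ n) z.
Proof.
move=> Hf; elim: n => [|n IHn].
  by apply: (mer_near (g := fun=> 1)); [apply/dnearP; exists 1|exact/holo_mer/holo_cst].
apply: (mer_near (g := fun w => f w * f w ^+ n)); last exact: merM.
by apply/dnearP; exists 1 => // w _ _; rewrite exprS.
Qed.

Lemma mer_sum (I : Type) (s : seq I) (F : I -> fn) z :
  (forall i, mer_at (F i) z) -> mer_at (fun w => \sum_(i <- s) F i w) z.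
Proof.
move=> HF; elim: s => [|i s IHs].
  apply: (mer_near (g := fun=> 0)); last exact/holo_mer/holo_cst.
  by apply/dnearP; exists 1 => // w _ _; rewrite big_nil.
apply: (mer_near (g := fun w => F i w + \sum_(i <- s) F i w)); last exact: merD.
by apply/dnearP; exists 1 => // w _ _; rewrite big_cons.
Qed.

Lemma pev_coef_wide w p x : (pev w p).[x] = \sum_(i < size p) p`_i w * x ^+ i.
Proof.
rewrite (@horner_coef_wide _ (size p)) ?size_poly //.
by apply: eq_bigr => i _; rewrite pev_coef.
Qed.

Lemma mer_horner p f z : kpoly p -> mer_at f z -> mer_at (fun w => (pev w p).[f w]) z.
Proof.
move=> Hp Hf; apply: (mer_near (g := fun w => \sum_(i < size p) p`_i w * f w ^+ i)).
  by apply/dnearP; exists 1 => // w _ _; rewrite pev_coef_wide.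
apply: mer_sum => i; apply: merM (merX _ Hf).
by have /periodic_fieldP[mp _] := Hp i; apply: mp.
Qed.

Lemma vanishes_dichotomy p f z : kpoly p -> mer_at f z ->
  vanishes_at p f z \/ \forall w \near z^', (pev w p).[f w] != 0.
Proof. by move=> Hp Hf; apply: mer_zero_or_neq0 (mer_horner Hp Hf). Qed.

Lemma ex_min_size (Q : {poly fn} -> Prop) : (exists p, Q p) ->
  exists2 p, Q p & forall q, Q q -> (size p <= size q)%N.
Proof.
case=> p0 Qp0; have ex : exists k, `[< exists2 p, Q p & size p = k >].
  by exists (size p0); apply/asboolP; exists p0.
case: (ex_minnP ex) => k /asboolP[p Qp <-] k_min; exists p => // q Qq.
by apply: k_min; apply/asboolP; exists q.
Qed.

Variables (c0 : C) (m : nat).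

Definition annihilates (F : 'I_m -> fn) p :=
  [/\ p \is monic, kpoly p & forall i, vanishes_at p (F i) c0].

(** A family with one member gives the minimal polynomial of a function; the whole family zeta gives
    the polynomial whose roots are exactly the zeta_i. *)
Definition minimal_annihilator F p := annihilates F p /\
  forall q, annihilates F q -> (size p <= size q)%N.

(** Otherwise [monicize] would turn [r] into an annihilator smaller than [A]. *)
Lemma minimal_remainder F A r : minimal_annihilator F A -> kpoly r ->
  (forall i, vanishes_at r (F i) c0) -> (size r < size A)%N ->
  forall z, \forall w \near z^', pev w r = 0.
Proof.
move=> [_ A_min] Hr r0 lt_r z.
have [nz|all0] := pselect (exists i, ~ mero_eq setT r`_i 0).
  have [q [q_monic Hq le_q rq]] := monicize Hr nz.
  have : (size A <= size q)%N.
    apply: A_min; split=> // i; apply: (dnear_mp (dnear_and (r0 i) (rq c0))) => w [rz [c c_neq0 rw]].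
    by move: rz; rewrite rw hornerZ => /eqP; rewrite mulf_eq0 (negPf c_neq0) => /eqP.
  by rewrite leqNgt (leq_ltn_trans le_q lt_r).
have H : \forall w \near z^', forall i : 'I_(size r), r`_i w = 0.
  apply: near_dnear_finite => i; have /contrapT ri : ~ ~ mero_eq setT r`_i 0.
    by move=> ri; apply: all0; exists i.
  by apply: (dnear_mp (ri z I)) => w.
apply: (dnear_mp H) => w r_w; apply/polyP => i; rewrite pev_coef coef0.
have [lt_i|le_i] := ltnP i (size r); first exact: (r_w (Ordinal lt_i)).
by rewrite nth_default.
Qed.

Lemma minimal_divides F A B : minimal_annihilator F A -> kpoly B ->
  (forall i, vanishes_at B (F i) c0) ->
  exists2 q, kpoly q & forall z, \forall w \near z^', pev w B = pev w q * pev w A.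
Proof.
move=> A_min HB B0; have [[A_monic HA A0] _] := A_min.
have [q [r [Hq Hr BE lt_r]]] := kpoly_divmod HB HA A_monic.
have evE w : pev w B = pev w q * pev w A + pev w r.
  by rewrite BE /pev rmorphD rmorphM.
exists q => // z; have r0 i : vanishes_at r (F i) c0.
  apply: (dnear_mp (dnear_and (A0 i) (B0 i))) => w [Aw Bw].
  by have := Bw; rewrite evE hornerD hornerM Aw mulr0 add0r.
by apply: (dnear_mp (minimal_remainder A_min Hr r0 lt_r z)) => w r_w; rewrite evE r_w addr0.
Qed.

End ConjugatePolynomial.

(** * Separability of the minimal annihilator *)

Section Splitting.
Variable R : realType.
Local Notation C := (CC R).
Local Notation fn := (C -> C).
Variables (c0 : C) (n : nat) (zeta : 'I_n -> fn).
Hypothesis zeta_holo : forall i, holo (zeta i) c0.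
Hypothesis zeta_neq : forall i j, i != j -> \forall w \near c0^', zeta i w != zeta j w.

Lemma pev_deriv w (p : {poly fn}) : pev w p^`() = (pev w p)^`().
Proof. by rewrite /pev deriv_map. Qed.

(** If A' vanished at zeta_j, the minimal polynomial d of zeta_j, whose root zeta_j is simple in
    characteristic 0, would divide A twice; A / d would still annihilate the family, in smaller
    degree. *)
Lemma minimal_simple_root (A : {poly fn}) j : minimal_annihilator c0 zeta A ->
  \forall w \near c0^', ((pev w A)^`()).[zeta j w] != 0.
Proof.
move=> A_min; have [[A_monic HA A0] A_le] := A_min.
have zeta_mer i : mer_at (zeta i) c0 by apply/holo_mer.
have [dA0|] := vanishes_dichotomy (kpoly_deriv HA) (zeta_mer j); last first.
  by move=> H; apply: (dnear_mp H) => w; rewrite pev_deriv.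
pose F (_ : 'I_1) := zeta j.
have [d d_ann d_le] := ex_min_size (ex_intro (annihilates c0 F) A
  (And3 A_monic HA (fun i => A0 j))).
have d_min : minimal_annihilator c0 F d by [].
have [d_monic Hd d0] := d_ann.
have [h Hh Ah] := minimal_divides d_min HA (fun i => A0 j).
have size_d : (1 < size d)%N.
  rewrite ltnNge; apply/negP => le_d1.
  have [w _ dw] := dnear_exists (d0 ord0) ltr01.
  have /size1_polyC dE : (size (pev w d) <= 1)%N by rewrite pev_size.
  have := monicP (pev_monic w d_monic); rewrite dE lead_coefC => d1.
  by move: dw; rewrite dE hornerC d1 => /eqP; rewrite oner_eq0.
have d'_neq0 : \forall w \near c0^', (pev w d^`()).[zeta j w] != 0.
  have [d'0|//] := vanishes_dichotomy (kpoly_deriv Hd) (zeta_mer j).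
  have lt_d' : (size d^`() < size d)%N by rewrite lt_size_deriv // monic_neq0.
  have [w _ dw] := dnear_exists (minimal_remainder d_min (kpoly_deriv Hd) (fun i => d'0) lt_d' c0) ltr01.
  have [k kE] : exists k, size d = k.+2 by case: (size d) size_d => [|[|k]] // _; exists k.
  have dk : d`_k.+1 = 1 by rewrite -(monicP d_monic) lead_coefE kE.
  have := congr1 (fun p : {poly C} => p`_k) dw.
  rewrite pev_coef coef_deriv coef0 dk -[(1 *+ _) w]/(evalf w (1 *+ _)) rmorphMn rmorph1.
  by move=> /eqP; rewrite pnatr_eq0.
(* Differentiating A = h d leaves h d' at the root zeta_j of d, where d' does not vanish. *)
have h0 i : vanishes_at h (F i) c0.
  have Ah2 := dnear_open (Ah c0).
  apply: (dnear_mp (dnear_and (dnear_and dA0 d'_neq0) (dnear_and (Ah c0) (d0 i)))).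
  move=> w [[+ dw] [Aw d_w]]; rewrite pev_deriv Aw derivM hornerD !hornerM d_w mulr0 add0r.
  by rewrite -pev_deriv => /eqP; rewrite mulf_eq0 (negPf dw) orbF => /eqP.
have [h2 Hh2 hh2] := minimal_divides d_min Hh h0.
have AE z : \forall w \near z^', pev w A = pev w (h2 * d) * pev w d.
  apply: (dnear_mp (dnear_and (Ah z) (hh2 z))) => w [-> ->].
  by rewrite /pev rmorphM.
have hd_k : kpoly (h2 * d) by apply: kpolyM.
have hd_neq0 : exists i, ~ mero_eq setT (h2 * d)`_i 0.
  apply: contrapT => none.
  have H : \forall w \near c0^', forall i : 'I_(size (h2 * d)), (h2 * d)`_i w = 0.
    apply: near_dnear_finite => i; have /contrapT hi : ~ ~ mero_eq setT (h2 * d)`_i 0.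
      by move=> hi; apply: none; exists i.
    by apply: (dnear_mp (hi c0 I)) => w.
  have [w _ [Hw Aw]] := dnear_exists (dnear_and H (AE c0)) ltr01.
  have hd0 : pev w (h2 * d) = 0.
    apply/polyP => i; rewrite pev_coef coef0.
    have [lt_i|le_i] := ltnP i (size (h2 * d)); first exact: (Hw (Ordinal lt_i)).
    by rewrite nth_default.
  by have := monic_neq0 (pev_monic w A_monic); rewrite Aw hd0 mul0r eqxx.
have [A2 [A2_monic HA2 _ A2E]] := monicize hd_k hd_neq0.
have A2_ann : annihilates c0 zeta A2.
  split=> // i; apply: (dnear_mp (dnear_and (A0 i) (dnear_and (AE c0) (A2E c0)))).
  move=> w [Aw [Aw2 [c c_neq0 A2w]]].
  have : (pev w (h2 * d)).[zeta i w] = 0.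
    move: Aw; rewrite Aw2 hornerM /pev rmorphM /= -/(pev w h2) -/(pev w d) hornerM.
    by move=> /eqP; rewrite !mulf_eq0 => /orP[/orP[]|] /eqP ->; rewrite ?mul0r ?mulr0.
  by rewrite A2w hornerZ => /eqP; rewrite mulf_eq0 (negPf c_neq0) => /eqP.
have le_A := A_le _ A2_ann.
have [w _ [Aw [c c_neq0 A2w]]] := dnear_exists (dnear_and (AE c0) (A2E c0)) ltr01.
have := pev_size w A_monic; rewrite Aw A2w -scalerAl size_scale //.
rewrite size_mul ?monic_neq0 ?pev_monic // !pev_size // => E; move: le_A.
rewrite -E leqNgt => /negP[].
by case: (size d) size_d => [|[|k]] // _; rewrite !addnS /= ltnS leq_addr.
Qed.

(** A divides B, so its roots are among the zeta_j; these are distinct and simple roots, which fixes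
    the degree. *)
Lemma annihilator_splits (A : {poly fn}) (B : {poly fn}) :
  minimal_annihilator c0 zeta A -> annihilates c0 zeta B ->
  (\forall w \near c0^', forall x, (pev w B).[x] = 0 -> exists j, x = zeta j w) ->
  size A = n.+1 /\ \forall w \near c0^', pev w A = \prod_i ('X - (zeta i w)%:P) /\
    separable_poly (pev w A).
Proof.
move=> A_min [B_monic HB B0] B_roots.
have [[A_monic HA A0] _] := A_min.
have [q Hq Bq] := minimal_divides A_min HB B0.
have simple := near_dnear_finite (fun j => minimal_simple_root j A_min).
have A_root := near_dnear_finite A0.
have dist : \forall w \near c0^', forall ij : 'I_n * 'I_n, ij.1 != ij.2 ->
    zeta ij.1 w != zeta ij.2 w.
  apply: near_dnear_finite => -[i j] /=; have [->|ij] := eqVneq i j.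
    by apply/dnearP; exists 1.
  by apply: (dnear_mp (zeta_neq ij)).
have H := dnear_and (dnear_and B_roots (Bq c0)) (dnear_and simple (dnear_and A_root dist)).
have key : \forall w \near c0^', [/\ size A = n.+1, injective (zeta ^~ w),
    separable_poly (pev w A) & forall i, (pev w A).[zeta i w] = 0].
  apply: (dnear_mp H) => w [[Br BA] [A' [Ar di]]].
  have A_sep : separable_poly (pev w A).
    rewrite unlock; apply: Pdiv.ClosedField.root_coprimep => x /rootP Ax.
    have [|j ->] := Br x; last exact: A'.
    by rewrite BA hornerM Ax mulr0.
  have z_inj : injective (zeta ^~ w).
    by move=> i j E; apply/eqP; apply: contraT => ij; have := di (i, j) ij; rewrite /= E eqxx.
  split=> //; have [s sE] := closed_field_poly_normal (pev w A).
  rewrite (monicP (pev_monic w A_monic)) scale1r in sE.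
  have s_uniq : uniq s by rewrite -separable_prod_XsubC -sE.
  have sz : size s = size (codom (zeta ^~ w)).
    apply/perm_size/uniq_perm => //; first exact/injectiveP.
    move=> x; rewrite -root_prod_XsubC -sE; apply/rootP/codomP => [Ax|[i ->]]; last exact: Ar.
    by apply: Br; rewrite BA hornerM Ax mulr0.
  by rewrite -(pev_size w A_monic) sE size_prod_XsubC sz size_codom card_ord.
have [w0 _ [A_size _ _ _]] := dnear_exists key ltr01.
split=> //; apply: (dnear_mp key) => w [_ z_inj A_sep Aw]; split=> //.
by apply: monic_roots_prod; rewrite ?pev_monic ?pev_size.
Qed.

End Splitting.

(** * Separability at generic points of the plane *)

Section Discriminant.
Variable R : realType.
Local Notation C := (CC R).
Local Notation fn := (C -> C).
Implicit Types (z w : C) (f g : fn) (p q A B : {poly fn}).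

Lemma pf_resultant p q : kpoly p -> kpoly q -> periodic_field (resultant p q).
Proof.
move=> Hp Hq; rewrite /resultant /determinant; apply: pf_sum => s _.
apply: pfM; first by case: (odd_perm s); rewrite ?expr1 ?expr0; first (apply: pfN; exact: pf1); exact: pf1.
by apply: pf_prod => i _; rewrite Sylvester_mxE; case: fintype.split => k; apply: pfMn.
Qed.

(** Nonzero values of the leading coefficients preserve the sizes, hence the shape of the Sylvester
    matrix. *)
Lemma resultant_eval w p q : lead_coef p w != 0 -> lead_coef q w != 0 ->
  resultant p q w = resultant (pev w p) (pev w q).
Proof.
rewrite -[lead_coef p w]/(evalf w (lead_coef p)) -[lead_coef q w]/(evalf w (lead_coef q)).
move=> p0 q0; rewrite /resultant /Sylvester_mx /pev !size_map_poly_id0 //.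
rewrite -[LHS]/(evalf w _) -det_map_mx /= map_col_mx; congr (\det (col_mx _ _));
  apply: map_lin1_mx => v; apply/rowP => j; rewrite !mxE -coef_map rmorphM /= map_rVpoly; exact: erefl.
Qed.

(** The resultant of A and A' is an element of k; being nonzero near c0, it is nonzero on a
    punctured neighbourhood of every point. *)
Lemma separable_generic A n c0 : A \is monic -> kpoly A -> size A = n.+1 ->
  (\forall w \near c0^', separable_poly (pev w A)) ->
  forall z, \forall w \near z^', separable_poly (pev w A).
Proof.
(* In degree 0 the derivative is zero, so it has no leading coefficient to which [resultant_eval]
   applies. *)
move=> A_monic HA; case: n => [|n] A_size c0_sep z.
  apply/dnearP; exists 1 => // w _ _.
  have /size1_polyC AE : (size (pev w A) <= 1)%N by rewrite pev_size ?A_size.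
  have := monicP (pev_monic w A_monic); rewrite AE lead_coefC => ->.
  by rewrite unlock derivC coprimep1 || rewrite unlock coprime1p.
have dn : A^`()`_n = n.+1%:R.
  by rewrite coef_deriv; have := monicP A_monic; rewrite lead_coefE A_size -pred_Sn => ->.
have dn_w w : (A^`()`_n) w = n.+1%:R.
  by rewrite dn -[LHS]/(evalf w _) rmorph_nat.
have size_d : size A^`() = n.+1.
  apply/eqP; rewrite eqn_leq -ltnS -A_size lt_size_deriv ?monic_neq0 //= ltnNge.
  apply/negP => le_n; have := dn_w 0; rewrite nth_default // => /esym/eqP.
  by rewrite pnatr_eq0.
have resE w : resultant A A^`() w = resultant (pev w A) (pev w A)^`().
  rewrite resultant_eval ?pev_deriv //; first by rewrite (monicP A_monic) oner_eq0.
  by rewrite lead_coefE size_d dn_w pnatr_eq0.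
have sepE w : separable_poly (pev w A) = (resultant A A^`() w != 0).
  rewrite resE resultant_eq0 unlock /coprimep -leqNgt leq_eqVlt ltnS leqn0.
  by rewrite size_poly_eq0 gcdp_eq0 (negPf (monic_neq0 (pev_monic w A_monic))) orbF.
have res_pf := pf_resultant HA (kpoly_deriv HA).
have res_neq0 : ~ mero_eq setT (resultant A A^`()) 0.
  move=> /(_ c0 I) H; have [w _ []] := dnear_exists (dnear_and c0_sep H) ltr01.
  by rewrite sepE => /eqP.
by apply: (dnear_mp (pf_propagation z res_pf res_neq0)) => w; rewrite sepE.
Qed.

End Discriminant.

(** * Generic horizontal lines *)

Section GenericPoint.
Variable R : realType.
Local Notation C := (CC R).
Local Notation fn := (C -> C).

Lemma countable_type (I : countType) : countable [set: I].
Proof. exact: countableP. Qed.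

Lemma uncountable_itv (r : R) : 0 < r -> ~ countable [set x : R | 0 < x < r].
Proof.
move=> r0 H; have := countable_lebesgue_measure0 H.
rewrite (_ : [set x | _] = `]0, r[%classic); last first.
  by apply/seteqP; split => x /=; rewrite in_itv.
rewrite lebesgue_measure_itv /= lte_fin r0 -EFinD subr0 => /eqP.
by rewrite eqe gt_eqF.
Qed.

(* Countably many heights are bad, so some horizontal line avoids them all. *)
Theorem generic_line (I J : countType) (G : I -> C -> Prop) (L : J -> C -> Prop)
    (c : C) (r : R) : 0 < r ->
  (forall i z, \forall w \near z^', G i w) ->
  (forall j z, nrm (z - c) < r -> \forall w \near z^', L j w) ->
  exists z, [/\ nrm (z - c) < r, forall j, L j z & forall i (t : R), G i (z + ofR t)].
Proof.
move=> r0 HG HL; pose D := [set z | nrm (z - c) < r].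
pose badG := \bigcup_(i in [set: I]) [set z | [set: C] z /\ ~ G i z].
pose badL := \bigcup_(j in [set: J]) [set z | D z /\ ~ L j z].
have cG : countable badG.
  by apply: bigcup_countable => [|i _]; [exact: countable_type|apply: countable_bad => z _].
have cL : countable badL.
  by apply: bigcup_countable => [|j _]; [exact: countable_type|apply: countable_bad => z /HL].
pose H := (fun z : C => complex.Im z - complex.Im c) @` (badG `|` badL).
have cH : countable H.
  apply: sub_countable (card_image_le _ _) _; rewrite -bigcup2E.
  by apply: bigcup_countable => [|[|[|i]] _] //=; exact: countable_type.
have [y [y0r yH]] : exists y : R, 0 < y < r /\ ~ H y.
  apply: contrapT => none; apply: (uncountable_itv r0).
  apply: sub_countable cH; apply: subset_card_le => y /= y0r.
  by apply: contrapT => yH; apply: none; exists y.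
pose z := c + (0 +i* y)%C.
have zE : complex.Im z - complex.Im c = y by rewrite /z; case: (c) => a b /=; rewrite addrC addKr.
have zc : nrm (z - c) < r.
  rewrite /z addrC addKr; apply: le_lt_trans (nrm_le_ReIm _) _ => /=.
  by rewrite normr0 add0r; case/andP: y0r => y0 yr; rewrite gtr0_norm.
exists z; split=> // [j|i t].
  apply: contrapT => nL; apply: yH; exists z => //; right; exists j => //.
apply: contrapT => nG; apply: yH; exists (z + ofR t); first by left; exists i.
by rewrite -zE; congr (_ - _); case: (z) => a b /=; rewrite addr0.
Qed.

End GenericPoint.

(** * Integer translations and germs of derivatives *)

Section Periodicity.
Variable R : realType.
Local Notation C := (CC R).
Local Notation fn := (C -> C).
Implicit Types (z w c : C) (f g : fn) (p q A B : {poly fn}).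

Lemma near_shift (P : C -> Prop) z c : (\forall w \near z + c, P w) ->
  \forall w \near z, P (w + c).
Proof.
move=> /nearP[r r0 H]; apply/nearP; exists r => // w lt_w; apply: H.
by rewrite opprD addrACA subrr addr0.
Qed.

Lemma kpoly_periodic p z : kpoly p -> \forall w \near z^', pev (w + 1) p = pev w p.
Proof.
move=> Hp; have H : \forall w \near z^', forall i : 'I_(size p), p`_i (w + 1) = p`_i w.
  by apply: near_dnear_finite => i; have /periodic_fieldP[_] := Hp i; apply.
apply: (dnear_mp H) => w Hw; apply/polyP => i; rewrite !pev_coef.
have [lt_i|le_i] := ltnP i (size p); first exact: (Hw (Ordinal lt_i)).
by rewrite nth_default.
Qed.

Lemma ofR_nat (m : nat) : ofR (m%:R : R) = m%:R.
Proof. exact: rmorph_nat. Qed.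

Lemma periodic_line p z :
  (forall t : R, \forall w \near z + ofR t, pev (w + 1) p = pev w p) ->
  forall m : nat, \forall w \near z, pev (w + m%:R) p = pev w p.
Proof.
move=> H; elim=> [|m IHm]; first by apply/nearP; exists 1 => // w _; rewrite addr0.
have := H m%:R; rewrite ofR_nat => /near_shift Hm.
by apply: (near_mp (near_and Hm IHm)) => w [E1 E2]; rewrite -addn1 natrD addrA E1.
Qed.

(* Otherwise, by periodicity, the polynomial of a generic point [z] would have
   all the roots [z + m + c]. *)
Lemma shift_not_root A c : A \is monic -> kpoly A ->
  ~ mero_eq setT (fun w => (pev w A).[w + c]) 0.
Proof.
move=> A_monic HA H.
pose G (_ : unit) w := (\forall v \near w, pev (v + 1) A = pev v A) /\
  (pev w A).[w + c] = 0.
have HG i z : \forall w \near z^', G i w.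
  by apply: dnear_and (dnear_open (kpoly_periodic z HA)) (H z I).
have [z [_ _ Hz]] := generic_line (L := fun _ : void => fun=> True) (c := 0) ltr01 HG
  (fun j => match j with end).
have per := periodic_line (fun t => (Hz tt t).1).
have roots (m : nat) : root (pev z A) (z + m%:R + c).
  by have := (Hz tt m%:R).2; rewrite ofR_nat (near_exists (per m)) => /rootP.
apply/negP: (monic_neq0 (pev_monic z A_monic)); rewrite negbK.
apply/eqP; apply: (@HolderAlgebra.poly_injective_roots _ _ (fun m => z + m%:R + c) 0) => [k l|k _].
  by move=> /addIr/HolderAlgebra.natr_injective.
exact/rootP.
Qed.

(** Used with c a natural number, to avoid the poles of Gamma, and with c a would-be constant value
    of zeta - nu, to exclude that this function is constant. *)
Lemma shift_generic A c : A \is monic -> kpoly A ->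
  forall z, \forall w \near z^', (pev w A).[w + c] != 0.
Proof.
move=> A_monic HA; apply: (mer_propagation _ (shift_not_root A_monic HA)) => z.
apply: mer_horner HA _.
by apply: holo_mer; apply: holoD; [exact: holo_id|exact: holo_cst].
Qed.

Lemma derive1_near f g z : (\forall w \near z, f w = g w) ->
  \forall w \near z, derive1 f w = derive1 g w.
Proof.
move=> H; apply: (near_mp (near_open H)) => w Hw; rewrite !derive1E.
exact: near_eq_derive.
Qed.

Lemma derive1n_near j f g z : (\forall w \near z, f w = g w) ->
  \forall w \near z, derive1n j f w = derive1n j g w.
Proof. by elim: j f g => [|j IHj] f g H //=; apply: derive1_near; apply: IHj. Qed.

Lemma derive1n_shift j f c z :
  derive1n j (fun u => f (u + c)) z = derive1n j f (z + c).
Proof.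
elim: j z => [//|j IHj] z; rewrite !derive1nS /derive1.
set d := (fun h : C => _); set d' := (fun h : C => _).
by suff -> : d = d' by []; apply/funext => h; rewrite /d /d' !IHj addrA.
Qed.

End Periodicity.

(** * Jets and their products *)

Section TaylorProduct.
Variable R : realType.
Local Notation C := (CC R).
Implicit Types (z w : C) (f g : C -> C) (p q : {poly C}) (r e : R) (a b : nat -> C).

Lemma taylor_coef_cvg f z0 r a (p : nat -> {poly C}) (M : R) k : 0 < r ->
  taylor f z0 r a ->
  (forall n z, nrm (z - z0) < r -> nrm (f z - (p n).[z - z0]) <= M * n.+1%:R^-1) ->
  (fun n => (p n)`_k) @ \oo --> a k.
Proof.
move=> r0 Ta Hp; have rho2 := half_itv r0; have [rho0 _] := andP rho2.
have rk0 : 0 < (r / 2) ^+ k by rewrite exprn_gt0.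
apply/cvgnP => e e0; have e1 : 0 < e * (r / 2) ^+ k by rewrite mulr_gt0.
exists (Num.bound (`|M| / (e * (r / 2) ^+ k))) => n le_n.
rewrite -(ltr_pM2r rk0); apply: le_lt_trans (Ta _ _ _ rho2 (Hp n) k) _.
rewrite ltr_pdivrMr ?ltr0n // mulrC -ltr_pdivrMr //.
apply: le_lt_trans (_ : `|M| / (e * (r / 2) ^+ k) < _).
  by rewrite ler_pM2r ?invr_gt0 // ler_norm.
apply: lt_le_trans (archi_boundP _) _; first by rewrite divr_ge0 // ltW.
by rewrite ler_nat (leq_trans le_n).
Qed.

(** The formula is exact for the coefficients of polynomial approximants and passes to the limit. *)
Lemma taylorM f g z0 r a b c : 0 < r -> apx f z0 r -> apx g z0 r ->
  taylor f z0 r a -> taylor g z0 r b -> taylor (fun z => f z * g z) z0 r c ->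
  forall k, c k = \sum_(i < k.+1) a i * b (k - i)%N.
Proof.
move=> r0 Hf Hg Ta Tb Tc k.
have inv0 m : 0 < (m.+1%:R : R)^-1 by rewrite invr_gt0 ltr0n.
have inv1 m : (m.+1%:R : R)^-1 <= 1 by rewrite invf_le1 ?ltr0n // ler1n.
have /choice[p Hp] m := apx_recenter Hf (inv0 m).
have /choice[q Hq] m := apx_recenter Hg (inv0 m).
have [[A A0 HA] [B B0 HB]] := (apx_bounded Hf, apx_bounded Hg).
have ca i : (fun n => (p n)`_i) @ \oo --> a i.
  by apply: (@taylor_coef_cvg f z0 r a p 1 i r0 Ta) => n z /Hp/ltW; rewrite mul1r.
have cb i : (fun n => (q n)`_i) @ \oo --> b i.
  by apply: (@taylor_coef_cvg g z0 r b q 1 i r0 Tb) => n z /Hq/ltW; rewrite mul1r.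
have cc : (fun n => (p n * q n)`_k) @ \oo --> c k.
  apply: (@taylor_coef_cvg _ z0 r c (fun n => p n * q n) (A + B + 1) k r0 Tc) => n z lt_z.
  have -> : f z * g z - (p n * q n).[z - z0] =
      (f z - (p n).[z - z0]) * g z + f z * (g z - (q n).[z - z0])
      - (f z - (p n).[z - z0]) * (g z - (q n).[z - z0]) by rewrite hornerM; ring.
  have [fz gz] := (HA _ lt_z, HB _ lt_z).
  have [pz qz] := (ltW (Hp n _ lt_z), ltW (Hq n _ lt_z)).
  apply: le_trans (nrmB _ _) _; rewrite [leRHS]mulrC [leRHS]mulrDr mulr1 lerD //.
    rewrite [leRHS]mulrDr [leRHS]addrC; apply: le_trans (nrmD _ _) _; rewrite !nrmM lerD //.
      by apply: ler_pM; rewrite ?nrm_ge0.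
    by rewrite [leLHS]mulrC; apply: ler_pM; rewrite ?nrm_ge0.
  rewrite nrmM -[leRHS]mulr1; apply: ler_pM; rewrite ?nrm_ge0 //.
  exact: le_trans qz (inv1 n).
apply: (cvg_unique _ cc).
  exact: norm_hausdorff.
rewrite (_ : (fun n => _) = (fun n => \sum_(i < k.+1) (p n)`_i * (q n)`_(k - i))).
  elim: k.+1 {cc} => [|m IHm].
    rewrite big_ord0 (_ : (fun n => _) = fun=> 0); first exact: cvg_cst.
    by apply/funext => n; rewrite big_ord0.
  rewrite big_ord_recr (_ : (fun n => _) = (fun n => \sum_(i < m) (p n)`_i * (q n)`_(k - i)) +
      (fun n => (p n)`_m * (q n)`_(k - m))); last by apply/funext => n; rewrite big_ord_recr.
  by apply: cvgD; [exact: IHm|apply: cvgM; [exact: ca|exact: cb]].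
by apply/funext => n; rewrite coefM.
Qed.

Definition jet f z J : {poly C} := \poly_(j < J.+1) (derive1n j f z / j`!%:R).

Lemma jet_coef f z J j : (j <= J)%N -> (jet f z J)`_j = derive1n j f z / j`!%:R.
Proof. by move=> le_j; rewrite coef_poly ltnS le_j. Qed.

Lemma fact_neq0 j : (j`!%:R : C) != 0.
Proof. by rewrite pnatr_eq0 -lt0n fact_gt0. Qed.

Lemma jet_taylor f z r a J j : 0 < r -> apx f z r -> taylor f z r a -> (j <= J)%N ->
  (jet f z J)`_j = a j.
Proof.
move=> r0 Hf Ta le_j; rewrite jet_coef // (taylor_derive1n j r0 Hf Ta) mulrC.
by rewrite mulKf ?fact_neq0.
Qed.

Lemma jetM f g z J j : holo f z -> holo g z -> (j <= J)%N ->
  (jet (fun w => f w * g w) z J)`_j = (jet f z J * jet g z J)`_j.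
Proof.
move=> Hf Hg le_j; have [r [r0 Af Ag]] := holo_apx2 Hf Hg.
have [[a Ta] [b Tb]] := (taylor_exists r0 Af, taylor_exists r0 Ag).
have Afg := apxM Af Ag; have [c Tc] := taylor_exists r0 Afg.
rewrite (jet_taylor r0 Afg Tc) // (taylorM r0 Af Ag Ta Tb Tc) coefM.
apply: eq_bigr => i _; have le_i : (i <= J)%N by rewrite (leq_trans _ le_j) -1?ltnS.
by rewrite (jet_taylor r0 Af Ta) // (jet_taylor r0 Ag Tb) // (leq_trans (leq_subr _ _)).
Qed.

Lemma jet0 f z J : (jet f z J)`_0 = f z.
Proof. by rewrite jet_coef // fact0 divr1. Qed.

Lemma jet_near f g z J : (\forall w \near z, f w = g w) -> jet f z J = jet g z J.
Proof.
move=> H; apply/polyP => j; rewrite !coef_poly; case: ltnP => // _.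
by rewrite (near_exists (derive1n_near j H)).
Qed.

Lemma jet_affine c f z J j : holo f z -> (j <= J)%N ->
  (jet (fun w => c - f w) z J)`_j = (c%:P - jet f z J)`_j.
Proof.
move=> [r r0 Hf] le_j; have [a Ta] := taylor_exists r0 Hf.
have Hg : apx (fun w => c - f w) z r by apply: apxB Hf; apply: apx_cst.
have Tg : taylor (fun w => c - f w) z r (fun j => (c%:P)`_j - a j).
  move=> rho e p Hrho Hp k.
  have := Ta rho e (c%:P - p) Hrho _ k.
  rewrite coefB -[X in X * _]nrmN opprB => H.
  rewrite (_ : p`_k - _ = a k - (c%:P`_k - p`_k)); last by ring.
  apply: H => w lt_w; rewrite hornerD hornerN hornerC -nrmN.
  by have := Hp _ lt_w; congr (nrm _ <= _); ring.
by rewrite (jet_taylor r0 Hg Tg) // coefB (jet_taylor r0 Hf Ta).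
Qed.

End TaylorProduct.

(** * The functions Gamma(nu + m - zeta) and coefficients in k(nu) *)

Section GammaOfRoots.
Variable R : realType.
Local Notation C := (CC R).
Local Notation fn := (C -> C).
Implicit Types (z w c : C) (f g : fn) (p q A : {poly fn}).

Lemma derive1n_0 j z : derive1n j (fun _ : C => 0 : C) z = 0.
Proof.
elim: j z => [//|j IHj] z; rewrite derive1Sn.
rewrite (_ : derive1 _ = fun=> 0) //; apply/funext => w.
have := has_derivative_poly (0 : {poly C}) w; rewrite deriv0 horner0.
by rewrite (_ : horner 0 = fun=> 0) => [/has_derivativeE|]; last by apply/funext => u; rewrite horner0.
Qed.

Lemma derive1_eq0_cst f z : holo f z -> (\forall w \near z, derive1 f w = 0) ->
  \forall w \near z, f w = f z.
Proof.
move=> Hf f'0; have [r r0 Hg] := holoB Hf (holo_cst (f z) z).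
have [a Ta] := taylor_exists r0 Hg.
have a0 k : a k = 0.
  case: k => [|k]; first by rewrite (taylor0 r0 Hg Ta) subrr.
  apply: (mulfI (fact_neq0 R k.+1)); rewrite mulr0 -(taylor_derive1n _ r0 Hg Ta).
  rewrite derive1Sn -[RHS](derive1n_0 k z); apply: (near_exists (derive1n_near k _)).
  apply: (near_mp f'0) => w <-; rewrite /derive1.
  set u := (fun h : C => _); set v := (fun h : C => _).
  suff -> : u = v by [].
  by apply/funext => h; rewrite /u /v opprB addrA subrK.
apply/nearP; exists r => // w /(taylor_eq0 Hg Ta a0)/eqP.
by rewrite subr_eq0 => /eqP.
Qed.

(** Source of the nonzero linear terms of the c_i: if the derivative vanished identically, f would
    be nu + c near z, and nu + c cannot be a root of [A] by [shift_generic]. *)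
Lemma root_derivative_neq1 A f z : A \is monic -> kpoly A -> holo f z ->
  vanishes_at A f z -> \forall w \near z^', derive1 (fun u => f u - u) w != 0.
Proof.
move=> A_monic HA Hf Af; have Hg := holoB Hf (holo_id z).
have [r r0 Hg'] := holo_derive1 Hg.
have [g'0|[k [g [d V]]]] := holo_dichotomy r0 Hg'; last first.
  by apply/dnearP; exists d; [case: V|exact: vanishing_order_neq0 V].
have gE : \forall w \near z, f w - w = f z - z.
  by apply: derive1_eq0_cst => //; apply/nearP; exists r.
have H := dnear_and Af (dnear_and (near_dnear gE) (shift_generic (f z - z) A_monic HA z)).
by have [w _ [fw []]] := dnear_exists H ltr01; move=> <-; rewrite subrKC fw eqxx.
Qed.

Lemma near_comp (P : C -> Prop) f z : holo f z -> (\forall w \near f z, P w) ->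
  \forall w \near z, P (f w).
Proof.
move=> Hf /nearP[r r0 HP]; apply: (near_mp (holo_continuous Hf r0)) => w.
exact: HP.
Qed.

Definition nonpole z := forall k : nat, z + k%:R != 0.

(** Within distance 1 of z only the k below |z| + 1 matter; these finitely many conditions are
    open. *)
Lemma nonpole_open z : nonpole z -> \forall w \near z, nonpole w.
Proof.
move=> Hz; pose N := Num.bound (nrm z + 1).
have H : \forall w \near z, forall k : 'I_N, w + (k : nat)%:R != 0.
  apply: near_finite => k; apply: (holo_neq0 (f := fun w => w + k%:R)) => //.
  by apply: holoD; [exact: holo_id|exact: holo_cst].
have H1 : \forall w \near z, nrm (w - z) < 1 by apply/nearP; exists 1.
apply: (near_mp (near_and H H1)) => w [Hw lt_w] k.
have [lt_k|le_k] := ltnP k N; first exact: (Hw (Ordinal lt_k)).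
apply/eqP => wk; have kE : k%:R = nrm (w - z + z).
  by rewrite subrK; move/eqP: wk; rewrite addr_eq0 => /eqP ->; rewrite nrmN nrm_nat.
have lt_k : k%:R < 1 + nrm z.
  by rewrite kE; apply: le_lt_trans (nrmD _ _) _; rewrite ltrD2r.
have lt_N : nrm z + 1 < N%:R by apply: archi_boundP; rewrite addr_ge0 ?nrm_ge0.
have := lt_le_trans lt_N (_ : N%:R <= k%:R); rewrite ler_nat addrC => /(_ le_k).
by rewrite ltNge ltW.
Qed.

Lemma holo_Gamma_comp f z : holo f z -> nonpole (f z) -> holo (fun w => Gamma (f w)) z.
Proof. by move=> Hf Hz; have [HG _ _] := Gamma_spec Hz; apply: holo_comp. Qed.

Lemma Gamma_jet_rec f z J m j : holo f z -> (forall k : nat, z - f z + k%:R != 0) -> (j <= J)%N ->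
  (jet (fun u => Gamma (u + m.+1%:R - f u)) z J)`_j =
  ((m%:R%:P - jet (fun u => f u - u) z J) * jet (fun u => Gamma (u + m%:R - f u)) z J)`_j.
Proof.
move=> Hf Hz le_j; have Hu := holo_id z; have Hfu := holoB Hf Hu.
have Hc k := holo_cst (k%:R : C) z.
have np k : nonpole (z + k%:R - f z).
  by move=> l; have := Hz (k + l)%N; rewrite natrD addrA [z - _ + _]addrAC.
have Hg := holoB (holoD Hu (Hc m)) Hf.
have nearE : \forall u \near z, Gamma (u + m.+1%:R - f u) =
    (m%:R - (f u - u)) * Gamma (u + m%:R - f u).
  apply: (near_mp (near_comp Hg (nonpole_open (np m)))) => u /Gamma_rec.
  rewrite -[m.+1]addn1 natrD addrA [_ + 1 - _]addrAC => ->.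
  by congr (_ * _); ring.
rewrite (jet_near J nearE) (jetM (holoB (Hc m) Hfu) (holo_Gamma_comp Hg (np m)) le_j).
rewrite !coefM; apply: eq_bigr => i _; congr (_ * _); apply: jet_affine => //.
by rewrite (leq_trans _ le_j) // -ltnS.
Qed.

Lemma holo_pev_id p z : (forall k, holo p`_k z) -> holo (fun w => (pev w p).[w]) z.
Proof.
move=> Hp; apply: (holo_ext (g := fun w => \sum_(i < size p) p`_i w * w ^+ i)).
  by move=> w; rewrite pev_coef_wide.
by apply: holo_sum => i _; apply: holoM; [exact: Hp|apply: holoX; exact: holo_id].
Qed.

Lemma kpoly_holo p z : kpoly p -> \forall w \near z^', forall k, holo p`_k w.
Proof.
move=> Hp; have H : \forall w \near z^', forall i : 'I_(size p), holo p`_i w.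
  by apply: near_dnear_finite => i; have /periodic_fieldP[/(_ z)/mer_holo] := Hp i.
apply: (dnear_mp H) => w Hw k; have [lt_k|le_k] := ltnP k (size p).
  exact: (Hw (Ordinal lt_k)).
by rewrite nth_default //; apply: holo_ext (holo_cst 0 w).
Qed.

Lemma kpoly_id_mer p z : kpoly p -> mer_at (fun w => (pev w p).[w]) z.
Proof. by move=> Hp; apply: mer_horner => //; apply: holo_mer; exact: holo_id. Qed.

(** Keeping polynomials over k evaluated at the identity, rather than plain functions, is what later
    makes the coefficients at z + m polynomials in m. *)
Lemma clear_denominators (T : eqType) (s : seq T) (a : T -> fn) :
  (forall i, rational_field (a i)) ->
  exists (P : T -> {poly fn}) (Q : {poly fn}), [/\ forall i, kpoly (P i), kpoly Q &
    forall z, \forall w \near z^', (pev w Q).[w] != 0 /\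
      forall i, i \in s -> (pev w (P i)).[w] = a i w * (pev w Q).[w]].
Proof.
move=> Ha; elim: s => [|i s [P [Q [HP HQ H]]]].
  exists (fun=> 1), 1; split=> [i||z]; [exact: kpoly1|exact: kpoly1|].
  by apply/dnearP; exists 1 => // w _ _; rewrite /pev rmorph1 hornerC oner_eq0.
have [p [q [Hp Hq q0 aq]]] := Ha i.
exists (fun k => if k == i then p * Q else P k * q), (Q * q); split=> [k||z].
- by case: eqP => _; exact: kpolyM.
- exact: kpolyM.
have q0' : \forall w \near z^', (pev w q).[w] != 0.
  apply: (mer_propagation (f := fun w => (pev w q).[w])) => [y|q00].
    exact: kpoly_id_mer.
  by apply: q0 => y Hy; apply: (dnear_mp (q00 y Hy)) => w; rewrite (pev_horner w q id).
have aq' : \forall w \near z^', a i w * (pev w q).[w] = (pev w p).[w].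
  by apply: (dnear_mp (aq z I)) => w; rewrite !(pev_horner w _ id).
have H' := H z.
apply: (dnear_mp (dnear_and (dnear_and H' q0') aq')) => w [[[Qw HPw] qw] aw].
rewrite {1 3}/pev !rmorphM !hornerM -!/(pev _ _) mulf_neq0 //; split=> // k.
rewrite inE; case: eqP => [-> _|_ /= k_s].
  rewrite {1}/pev rmorphM hornerM -!/(pev _ _) -aw; ring.
by rewrite {1}/pev rmorphM hornerM -!/(pev _ _) HPw // mulrA.
Qed.

End GammaOfRoots.

(** * Differential relations between Gamma functions *)

Section HolderRelation.
Variable R : realType.
Local Notation C := (CC R).
Local Notation fn := (C -> C).
Variables (n : nat) (Omega : set C) (zeta : 'I_n -> fn).
Hypothesis Omega_open : open Omega.
Hypothesis zeta_holo : forall i z, Omega z -> holo (zeta i) z.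
Hypothesis zeta_algebraic : forall i,
  algebraic_over Omega (@periodic_field R) (zeta i).
Hypothesis zeta_conj : conjugation_closed Omega (@periodic_field R) zeta.
Hypothesis zeta_distinct : forall i j, i <> j ->
  distinct_mod_int Omega (zeta i) (zeta j).

(** By the dichotomy for germs, failure would make zeta_i - zeta_j equal to m on a whole disc inside
    Omega. *)
Lemma zeta_sub_neq i j (m : int) z : i != j -> Omega z ->
  \forall w \near z^', zeta i w - zeta j w != m%:~R.
Proof.
move=> /eqP ij Oz.
have h := holoB (holoB (zeta_holo i Oz) (zeta_holo j Oz)) (holo_cst (m%:~R : C) z).
have [H|H] := mer_zero_or_neq0 (holo_mer h); last first.
  by apply: (dnear_mp H) => w; rewrite subr_eq0.
have HO : \forall w \near z, Omega w by apply: open_nbhs_nbhs; split.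
have [w _ [Hw Ow]] := dnear_exists (dnear_and (dnear_open H) (dnear_open (near_dnear HO))) ltr01.
have /nearP[r r0 Hr] := near_and Hw Ow.
case: (zeta_distinct ij (V := [set v | nrm (v - w) < r])).
- apply/openP => v /= lt_v; exists (r - nrm (v - w)); first by rewrite subr_gt0.
  move=> u lt_u; apply: le_lt_trans (nrm_triangle v _ _) _.
  by rewrite -ltrBrDr.
- by exists w; rewrite /= subrr nrm0.
- by move=> v /Hr[].
by exists m => v /Hr[/eqP]; rewrite subr_eq0 => /eqP.
Qed.

Lemma exists_minpoly i : exists p, is_minpoly Omega (@periodic_field R) (zeta i) p.
Proof.
have [p [Hp p_neq0 p0]] := zeta_algebraic i.
have [q [q_monic Hq _ qE]] := monicize Hp p_neq0.
pose Q (q : {poly fn}) := [/\ q \is monic, kpoly q & mero_eq Omega q.[zeta i] 0].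
have [|p1 [p1_monic Hp1 p10] p1_min] := @ex_min_size R Q.
  exists q; split=> // z Oz; apply: (dnear_mp (dnear_and (p0 z Oz) (qE z))) => w.
  case; rewrite -!pev_horner => pw [c c_neq0 pq]; move: pw; rewrite pq hornerZ.
  by move=> /eqP; rewrite mulf_eq0 (negPf c_neq0) => /eqP.
by exists p1; split=> // q' q'_monic Hq' q'0; apply: p1_min.
Qed.

(** By closure under conjugation, the product B of the minimal polynomials has no roots outside the
    family, but it repeats factors when two members are conjugate; the minimal annihilator removes
    the repetitions. *)
Lemma splitting_polynomial c0 : Omega c0 -> exists A : {poly fn},
  [/\ A \is monic, kpoly A, size A = n.+1,
    \forall w \near c0^', pev w A = \prod_i ('X - (zeta i w)%:P) &
    forall z, \forall w \near z^', separable_poly (pev w A)].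
Proof.
move=> Oc0; have zh i := zeta_holo i Oc0.
have /fin_all_exists[p Hp] := exists_minpoly.
have p_roots i : exists s : seq 'I_n,
    \forall w \near c0^', pev w (p i) = \prod_(j <- s) ('X - (zeta j w)%:P).
  have [s Hs] := zeta_conj (Hp i); exists s.
  pose q := \prod_(j <- s) ('X - (zeta j)%:P) : {poly fn}.
  pose N := maxn (size (p i)) (size q).
  have H : \forall w \near c0^', forall d : 'I_N, (p i)`_d w = q`_d w.
    by apply: near_dnear_finite => d; apply: Hs.
  apply: (dnear_mp H) => w Hw.
  have -> : \prod_(j <- s) ('X - (zeta j w)%:P) = pev w q.
    rewrite /pev rmorph_prod; apply: eq_bigr => j _.
    by rewrite rmorphB /= map_polyX map_polyC.
  apply/polyP => d; rewrite !pev_coef.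
  have [lt_d|] := ltnP d N; first exact: (Hw (Ordinal lt_d)).
  by rewrite geq_max => /andP[le1 le2]; rewrite !nth_default.
have /fin_all_exists[s Hs] := p_roots.
pose B := \prod_(i <- enum 'I_n) p i.
have B_ann : annihilates c0 zeta B.
  split; first by apply: monic_prod => i _; case: (Hp i).
    by apply: kpoly_prod => i; case: (Hp i).
  move=> i; have [_ _ pi0 _] := Hp i; apply: (dnear_mp (pi0 c0 Oc0)) => w.
  rewrite -pev_horner => Hw; rewrite /B big_enum (bigD1 i) //= /pev rmorphM hornerM.
  by rewrite -/(pev w (p i)) Hw mul0r.
have B_roots : \forall w \near c0^', forall x, (pev w B).[x] = 0 -> exists j, x = zeta j w.
  apply: (dnear_mp (near_dnear_finite Hs)) => w Hw x.
  rewrite /B /pev rmorph_prod horner_prod => /eqP; rewrite prodf_seq_eq0 => /hasP[i _ /= /eqP].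
  rewrite -/(pev w (p i)) Hw horner_prod => /eqP; rewrite prodf_seq_eq0 => /hasP[j _ /=].
  by rewrite hornerXsubC subr_eq0 => /eqP ->; exists j.
have [A A_ann A_le] := ex_min_size (ex_intro (annihilates c0 zeta) B B_ann).
have zneq i j : i != j -> \forall w \near c0^', zeta i w != zeta j w.
  move=> ij; apply: (dnear_mp (zeta_sub_neq 0 ij Oc0)) => w.
  by rewrite subr_eq0.
have [A_size A_split] := annihilator_splits zh zneq (conj A_ann A_le) B_ann B_roots.
have [A_monic HA _] := A_ann; exists A; split=> //.
  by apply: (dnear_mp A_split) => w [].
by apply: (separable_generic A_monic HA A_size); apply: (dnear_mp A_split) => w [].
Qed.

Variables (d : nat) (x : 'I_d -> 'I_n * nat).
Variables (s : seq (HolderAlgebra.exponent d)) (P : HolderAlgebra.exponent d -> {poly fn}).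
Hypothesis x_inj : injective x.
Hypothesis s_uniq : uniq s.
Hypothesis P_kpoly : forall mu, kpoly (P mu).

Definition relation (r : 'I_n -> fn) (w : C) : C := \sum_(mu <- s) (pev w (P mu)).[w] *
  \prod_(l < d) (derive1n (x l).2 (fun u => Gamma (u - r (x l).1 u)) w) ^+
    HolderAlgebra.mult mu l.

Lemma relation_local (r r' : 'I_n -> fn) (w0 : C) : (\forall w \near w0, forall i, r i w = r' i w) ->
  \forall w \near w0, relation r w = relation r' w.
Proof.
move=> E; have H l : \forall w \near w0, derive1n (x l).2 (fun u => Gamma (u - r (x l).1 u)) w =
    derive1n (x l).2 (fun u => Gamma (u - r' (x l).1 u)) w.
  by apply: derive1n_near; apply: (near_mp E) => w ->.
apply: (near_mp (near_finite H)) => w Hw; apply: eq_bigr => mu _; congr (_ * _).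
by apply: eq_bigr => l _; rewrite Hw.
Qed.

Lemma near_dnear_seq (T : eqType) (ts : seq T) (Q : T -> C -> Prop) (w0 : C) :
  (forall i, \forall w \near w0^', Q i w) ->
  \forall w \near w0^', forall i, i \in ts -> Q i w.
Proof.
move=> H; elim: ts => [|t ts IH]; first by apply/dnearP; exists 1.
apply: (dnear_mp (dnear_and (H t) IH)) => w [Ht Hts] i.
by rewrite inE => /orP[/eqP ->|/Hts].
Qed.

(** Only the fourth condition depends on [l]: over all natural numbers it keeps w - zeta_i(w) away
    from the poles of Gamma, while each single condition stays generic and their family
    countable. *)
Definition regular (A : {poly fn}) (l : nat) (w : C) :=
  [/\ forall k, holo A`_k w, \forall v \near w, pev (v + 1) A = pev v A,
    separable_poly (pev w A), (pev w A).[w + l%:R] != 0 &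
    forall mu, mu \in s -> (forall k, holo (P mu)`_k w) /\
      \forall v \near w, pev (v + 1) (P mu) = pev v (P mu)].

Lemma regular_generic A l : A \is monic -> kpoly A ->
  (forall z, \forall w \near z^', separable_poly (pev w A)) ->
  forall z, \forall w \near z^', regular A l w.
Proof.
move=> A_monic HA A_sep z.
have HP : \forall w \near z^', forall mu, mu \in s -> (forall k, holo (P mu)`_k w) /\
    \forall v \near w, pev (v + 1) (P mu) = pev v (P mu).
  apply: near_dnear_seq => mu; apply: dnear_and; first exact: kpoly_holo.
  exact: dnear_open (kpoly_periodic z (P_kpoly mu)).
have H1 := dnear_and (kpoly_holo z HA) (dnear_open (kpoly_periodic z HA)).
have H2 := dnear_and (A_sep z) (shift_generic l%:R A_monic HA z).
by apply: (dnear_mp (dnear_and (dnear_and H1 H2) HP)) => w [[[? ?] [? ?]] ?]; split.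
Qed.

Lemma root_nonpole A (r : 'I_n -> fn) (w : C) : (forall l, regular A l w) ->
  splits (fun v => pev v A) r w -> forall i, nonpole (w - r i w).
Proof.
move=> A_reg [_ /near_exists rA] i l; apply/eqP => E.
have [_ _ _ /eqP] := A_reg l; case.
rewrite rA horner_prod (bigD1 i) //= hornerXsubC (_ : w + _ - _ = 0) ?mul0r //.
by rewrite -[RHS]E addrAC.
Qed.

Lemma relation_holo A (r : 'I_n -> fn) (w : C) : (forall l, regular A l w) ->
  splits (fun v => pev v A) r w -> holo (relation r) w.
Proof.
move=> A_reg r_split; have [_ _ _ _ HP] := A_reg 0%N; have [r_holo _] := r_split.
rewrite /relation.
have H mu : mu \in s -> holo (fun w => (pev w (P mu)).[w] *
  \prod_(l < d) (derive1n (x l).2 (fun u => Gamma (u - r (x l).1 u)) w) ^+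
    HolderAlgebra.mult mu l) w.
  move=> mu_s; apply: holoM; first by apply: holo_pev_id; have [] := HP mu mu_s.
  apply: holo_prod => l _; apply: holoX; apply: holo_derive1n.
  apply: holo_Gamma_comp; last exact: (root_nonpole A_reg r_split).
  by apply: holoB; [exact: holo_id|exact: r_holo].
apply: (holo_ext (g := fun w => \sum_(mu <- s | mu \in s) (pev w (P mu)).[w] *
  \prod_(l < d) (derive1n (x l).2 (fun u => Gamma (u - r (x l).1 u)) w) ^+
    HolderAlgebra.mult mu l)).
  by move=> v; rewrite big_seq.
by apply: holo_sum => mu; apply: H.
Qed.

Section OnRegularLine.
Variables (A : {poly fn}) (z : C).
Hypothesis A_monic : A \is monic.
Hypothesis A_size : size A = n.+1.
Hypothesis A_reg : forall (t : R) l, regular A l (z + ofR t).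
Hypothesis z_split : splits (fun v => pev v A) zeta z.
Hypothesis z_rel : \forall w \near z, relation zeta w = 0.

(** The roots continued to z + m and translated back split A at z by periodicity, hence are the
    zeta_i up to a permutation. The polynomials over k are unchanged; only the point where they are
    evaluated becomes z + m. *)
Lemma relation_shift (m : nat) : exists2 tau : 'I_n -> 'I_n, injective tau &
  \sum_(mu <- s) (pev z (P mu)).[z + m%:R] * \prod_(l < d)
    (derive1n (x l).2 (fun u => Gamma (u + m%:R - zeta (tau (x l).1) u)) z) ^+
      HolderAlgebra.mult mu l = 0.
Proof.
have A_sep (t : R) : separable_poly (pev (z + ofR t) A) by have [] := A_reg t 0%N.
have A_holo (t : R) k : holo (fun w => (pev w A)`_k) (z + ofR t).
  have [Ak _ _ _ _] := A_reg t 0%N; apply: (holo_ext _ (Ak k)) => w.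
  exact: pev_coef.
have rel0 : relation_at (fun v => pev v A) relation z by exists zeta.
have [r [r_holo r_split] r_rel] := relation_continuation
  (fun w => pev_monic w A_monic) (fun w => etrans (pev_size w A_monic) A_size)
  A_holo A_sep (fun t r => relation_holo (A_reg t))
  (fun t r r' => @relation_local r r' (z + ofR t)) rel0 m%:R.
rewrite /= ofR_nat in r_holo r_split r_rel.
have A_per := periodic_line (fun t => let: And5 _ h _ _ _ := A_reg t 0%N in h) m.
have r'_split : splits (fun v => pev v A) (fun i u => r i (u + m%:R)) z.
  split=> [i|].
    apply: (@holo_comp R (fun u => u + m%:R) (r i)); last exact: r_holo.
    by apply: holoD; [exact: holo_id|exact: holo_cst].
  by apply: (near_mp (near_and A_per (near_shift r_split))) => u [<-].
have sep0 : separable_poly (pev z A) by have := A_sep 0; rewrite rmorph0 addr0.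
have [tau tau_inj tauE] := splitting_unique sep0 r'_split z_split.
exists tau => //; rewrite -[RHS](near_exists r_rel) /relation.
rewrite [LHS]big_seq [RHS]big_seq; apply: eq_bigr => mu mu_s; congr (_ * _).
  have P_per := periodic_line (fun t => let: And5 _ _ _ _ h := A_reg t 0%N in (h mu mu_s).2) m.
  by rewrite (near_exists P_per).
apply: eq_bigr => l _; congr (_ ^+ _); rewrite -derive1n_shift.
apply: (near_exists (derive1n_near _ _)).
by apply: (near_mp tauE) => u ->.
Qed.

Lemma coefficient_eq0 :
  (forall i, derive1 (fun u => zeta i u - u) z != 0) ->
  (forall i j (m : int), i != j -> zeta i z - zeta j z != m%:~R) ->
  forall mu, mu \in s -> (pev z (P mu)).[z] = 0.
Proof.
move=> dzeta zeta_neq mu mu_s.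
have z_reg l : regular A l z by have := A_reg 0 l; rewrite rmorph0 addr0.
have np i : nonpole (z - zeta i z) := root_nonpole z_reg z_split i.
have [z_holo _] := z_split.
(* The successor ensures J >= 1, so that the linear term of c_i belongs to its jet. *)
pose J := (\max_(l < d) (x l).2).+1.
have x_le l : ((x l).2 <= J)%N by apply: leqW; exact: (leq_bigmax (F := fun l => (x l).2)).
(* This composition is the coefficient at z + m as a polynomial in m; its value at m = 0 is the one
   sought. *)
have : pev z (P mu) \Po ('X + z%:P) = 0.
  apply: (@HolderAlgebra.jet_relations_trivial C n J d
    (fun i => jet (fun u => zeta i u - u) z J)
    (fun i m => jet (fun u => Gamma (u + m%:R - zeta i u)) z J) x
    (fun l => (x l).2`!%:R) s (fun mu => pev z (P mu) \Po ('X + z%:P))) => //.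
  - move=> i j k l ij; rewrite !jet0; have := zeta_neq i j (l%:Z - k%:Z) ij.
    apply: contraNneq => E; rewrite rmorphB /= -!pmulrn.
    have -> : zeta i z - zeta j z = zeta i z - z + k%:R - (zeta j z - z) - k%:R by ring.
    by rewrite E [_ + l%:R]addrC addrK.
  - by move=> i; rewrite jet_coef // divr1; exact: dzeta.
  - by move=> i m j le_j; exact: (Gamma_jet_rec m (z_holo i) (np i) le_j).
  - move=> i m; rewrite jet0; have [|_ + _] := @Gamma_spec R (z + m%:R - zeta i z) => //.
    by move=> k; have := np i (m + k)%N; rewrite natrD addrA [z - _ + _]addrAC.
  move=> m; have [tau tau_inj E] := relation_shift m; exists tau => //.
  rewrite -[RHS]E; apply: eq_bigr => nu _.
  rewrite horner_comp !hornerE [m%:R + z]addrC; congr (_ * _).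
  by apply: eq_bigr => l _; rewrite jet_coef // mulrC divfK ?fact_neq0.
by move=> /(congr1 (horner^~ 0)); rewrite horner_comp !hornerE.
Qed.

End OnRegularLine.

Lemma local_configuration A c0 : Omega c0 -> A \is monic -> kpoly A ->
  (\forall w \near c0^', pev w A = \prod_i ('X - (zeta i w)%:P)) ->
  (forall z, Omega z -> \forall w \near z^', relation zeta w = 0) ->
  exists c r, 0 < r /\ forall w, nrm (w - c) < r ->
    [/\ Omega w, splits (fun v => pev v A) zeta w, \forall v \near w, relation zeta v = 0 &
      forall i, derive1 (fun u => zeta i u - u) w != 0].
Proof.
move=> Oc0 A_monic HA A_split rel.
have O0 : \forall w \near c0, Omega w by apply: open_nbhs_nbhs.
have H1 := dnear_and (near_dnear O0) (dnear_open A_split).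
have D : \forall w \near c0^', forall i, derive1 (fun u => zeta i u - u) w != 0.
  apply: near_dnear_finite => i; apply: (root_derivative_neq1 A_monic HA).
    exact: zeta_holo.
  apply: (dnear_mp A_split) => w ->; rewrite horner_prod (bigD1 i) //=.
  by rewrite hornerXsubC subrr mul0r.
have H2 := dnear_and (dnear_open (rel c0 Oc0)) D.
have [c _ /nearP[r r0 Hr]] := dnear_exists (dnear_open (dnear_and H1 H2)) ltr01.
exists c, r; split=> // w /Hr[[Ow Aw] [Rw Dw]]; split=> //.
by split=> // i; apply: zeta_holo.
Qed.

(** Nonvanishing of a coefficient is itself a generic condition, so it can be imposed on the very
    point z where [coefficient_eq0] applies. *)
Theorem holder_coefficients : Omega !=set0 ->
  (forall z, Omega z -> \forall w \near z^', relation zeta w = 0) ->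
  forall mu, mu \in s -> mero_eq setT (fun w => (pev w (P mu)).[w]) 0.
Proof.
move=> [c0 Oc0] rel mu mu_s; apply: contrapT => mu_neq0.
have [A [A_monic HA A_size A_split A_sep]] := splitting_polynomial Oc0.
have [c [r [r0 Hr]]] := local_configuration Oc0 A_monic HA A_split rel.
pose G (l : nat) w := regular A l w /\ (pev w (P mu)).[w] != 0.
have HG l z : \forall w \near z^', G l w.
  apply: dnear_and; first exact: regular_generic.
  by apply: (mer_propagation _ mu_neq0) => y; apply: kpoly_id_mer.
(* These conditions are imposed at the point z only, since zeta is controlled on Omega and not along
   the line. *)
pose L (ijm : 'I_n * 'I_n * int) w := ijm.1.1 != ijm.1.2 ->
  zeta ijm.1.1 w - zeta ijm.1.2 w != ijm.2%:~R.
have HL ijm z : nrm (z - c) < r -> \forall w \near z^', L ijm w.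
  move=> /Hr[Oz _ _ _]; have [eq_ij|ij] := boolP (ijm.1.1 == ijm.1.2).
    by apply/dnearP; exists 1 => // w _ _; rewrite /L eq_ij.
  apply: (dnear_mp (zeta_sub_neq ijm.2 ij Oz)) => w Hw _.
  exact: Hw.
have [z [zc zL zG]] := generic_line r0 HG HL.
have [Oz z_split z_rel dzeta] := Hr z zc.
have A_reg (t : R) l : regular A l (z + ofR t) := (zG l t).1.
have := (zG 0%N 0).2; rewrite rmorph0 addr0.
rewrite (coefficient_eq0 A_monic A_size A_reg z_split z_rel dzeta) ?eqxx //.
by move=> i j m ij; apply: (zL (i, j, m)).
Qed.

End HolderRelation.

Theorem theorem6p1 (R : realType) (n : nat) (Omega : set (CC R))
    (zeta : 'I_n -> CC R -> CC R)
    (Omega_open : open Omega) (Omega_nonempty : Omega !=set0)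
    (zeta_analytic : forall i, analytic_on Omega (zeta i))
    (Gamma_analytic : forall i,
       analytic_on Omega (fun nu => Gamma (nu - zeta i nu)))
    (zeta_algebraic : forall i,
       algebraic_over Omega (@periodic_field R) (zeta i))
    (zeta_conj : conjugation_closed Omega (@periodic_field R) zeta)
    (zeta_distinct : forall i j, i <> j ->
       distinct_mod_int Omega (zeta i) (zeta j)) :
  differentially_independent Omega (@rational_field R)
    (fun i nu => Gamma (nu - zeta i nu)).
Proof.
move=> d x x_inj P P_rational P0 mu z _.
have zeta_holo i w : Omega w -> holo (zeta i) w by move=> /zeta_analytic/analytic_holo.
pose s : seq (HolderAlgebra.exponent d) := mpoly.msupp P.
have [mu_s|/mpoly.memN_msupp_eq0 ->] := boolP ((mu : HolderAlgebra.exponent d) \in s); last first.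
  by apply/dnearP; exists 1.
have [N [D [N_kpoly D_kpoly ND]]] := clear_denominators s P_rational.
have N0 : mero_eq setT (fun w => (pev w (N mu)).[w]) 0.
  apply: (@holder_coefficients R n Omega zeta _ _ _ _ _ d x s N) => //.
    exact: mpoly.msupp_uniq.
  move=> w Ow; apply: (dnear_mp (dnear_and (P0 w Ow) (ND w))) => u [Pu [_ Nu]].
  (* Multiplication by the common denominator at u turns the relation over K into one with
     coefficients in k[nu]. *)
  have := HolderAlgebra.eval_meval (evalf u)
    (fun l => derive1n (x l).2 (fun nu => Gamma (nu - zeta (x l).1 nu))) P.
  rewrite [LHS]Pu -/s => /(congr1 ( *%R^~ (pev u D).[u])); rewrite mul0r mulr_suml => E.
  rewrite [RHS]E /relation [LHS]big_seq [RHS]big_seq; apply: eq_bigr => nu nu_s.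
  by rewrite Nu // mulrAC.
apply: (dnear_mp (dnear_and (N0 z I) (ND z))) => w [Nw [Dw NDw]].
by move: Nw; rewrite NDw // => /eqP; rewrite mulf_eq0 (negPf Dw) orbF => /eqP.
Qed.
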